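(* Let $\delta>0$, let $V$ be a random variable in $[0,1]$, let $\Omega_\delta$ be a $\mathrm{GGC}(1,V/\delta)$ subordinator, and let $X\stackrel{d}{=}(1-V)/V$. Let $(\Sigma_t(V):t\ge 0)$ denote a subordinator with Lévy density $\rho_{\Sigma_1(V)}$ given below (its law depends on $V$ only through the distribution of $V$). (i) The Lévy density of a gamma$(1)$ subordinator with scale $1/\delta$ has the decomposition $$s^{-1}e^{-s\delta}=\delta\rho_{\Sigma_1(V)}(s\delta)+s^{-1}\mathbb{E}[e^{-s\delta/V}],$$ where $$\rho_{\Sigma_1(V)}(s)=\int_1^\infty e^{-sx}[1-F_{1/V}(x)]\,dx=\frac1s e^{-s}\big(1-\mathbb{E}[e^{-sX}]\big).$$ (ii) If $0<\varrho=\mathbb{E}[-\log(V)]<\infty$, then $\rho_{\Sigma_1(V)}(s)=\varrho f_{\Delta_{\mathbf e}(X)}(s)$, where $f_{\Delta_{\mathbf e}(X)}$ is the density of a random variable denoted $\Delta_{\mathbf e}(X)$. In this case $\Sigma_t(V)$ is a compound Poisson process representable as $$\Sigma_t(V)=\sum_{k=1}^{N(\varrho t)}\Delta_k,\qquad t\ge 0,$$ where $(\Delta_k)$ are i.i.d. random variables equal in distribution to $\Delta_{\mathbf e}(X)$. (iii) In general, for each fixed $\theta>0$, $$\gamma_\theta\stackrel{d}{=}\Sigma_\theta(V)+\gamma_\theta M_\theta,$$ where $\Sigma_\theta(V)$, $\gamma_\theta$ and $M_\theta$ on the right-hand side are independent and $M_\theta\stackrel{d}{=}\beta_{\theta,1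}M_\theta+(1-\beta_{\theta,1})V$.
   Context: Subordinators have zero drift and Laplace transform $\mathbb{E}[e^{-\omega\zeta(t)}]=\exp\{-t\int_0^\infty(1-e^{-\omega s})\rho_\zeta(s)ds\}$ with $\rho_\zeta$ the Lévy density. A $\mathrm{GGC}(\theta,R)$ subordinator ($\theta>0$, $R\ge0$ with $\mathbb{E}[\log(1+\omega R)]<\infty$) has Lévy density $\theta s^{-1}\mathbb{E}[e^{-s/R}]$ and Laplace exponent $\theta\,\mathbb{E}[\log(1+\omega R)]$. On $\{V=0\}$ the conventions are $1/V=X=\infty$ and $e^{-\infty}=0$. $F_{1/V}$ is the c.d.f. of $1/V$. $\gamma_\theta$ is gamma with shape $\theta$, scale $1$; $\beta_{a,b}$ is a beta$(a,b)$ variable; $N$ is a homogeneous Poisson process with $\mathbb{E}[N(s)]=s$, independent of $(\Delta_k)$. Variables on the right-hand side of the distributional identity for $M_\theta$ are independent. *)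

(* Defs.v *)
From HB Require Import structures.
From mathcomp Require Import all_boot all_order all_algebra.
From mathcomp Require Import all_classical all_reals all_analysis.
From mathcomp Require Import measurable_realfun.

Set Implicit Arguments.
Unset Strict Implicit.
Unset Printing Implicit Defensive.
Import Order.TTheory GRing.Theory Num.Theory.
Import numFieldNormedType.Exports.
Local Open Scope classical_set_scope.
Local Open Scope ring_scope.

Definition eq_law {d1 d2 d} {T1 : measurableType d1} {T2 : measurableType d2}
    {U : measurableType d} {R : realType} (P1 : probability T1 R)
    (X1 : T1 -> U) (P2 : probability T2 R) (X2 : T2 -> U) : Prop :=
  forall A : set U, measurable A -> P1 (X1 @^-1` A) = P2 (X2 @^-1` A).

Definition indep2 {d d1 d2} {T : measurableType d} {U1 : measurableType d1}
    {U2 : measurableType d2} {R : realType} (P : probability T R)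
    (X : T -> U1) (Y : T -> U2) : Prop :=
  forall (A : set U1) (B : set U2), measurable A -> measurable B ->
    P (X @^-1` A `&` Y @^-1` B) = (P (X @^-1` A) * P (Y @^-1` B))%E.

Definition mutual_indep {d d'} {T : measurableType d} {U : measurableType d'}
    {R : realType} {I : eqType} (P : probability T R) (X : I -> T -> U) : Prop :=
  forall (s : seq I) (A : I -> set U), uniq s ->
    (forall i, measurable (A i)) ->
    P (\bigcap_(i in [set` s]) X i @^-1` A i) =
    (\prod_(i <- s) P (X i @^-1` A i))%E.

Definition indep3 {d d'} {T : measurableType d} {U : measurableType d'}
    {R : realType} (P : probability T R) (X Y Z : T -> U) : Prop :=
  mutual_indep P (fun i : 'I_3 => tnth [tuple X; Y; Z] i).

Definition has_density {d} {T : measurableType d} {R : realType}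
    (P : probability T R) (X : T -> R) (f : R -> R) : Prop :=
  [/\ measurable_fun [set: R] f, forall x, 0 <= f x &
      forall A : set R, measurable A ->
        P (X @^-1` A) = (\int[lebesgue_measure]_(x in A) (f x)%:E)%E].

Definition Gamma_fun {R : realType} (a : R) : R :=
  \int[lebesgue_measure]_(x in `]0, +oo[) (x `^ (a - 1) * expR (- x)).

(* a is the shape and c the scale: the law of c * gamma_a *)
Definition gamma_pdf {R : realType} (a c x : R) : R :=
  if 0 < x then x `^ (a - 1) * expR (- (x / c)) / (Gamma_fun a * c `^ a)
  else 0.

(* The library's beta distribution only has natural number parameters. *)
Definition Beta_fun {R : realType} (a b : R) : R :=
  \int[lebesgue_measure]_(x in `]0, 1[) (x `^ (a - 1) * (1 - x) `^ (b - 1)).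

Definition real_beta_pdf {R : realType} (a b x : R) : R :=
  if 0 < x < 1 then x `^ (a - 1) * (1 - x) `^ (b - 1) / Beta_fun a b else 0.

(* Processes are indexed by all of R, but only times t >= 0 are constrained. *)
Definition subordinator {d} {T : measurableType d} {R : realType}
    (P : probability T R) (Z : R -> T -> R) : Prop :=
  [/\ forall t, 0 <= t -> measurable_fun [set: T] (Z t),
      {ae P, forall w, Z 0 w = 0},
      {ae P, forall w,
        (forall s t, 0 <= s -> s <= t -> Z s w <= Z t w) /\
        (forall t, 0 <= t -> Z s w @[s --> t^'+] --> Z t w)},
      forall t : nat -> R, 0 <= t 0%N -> (forall i, t i <= t i.+1) ->
        mutual_indep P (fun (i : nat) w => Z (t i.+1) w - Z (t i) w) &
      forall s t, 0 <= s -> 0 <= t ->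
        eq_law P (fun w => Z (s + t) w - Z s w) P (Z t)].

(* rho is the density on ]0, +oo[ of the Levy measure of a subordinator;
   its values off ]0, +oo[ are irrelevant. *)
Definition levy_density {R : realType} (rho : R -> \bar R) : Prop :=
  [/\ measurable_fun [set s : R | 0 < s] rho,
      forall s, 0 < s -> (0 <= rho s)%E &
      (\int[lebesgue_measure]_(s in `]0%R, +oo[)
          ((Num.min 1 s)%:E * rho s) < +oo)%E].

(* No linear term in the exponent: the drift is zero. *)
Definition has_levy_density {d} {T : measurableType d} {R : realType}
    (P : probability T R) (Z : R -> T -> R) (rho : R -> \bar R) : Prop :=
  [/\ subordinator P Z, levy_density rho &
      forall t omega : R, 0 <= t -> 0 <= omega ->
        (\int[P]_w (expR (- (omega * Z t w)))%:E =
         expeR (- (t%:E * \int[lebesgue_measure]_(s in `]0%R, +oo[)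
                            ((1 - expR (- (omega * s)))%:E * rho s))))%E].

(* In \bar R one has 0^-1 = +oo, and expeR -oo = 0, as required on {Q = 0}. *)
Definition expect_exp_inv {d} {T : measurableType d} {R : realType}
    (P : probability T R) (Q : T -> R) (s : R) : \bar R :=
  (\int[P]_w expeR (- (s%:E / (Q w)%:E)))%E.

Definition is_GGC {d d'} {T : measurableType d} {T' : measurableType d'}
    {R : realType} (P : probability T R) (theta : R) (P' : probability T' R)
    (Q : T' -> R) (Z : R -> T -> R) : Prop :=
  [/\ 0 < theta, measurable_fun [set: T'] Q, forall w, 0 <= Q w,
      forall omega : R, 0 < omega ->
        (\int[P']_w (ln (1 + omega * Q w))%:E < +oo)%E &
      has_levy_density P Z
        (fun s => ((theta / s)%:E * expect_exp_inv P' Q s)%E)].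

Definition gamma_subordinator {d} {T : measurableType d} {R : realType}
    (P : probability T R) (theta c : R) (Z : R -> T -> R) : Prop :=
  subordinator P Z /\
  forall t, 0 < t -> has_density P (Z t) (gamma_pdf (theta * t) c).

Definition poisson_process {d} {T : measurableType d} {R : realType}
    (P : probability T R) (N : R -> T -> nat) : Prop :=
  [/\ forall t, 0 <= t -> measurable_fun [set: T] (N t),
      subordinator P (fun t w => (N t w)%:R) &
      forall t (k : nat), 0 < t ->
        P (N t @^-1` [set k]) = (poisson_pmf t k)%:E].

(* Equality of all finite-dimensional distributions on times t >= 0. *)
Definition eq_fdd {d d'} {T : measurableType d} {T' : measurableType d'}
    {R : realType} (P : probability T R) (Y : R -> T -> R)
    (P' : probability T' R) (Z : R -> T' -> R) : Prop :=
  forall (n : nat) (t : n.-tuple R), (forall i, 0 <= tnth t i) ->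
    eq_law P (fun w => [tuple Y (tnth t i) w | i < n])
           P' (fun w => [tuple Z (tnth t i) w | i < n]).

Definition indep_process_seq {d} {T : measurableType d} {R : realType}
    (P : probability T R) (N : R -> T -> nat) (D : nat -> T -> R) : Prop :=
  forall (m n : nat) (t : m.-tuple R), (forall i, 0 <= tnth t i) ->
    indep2 P (fun w => [tuple N (tnth t i) w | i < m])
             (fun w => [tuple D k w | k < n]).

Definition cdf_inv {d} {T : measurableType d} {R : realType}
    (P : probability T R) (V : T -> R) (x : R) : \bar R :=
  P [set w | (((V w)%:E)^-1 <= x%:E)%E].

Definition rho_Sigma {d} {T : measurableType d} {R : realType}
    (P : probability T R) (V : T -> R) (s : R) : \bar R :=
  (\int[lebesgue_measure]_(x in `[1%R, +oo[)
     ((expR (- (s * x)))%:E * (1 - cdf_inv P V x)))%E.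

(* M =d beta M + (1 - beta) V with beta ~ beta(theta, 1): the right-hand side
   is built from independent copies B, M', V' on some probability space. *)
Definition M_equation {d d'} {T : measurableType d} {TV : measurableType d'}
    {R : realType} (theta : R) (PV : probability TV R) (V : TV -> R)
    (P : probability T R) (M : T -> R) : Prop :=
  exists (e : measure_display) (T' : measurableType e) (P' : probability T' R)
    (B M' V' : {RV P' >-> R}),
    [/\ indep3 P' B M' V', has_density P' B (real_beta_pdf theta 1),
        eq_law P' M' P M, eq_law P' V' PV V &
        eq_law P M P' (fun w => B w * M' w + (1 - B w) * V' w)].

(* Main.v *)
Require Import Defs.
From HB Require Import structures.
From mathcomp Require Import all_boot all_order all_algebra.
From mathcomp Require Import all_classical all_reals all_analysis.
From mathcomp Require Import measurable_realfun.
From mathcomp Require Import ring lra.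
Import Order.TTheory GRing.Theory Num.Theory.
Import numFieldNormedType.Exports.
Local Open Scope classical_set_scope.
Local Open Scope ring_scope.
Set Implicit Arguments.
Unset Strict Implicit.
Unset Printing Implicit Defensive.

(** Laplace transforms decide everything here: a nonnegative variable is
    determined by its Laplace transform ([laplace_unique]), so each identity
    between laws becomes an identity between functions of omega.

    (i) Integrating e^{-sx} against 1 - F_{1/V}(x) over x >= 1 and exchanging
    the integrals replaces the tail of 1/V by an integral of e^{-sx} between 1
    and 1/V, that is (e^{-s} - e^{-s/V}) / s; taking the mean gives
    [rho_Sigma_decomposition].  Frullani's integral
    [frullani] turns Levy densities of the form e^{-as}/s into logarithms, so
    that the exponent of Sigma is ln(1 + omega) - E ln(1 + omega V)
    ([laplace_exponent_rho_Sigma]).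

    (ii) The same integral with omega = 1/V - 1 shows that the total mass of the
    Levy density is E(- ln V), which makes it varrho times a probability
    density.  For a random sum of jumps counted by a Poisson process, splitting
    the sample space according to the values of the process at finitely many
    times makes the counts deterministic; on each piece the increments are sums
    over disjoint blocks of independent jumps.  Hence the increments of the
    random sum have, jointly, the law obtained by mixing the laws of such
    blocks over the increments of the count ([random_sum_increments]), which
    gives independence and stationarity; the generating function of the
    Poisson law gives the exponent.  Independent and stationary increments
    determine all finite-dimensional laws from the one-dimensional ones
    ([subordinators_eq_fdd]).

    (iii) Suppose that M has the law of B M + (1 - B) V.  The distance from M to
    [0, 1] is contracted by the factor B < 1 in this equation, so M lies in
    [0, 1] almost surely ([fixed_point_support]).  The integral of
    (1 + u (b m + (1 - b) v))^{-(theta + 1)} against the beta(theta, 1) density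
    in b is (1 + u m)^{-theta} / (1 + u v) ([beta_integral]); with
    psi(u) = E (1 + u M)^{-theta} the equation therefore reads
    E (1 + u M)^{-(theta + 1)} = psi(u) E (1 + u V)^{-1}, which is the linear
    differential equation psi' = - theta psi K' for K(u) = E ln(1 + u V).  So
    psi = e^{- theta K} ([cifarelli_regazzini]).  Conditionally on M, the
    Laplace transform of gamma_theta M is (1 + omega M)^{-theta}, with mean
    e^{- theta K(omega)}; multiplied by the transform of Sigma_theta this gives
    (1 + omega)^{-theta}, the transform of gamma_theta ([gamma_decomposition]).
    A solution M exists because iterating the equation from the point mass
    at 0 moves mass to the right inside [0, 1]: the distribution functions
    decrease to one that is fixed ([mix_fixed_point]). *)

(** * Integrals and independence *)

(** The pushforward along a measurable function, packaged with its measure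
    structure: an anonymous function carries no such structure by itself. *)
Definition image_measure {d d'} {T : measurableType d} {U : measurableType d'}
    {R : realType} (m : {measure set T -> \bar R}) (f : T -> U)
    (mf : measurable_fun setT f) : {measure set U -> \bar R} :=
  measure_function_pushforward__canonical__measure_function_Measure m mf.

Lemma ge0_integral_image d d' (T : measurableType d) (U : measurableType d')
    (R : realType) (m : {measure set T -> \bar R}) (X : T -> U)
    (mX : measurable_fun setT X) (f : U -> \bar R) :
  measurable_fun setT f -> (forall u, 0 <= f u)%E ->
  (\int[m]_w f (X w) = \int[image_measure m mX]_u f u)%E.
Proof.
move=> mf f0; have := @ge0_integral_pushforward _ _ _ _ _ _ mX m setT f measurableT mf.
by rewrite preimage_setT => ->.
Qed.

Lemma measurable_laplace_kernel (R : realType) (b : R) :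
  measurable_fun setT (fun x : R => (expR (- (b * x)))%:E).
Proof.
apply/measurable_EFinP; apply: measurableT_comp => //.
by apply: measurable_funN; exact: measurable_funM.
Qed.

Section measure_tools.
Context {d} {T : measurableType d} {R : realType}.
Local Open Scope ereal_scope.

Definition mfun_of d' (U : measurableType d') (f : T -> U)
  (mf : measurable_fun setT f) : {mfun T >-> U} :=
  HB.pack f (isMeasurableFun.Build _ _ _ _ f mf).

Lemma integral_probability_cst (P : probability T R) (r : \bar R) :
  \int[P]_w r = r.
Proof.
transitivity (r * P setT); first exact: integral_cst.
by rewrite probability_setT mule1.
Qed.

Lemma ge0_eq_law_integral d2 d' (T2 : measurableType d2)
    (U : measurableType d') (P1 : probability T R) (X1 : T -> U)
    (P2 : probability T2 R) (X2 : T2 -> U) (f : U -> \bar R) :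
  measurable_fun setT X1 -> measurable_fun setT X2 ->
  measurable_fun setT f -> (forall u, 0 <= f u) ->
  eq_law P1 X1 P2 X2 -> \int[P1]_w f (X1 w) = \int[P2]_w f (X2 w).
Proof.
move=> mX1 mX2 mf f0 X12.
rewrite (ge0_integral_image P1 mX1 mf f0) (ge0_integral_image P2 mX2 mf f0).
by apply: eq_measure_integral => A mA _; exact: X12.
Qed.

(** Both sides are finite measures in A of the same total mass, hence they
    agree once they agree on a pi-system that generates. *)
Lemma indep_event_gen d' (U : measurableType d') (P : probability T R)
    (E : set T) (Y : T -> U) (G : set (set U)) :
  measurable E -> measurable_fun setT Y ->
  measurable = <<s G >> -> setI_closed G -> G setT ->
  (forall A, G A -> P (E `&` Y @^-1` A) = P E * P (Y @^-1` A)) ->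
  forall A, measurable A -> P (E `&` Y @^-1` A) = P E * P (Y @^-1` A).
Proof.
move=> mE mY GE GI GT PG.
pose m1 := image_measure (mrestr P mE) mY.
have PE0 : (0 <= fine (P E))%R by rewrite fine_ge0.
pose m2 : {measure set U -> \bar R} := mscale (NngNum PE0) (image_measure P mY).
have m12 : forall A, measurable A -> m1 A = m2 A.
  move=> A mA; apply: (measure_unique G (fun=> setT)) => //.
  - by rewrite bigcup_const//; exists 0%N.
  - move=> B GB; rewrite /m1 /m2 /mscale /= /pushforward /mrestr /=.
    rewrite -[RHS]/((fine (P E))%:E * P (Y @^-1` B)).
    by rewrite setIC PG// fineK// fin_num_measure.
  - move=> k; rewrite /m1 /= /pushforward /mrestr /= preimage_setT setTI.
    by rewrite -ge0_fin_numE// fin_num_measure.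
move=> A /m12; rewrite /m1 /= /pushforward /mrestr /= setIC => ->.
rewrite -[LHS]/((fine (P E))%:E * P (Y @^-1` A)).
by rewrite fineK// fin_num_measure.
Qed.

(** The extension from the generators is made one variable at a time. *)
Lemma indep2_gen d1 d2 (U1 : measurableType d1) (U2 : measurableType d2)
    (P : probability T R) (X : T -> U1) (Y : T -> U2)
    (G1 : set (set U1)) (G2 : set (set U2)) :
  measurable_fun setT X -> measurable_fun setT Y ->
  measurable = <<s G1 >> -> setI_closed G1 -> G1 setT ->
  measurable = <<s G2 >> -> setI_closed G2 -> G2 setT ->
  (forall A B, G1 A -> G2 B ->
     P (X @^-1` A `&` Y @^-1` B) = P (X @^-1` A) * P (Y @^-1` B)) ->
  indep2 P X Y.
Proof.
move=> mX mY E1 I1 T1 E2 I2 T2 PG A B mA mB.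
have mXA : measurable (X @^-1` A) by rewrite -[_ @^-1` _]setTI; exact: mX.
apply: (indep_event_gen mXA mY E2 I2 T2) => // {mB}B GB.
have mB : measurable B by rewrite E2; exact: sub_sigma_algebra.
have mYB : measurable (Y @^-1` B) by rewrite -[_ @^-1` _]setTI; exact: mY.
rewrite setIC muleC; apply: (indep_event_gen mYB mX E1 I1 T1) => // {mXA mA}A GA.
by rewrite setIC muleC; exact: PG.
Qed.

(** Independence says that the joint law is the product of the laws, and then
    Tonelli applies. *)
Lemma indep2_integral d1 d2 (U1 : measurableType d1) (U2 : measurableType d2)
    (P : probability T R) (X : T -> U1) (Y : T -> U2) (f : U1 * U2 -> \bar R) :
  measurable_fun setT X -> measurable_fun setT Y ->
  measurable_fun setT f -> (forall u, 0 <= f u) -> indep2 P X Y ->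
  \int[P]_w f (X w, Y w) = \int[P]_w \int[P]_w' f (X w, Y w').
Proof.
move=> mX mY mf f0 XY.
pose X' := mfun_of mX; pose Y' := mfun_of mY.
have mXY : measurable_fun setT (fun w => (X w, Y w)).
  exact: measurable_fun_pair.
pose XY' := mfun_of mXY.
pose mXY' : {measure set (U1 * U2) -> \bar R} := distribution P XY'.
have E : forall A, measurable A ->
    (distribution P X' \x distribution P Y') A = mXY' A.
  apply: product_measure_unique => A B mA mB.
  by rewrite /mXY' /distribution /pushforward /= -XY.
rewrite (ge0_integral_image P mXY mf f0).
transitivity (\int[distribution P X' \x distribution P Y']_z f z).
  by apply: eq_measure_integral => A mA _; exact/esym/E.
rewrite fubini_tonelli1//.
have mF := measurable_fun_fubini_tonelli_F (m2 := distribution P Y') f mf f0.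
rewrite -(ge0_integral_image P mX mF); last by move=> x; exact: integral_ge0.
apply: eq_integral => w _; rewrite /fubini_F.
have mg : measurable_fun setT (fun y => f (X w, y)).
  exact: measurableT_comp mf (measurable_pair1 _).
exact/esym/(ge0_integral_image P mY mg).
Qed.

Lemma indep2_integralM d1 d2 (U1 : measurableType d1) (U2 : measurableType d2)
    (P : probability T R) (X : T -> U1) (Y : T -> U2)
    (f : U1 -> \bar R) (g : U2 -> \bar R) :
  measurable_fun setT X -> measurable_fun setT Y ->
  measurable_fun setT f -> measurable_fun setT g ->
  (forall u, 0 <= f u) -> (forall u, 0 <= g u) -> indep2 P X Y ->
  \int[P]_w (f (X w) * g (Y w)) = (\int[P]_w f (X w)) * \int[P]_w g (Y w).
Proof.
move=> mX mY mf mg f0 g0 XY.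
have := @indep2_integral _ _ _ _ P X Y (fun z => f z.1 * g z.2) mX mY.
move=> /= ->//; first last.
- by move=> u; rewrite mule_ge0.
- apply: emeasurable_funM.
    exact: (measurableT_comp mf measurable_fst).
  exact: (measurableT_comp mg measurable_snd).
rewrite -ge0_integralZr//.
- apply: eq_integral => w _; rewrite ge0_integralZl//.
  exact: (measurableT_comp mg).
- exact: (measurableT_comp mf).
- exact: integral_ge0.
Qed.

End measure_tools.

(** * Tuples of independent variables *)

(** Products of measurable sets form the pi-system on which laws of tuples are
    compared.  The factors are indexed by all of nat, so that shifting and
    truncating families needs no casts between ordinals. *)
Definition box d (U : measurableType d) n : set (set (n.-tuple U)) :=
  [set C | exists2 A : nat -> set U, (forall i, measurable (A i)) &
     C = [set t : n.-tuple U | forall i : 'I_n, A i (tnth t i)]].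

Lemma emeasurable_fun_prod d (T : measurableType d) (R : realType) (I : Type)
    (s : seq I) (f : I -> T -> \bar R) :
  (forall i, measurable_fun setT (f i)) ->
  measurable_fun setT (fun x => \prod_(i <- s) f i x)%E.
Proof.
move=> mf; elim: s => [|i s IH].
  by under eq_fun do rewrite big_nil; exact: measurable_cst.
by under eq_fun do rewrite big_cons; exact: emeasurable_funM.
Qed.

Section boxes.
Context d (U : measurableType d) (n : nat).

Lemma measurable_box C : @box d U n C -> measurable C.
Proof.
move=> [A mA ->]; rewrite (_ : [set _ | _] =
    \bigcap_(i in [set: 'I_n]) (@tnth n U ^~ i) @^-1` (A i)); last first.
  by apply/seteqP; split=> t /=; [move=> h i _; exact: h|move=> h i; exact: h].
apply: fin_bigcap_measurable; first exact: finite_finset.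
by move=> i _; rewrite -[_ @^-1` _]setTI; exact: measurable_tnth.
Qed.

Lemma box_gen : measurable = <<s @box d U n >>.
Proof.
apply/seteqP; split; last first.
  by apply: smallest_sub; [exact: sigma_algebra_measurable|exact: measurable_box].
apply: smallest_sub; first exact: smallest_sigma_algebra.
move=> C /=; rewrite -bigcup_seq/= => -[i _ [A mA <-]].
apply: sub_sigma_algebra.
exists (fun k => if k == i :> nat then A else setT).
  by move=> k; case: ifP.
rewrite setTI; apply/seteqP; split=> t /=.
  by move=> Ai j; case: ifPn => // /eqP ij; rewrite (_ : j = i)//; exact: val_inj.
by move=> /(_ i); rewrite eqxx.
Qed.

Lemma box_setI : setI_closed (@box d U n).
Proof.
move=> _ _ [A mA ->] [B mB ->]; exists (fun i => A i `&` B i).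
  by move=> i; exact: measurableI.
apply/seteqP; split=> t /=; first by move=> [hA hB] i; split.
by move=> h; split=> i; have [] := h i.
Qed.

Lemma box_setT : @box d U n setT.
Proof. by exists (fun=> setT) => //; apply/seteqP. Qed.

End boxes.

Lemma measurable_mktuple d d' (T : measurableType d) (U : measurableType d')
    n (X : nat -> T -> U) :
  (forall i, (i < n)%N -> measurable_fun setT (X i)) ->
  measurable_fun setT (fun w => [tuple X i w | i < n]).
Proof.
move=> mX; apply/measurable_fun_tnthP => i.
rewrite (_ : _ \o _ = X i); first exact: mX.
by apply/funext => w /=; rewrite tnth_mktuple.
Qed.

(** Independence of the first n members of a sequence, stated by the product
    rule for all n events at once; taking some of the events trivial recovers
    the rule for subfamilies. *)
Definition indep_upto {d d'} {T : measurableType d} {U : measurableType d'}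
    {R : realType} (P : probability T R) n (X : nat -> T -> U) : Prop :=
  forall A : nat -> set U, (forall i, measurable (A i)) ->
    P [set w | forall i, (i < n)%N -> A i (X i w)] =
    (\prod_(i < n) P (X i @^-1` A i))%E.

Section independence.
Context {d} {T : measurableType d} {R : realType} (P : probability T R).
Context {d'} {U : measurableType d'}.
Local Open Scope ereal_scope.

Lemma mutual_indep_upto a n (X : nat -> T -> U) :
  mutual_indep P X -> indep_upto P n (fun i => X (a + i)%N).
Proof.
move=> iX A mA.
have Ei : iota a n = [seq (a + i)%N | i <- index_iota 0 n].
  by rewrite /index_iota subn0 -iotaDl addn0.
have := iX (iota a n) (fun i => A (i - a)%N) (iota_uniq _ _) (fun i => mA _).
rewrite Ei big_map => hP.
transitivity (\prod_(i < n) P (X (a + i)%N @^-1` A (a + i - a)%N)).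
  rewrite -(big_mkord xpredT (fun i => P (X (a + i)%N @^-1` A (a + i - a)%N))).
  rewrite -hP; congr (P _); apply/seteqP; split=> w /=.
    move=> h k /= /mapP[i]; rewrite mem_index_iota => /andP[_ ilt] ->.
    by rewrite /= addKn; exact: h.
  move=> h i ilt; have := h (a + i)%N; rewrite /= addKn; apply.
  by apply/mapP; exists i => //; rewrite mem_index_iota.
by apply: eq_bigr => i _; rewrite addKn.
Qed.

Lemma indep_upto_box n (X : nat -> T -> U) (A : nat -> set U) :
  indep_upto P n X -> (forall i, measurable (A i)) ->
  P ((fun w => [tuple X i w | i < n]) @^-1`
     [set t : n.-tuple U | forall i : 'I_n, A i (tnth t i)]) =
  \prod_(i < n) P (X i @^-1` A i).
Proof.
move=> iX mA; rewrite -iX//; congr (P _); apply/seteqP; split=> w /= h i.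
  by move=> ilt; have := h (Ordinal ilt); rewrite tnth_mktuple.
by rewrite tnth_mktuple; exact: h.
Qed.

Lemma indep_upto_le m n (X : nat -> T -> U) : (m <= n)%N ->
  indep_upto P n X -> indep_upto P m X.
Proof.
move=> mn iX A mA.
have := iX (fun i => if (i < m)%N then A i else setT).
have mA' i : measurable (if (i < m)%N then A i else setT) by case: ifP.
move=> /(_ mA').
rewrite (_ : [set w | _] = [set w | forall i, (i < m)%N -> A i (X i w)]).
  move=> ->; rewrite (big_ord_widen n (fun i => P (X i @^-1` A i)) mn).
  rewrite [RHS]big_mkcond/=; apply: eq_bigr => i _.
  by case: ifP => // _; rewrite preimage_setT probability_setT.
apply/seteqP; split=> w /= h i.
  by move=> im; have := h i (leq_trans im mn); rewrite im.
by move=> _; case: ifP => // im; exact: h.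
Qed.

Lemma indep_upto_shift a n (X : nat -> T -> U) :
  indep_upto P (a + n) X -> indep_upto P n (fun i => X (a + i)%N).
Proof.
move=> iX A mA.
have := iX (fun i => if (i < a)%N then setT else A (i - a)%N).
have mA' i : measurable (if (i < a)%N then setT else A (i - a)%N).
  by case: ifP.
move=> /(_ mA').
rewrite big_split_ord/= big1 ?mul1e; last first.
  by move=> i _; rewrite ltn_ord preimage_setT probability_setT.
have -> : \prod_(i < n) P (X (a + i)%N @^-1`
    (if (a + i < a)%N then setT else A (a + i - a)%N)) =
    \prod_(i < n) P (X (a + i)%N @^-1` A i).
  by apply: eq_bigr => i _; rewrite ltnNge leq_addr/= addKn.
move=> <-; congr (P _); apply/seteqP; split=> w /= h i.
  move=> ilt; case: ifPn => //; rewrite -leqNgt => ai.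
  by have := h (i - a)%N; rewrite subnKC//; apply; rewrite ltn_subLR.
move=> ilt; have := h (a + i)%N.
by rewrite ltn_add2l [(a + i < a)%N]ltnNge leq_addr/= addKn; exact.
Qed.

(** On boxes this is the product rule split in two, and boxes generate. *)
Lemma indep_upto_group a n (X : nat -> T -> U) :
  (forall i, (i < a + n)%N -> measurable_fun setT (X i)) ->
  indep_upto P (a + n) X ->
  indep2 P (fun w => [tuple X i w | i < a]) (fun w => [tuple X (a + i)%N w | i < n]).
Proof.
move=> mX iX.
have mX1 : measurable_fun setT (fun w => [tuple X i w | i < a]).
  by apply: measurable_mktuple => i ia; apply: mX; rewrite ltn_addr.
have mX2 : measurable_fun setT (fun w => [tuple X (a + i)%N w | i < n]).
  by apply: (@measurable_mktuple _ _ _ _ _ (fun i => X (a + i)%N)) => i ia;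
     apply: mX; rewrite ltn_add2l.
apply: (indep2_gen mX1 mX2 (box_gen _ _) (@box_setI _ _ _) (box_setT _ _)
   (box_gen _ _) (@box_setI _ _ _) (box_setT _ _)).
move=> _ _ [A mA ->] [B mB ->].
rewrite (indep_upto_box (indep_upto_le (leq_addr _ _) iX) mA).
rewrite (@indep_upto_box _ (fun i => X (a + i)%N) _ (indep_upto_shift iX) mB).
pose C i := if (i < a)%N then A i else B (i - a)%N.
have mC i : measurable (C i) by rewrite /C; case: ifP.
have := iX C mC; rewrite big_split_ord/=.
have -> : \prod_(i < a) P (X i @^-1` C i) = \prod_(i < a) P (X i @^-1` A i).
  by apply: eq_bigr => i _; rewrite /C ltn_ord.
have -> : \prod_(i < n) P (X (a + i)%N @^-1` C (a + i)%N) =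
          \prod_(i < n) P (X (a + i)%N @^-1` B i).
  by apply: eq_bigr => i _; rewrite /C ltnNge leq_addr/= addKn.
move=> <-; congr (P _); apply/seteqP; split=> w /=.
  move=> [hA hB] i ilt; rewrite /C; case: ifPn => ia.
    by have := hA (Ordinal ia); rewrite tnth_mktuple.
  have ina : (i - a < n)%N by rewrite ltn_subLR// leqNgt.
  by have := hB (Ordinal ina); rewrite tnth_mktuple/= subnKC// leqNgt.
move=> h; split=> i; rewrite tnth_mktuple.
  by have := h i; rewrite /C ltn_ord; apply; rewrite ltn_addr.
have := h (a + i)%N; rewrite /C [(a + i < a)%N]ltnNge leq_addr/= addKn; apply.
by rewrite ltn_add2l.
Qed.

End independence.

Section independence2.
Context {d} {T : measurableType d} {R : realType} (P : probability T R).
Context {d'} {U : measurableType d'}.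
Local Open Scope ereal_scope.

Lemma eq_law_mktuple d2 (T2 : measurableType d2) (P2 : probability T2 R) n
    (X : nat -> T -> U) (X2 : nat -> T2 -> U) :
  (forall i, (i < n)%N -> measurable_fun setT (X i)) ->
  (forall i, (i < n)%N -> measurable_fun setT (X2 i)) ->
  indep_upto P n X -> indep_upto P2 n X2 ->
  (forall i, (i < n)%N -> eq_law P (X i) P2 (X2 i)) ->
  eq_law P (fun w => [tuple X i w | i < n]) P2 (fun w => [tuple X2 i w | i < n]).
Proof.
move=> mX mX2 iX iX2 X12 A mA.
pose m1 := image_measure P (measurable_mktuple mX).
pose m2 := image_measure P2 (measurable_mktuple mX2).
apply: (@measure_unique _ _ _ (@box _ U n) (fun=> setT) _ _ _ _ m1 m2) => //.
- exact: box_gen.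
- exact: box_setI.
- by move=> _; exact: box_setT.
- by rewrite bigcup_const//; exists 0%N.
- move=> _ [B mB ->]; rewrite /m1 /m2 /= /pushforward/=.
  rewrite (indep_upto_box iX mB) (indep_upto_box iX2 mB).
  by apply: eq_bigr => i _; exact: X12.
- by move=> _; rewrite /m1 /= /pushforward/= preimage_setT probability_setT ltry.
Qed.

(** The last variable is independent of the tuple of the previous ones, so the
    product can be peeled off one factor at a time. *)
Lemma indep_upto_integral_prod n (X : nat -> T -> U) (h : nat -> U -> \bar R) :
  (forall i, (i < n)%N -> measurable_fun setT (X i)) ->
  (forall i, measurable_fun setT (h i)) -> (forall i u, 0 <= h i u) ->
  indep_upto P n X ->
  \int[P]_w \prod_(i < n) h i (X i w) = \prod_(i < n) \int[P]_w h i (X i w).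
Proof.
move=> + mh h0; elim: n => [|n IH] mX iX.
  under eq_integral do rewrite big_ord0.
  by rewrite big_ord0 integral_probability_cst.
rewrite big_ord_recr/= -IH; first last.
- by apply: indep_upto_le iX.
- by move=> i ilt; apply: mX; rewrite ltnW.
have iX1 : indep_upto P (n + 1) X by rewrite addn1.
have mX1 : forall i, (i < n + 1)%N -> measurable_fun setT (X i).
  by move=> i; rewrite addn1; exact: mX.
have XX := indep_upto_group mX1 iX1.
have := @indep2_integralM _ _ _ _ _ _ _ P _ _
  (fun t : n.-tuple U => \prod_(i < n) h i (tnth t i))
  (fun t : 1.-tuple U => h n (thead t)) _ _ _ _ _ _ XX.
under eq_integral.
  move=> w _; rewrite (_ : thead _ = X n w); last first.
    by rewrite /thead tnth_mktuple addn0.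
  under eq_bigr do rewrite tnth_mktuple.
  over.
move=> H; under eq_integral do rewrite big_ord_recr/=.
rewrite H.
- congr (_ * _).
    by apply: eq_integral => w _; apply: eq_bigr => i _; rewrite tnth_mktuple.
  by apply: eq_integral => w _; rewrite /thead tnth_mktuple addn0.
- by apply: measurable_mktuple => i ilt; apply: mX; rewrite ltnW.
- apply: (@measurable_mktuple _ _ _ _ _ (fun i => X (n + i)%N)) => i.
  by rewrite ltnS leqn0 => /eqP ->; apply: mX; rewrite addn0.
- apply: emeasurable_fun_prod => i.
  by apply: measurableT_comp (mh i) _; exact: measurable_tnth.
- by apply: measurableT_comp (mh n) _; exact: measurable_tnth.
- by move=> t; apply: prode_ge0.
- by move=> t; exact: h0.
Qed.

End independence2.

(** * Uniqueness of the Laplace transform *)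

Section laws_on_the_line.
Context {R : realType}.
Local Open Scope ereal_scope.

Lemma eq_law_tail d1 d2 (T1 : measurableType d1) (T2 : measurableType d2)
    (P1 : probability T1 R) (P2 : probability T2 R)
    (X1 : T1 -> R) (X2 : T2 -> R) :
  measurable_fun setT X1 -> measurable_fun setT X2 ->
  (forall c, P1 (X1 @^-1` `]c, +oo[) = P2 (X2 @^-1` `]c, +oo[)) ->
  eq_law P1 X1 P2 X2.
Proof.
move=> mX1 mX2 H A mA.
have mX1A B : measurable B -> measurable (X1 @^-1` B).
  by move=> mB; rewrite -[_ @^-1` _]setTI; exact: mX1.
pose m1 := image_measure P1 mX1; pose m2 := image_measure P2 mX2.
pose G : set (set R) := [set B | exists x, B = `]x, +oo[%classic].
have mG : (measurable : set (set R)) = <<s G >>.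
  exact: RGenOInfty.measurableE.
change (m1 A = m2 A).
pose g (k : nat) : set R := `](- k%:R)%R, +oo[%classic.
apply: (@measure_unique _ R _ G g mG _ _ _ m1 m2) => //.
- move=> _ _ [x ->] [y ->]; exists (Num.max x y); apply/seteqP; split=> z /=.
    by rewrite !in_itv/= !andbT gt_max => -[-> ->].
  by rewrite !in_itv/= !andbT gt_max => /andP[-> ->].
- by move=> k; exists (- k%:R)%R.
- apply/seteqP; split=> x //= _; exists (Num.trunc (- x)).+1 => //=.
  rewrite /g /= in_itv/= andbT ltrNl.
  by rewrite truncnS_gt.
- by move=> _ [x ->]; exact: H.
- move=> k; rewrite /m1 /= /pushforward (@le_lt_trans _ _ 1)//; last by rewrite ltry.
  by apply/probability_le1/mX1A; exact: measurable_itv.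
Qed.

Lemma integrable_bounded d (T : measurableType d) (P : probability T R)
    (f : T -> R) (M : R) :
  measurable_fun setT f -> (forall w, `|f w| <= M)%R ->
  P.-integrable setT (EFin \o f).
Proof.
move=> mf fM; apply: measurable_bounded_integrable => //.
- by rewrite -ge0_fin_numE// fin_num_measure.
- exists M; split; first exact: num_real.
  by move=> x Mx w _ /=; rewrite (le_trans (fM w))// ltW.
Qed.

Lemma integrable01 d (T : measurableType d) (P : probability T R) (f : T -> R) :
  measurable_fun setT f -> (forall w, 0 <= f w <= 1)%R ->
  P.-integrable setT (EFin \o f).
Proof.
move=> mf f01; apply: (@integrable_bounded _ _ _ _ 1%R) => // w.
by have /andP[f0 f1] := f01 w; rewrite ger0_norm.
Qed.

Lemma integral01_fin d (T : measurableType d) (P : probability T R) (f : T -> R) :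
  measurable_fun setT f -> (forall w, 0 <= f w <= 1)%R ->
  \int[P]_w (f w)%:E \is a fin_num.
Proof. by move=> mf f01; apply: integrable_fin_num => //; exact: integrable01. Qed.

(** Combinations of the functions e^{-jnx}, hence of values of the Laplace
    transform, approximate the indicator of ]c, +oo[ on x >= 0:
    (1 - e^{-nx})^k with k of order n e^{nc} tends to 1 if x > c, where
    k e^{-nx} tends to 0, and to 0 if x <= c, where k e^{-nx} >= n. *)
Let kn (c : R) (n : nat) : nat := (Num.trunc (n%:R * expR (n%:R * c))).+1.

Let pn (c : R) (n : nat) (x : R) : R :=
  (1 - expR (- (n%:R * x))) ^+ kn c n.

Let bernoulli_ge (y : R) k : (0 <= y <= 1 -> 1 - k%:R * y <= (1 - y) ^+ k)%R.
Proof.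
move=> /andP[y0 y1]; elim: k => [|k IH]; first by rewrite mul0r subr0 expr0.
have [h|h] := leP 0%R (1 - k%:R * y)%R.
  rewrite exprS; have : ((1 - y) * (1 - k%:R * y) <= (1 - y) * (1 - y) ^+ k)%R.
    by apply: ler_wpM2l => //; rewrite subr_ge0.
  apply: le_trans; rewrite -natr1.
  have : (0 <= k%:R * y * y)%R by rewrite !mulr_ge0.
  rewrite mulrDl mul1r; move: (k%:R * y)%R => z zy.
  by rewrite -subr_ge0 (_ : _ - _ = z * y)%R//; ring.
rewrite (@le_trans _ _ 0%R)//; last by rewrite exprn_ge0// subr_ge0.
rewrite -natr1; move: h; move: (k%:R : R) => z; lra.
Qed.

(** Above c the error is at most k e^{-nx} by Bernoulli's inequality, below c it
    is at most e^{- k e^{-nx}}; both are of order 1/n. *)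
Let pn_bound (c x : R) : (0 <= c -> 0 <= x -> exists K : R, forall n,
  `|pn c n x - (c < x)%R%:R| <= K * harmonic n)%R.
Proof.
move=> c0 x0.
have y01 n : (0 <= expR (- (n%:R * x)) <= 1)%R.
  by rewrite expR_ge0/= expR_le1 oppr_le0 mulr_ge0.
have pn01 n : (0 <= pn c n x <= 1)%R.
  have /andP[a b] := y01 n.
  by rewrite exprn_ge0 ?subr_ge0//= exprn_ile1// ?subr_ge0// gerBl.
have [cx|xc] := ltP c x.
  pose e := (x - c)%R; have e0 : (0 < e)%R by rewrite subr_gt0.
  pose C : R := (1 + 2 / e)%R.
  exists (C ^+ 2)%R => n; have /andP[p0 p1] := pn01 n.
  rewrite ler0_norm ?subr_le0// opprB.
  have H1 : (1 - pn c n x <= (kn c n)%:R * expR (- (n%:R * x)))%R.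
    by rewrite lerBlDr -lerBlDl; apply: bernoulli_ge.
  apply: (le_trans H1).
  have H2 : ((kn c n)%:R <= n%:R * expR (n%:R * c) + 1 :> R)%R.
    rewrite /kn -natr1 lerD2r.
    by rewrite truncn_le mulr_ge0// expR_ge0.
  have H3 : ((kn c n)%:R * expR (- (n%:R * x)) <= (n%:R + 1) * expR (- (n%:R * e)))%R.
    apply: (@le_trans _ _ ((n%:R * expR (n%:R * c) + 1) * expR (- (n%:R * x))))%R.
      by rewrite ler_wpM2r// expR_ge0.
    rewrite mulrDl mul1r [X in (_ <= X)%R]mulrDl mul1r; apply: lerD.
      by rewrite -mulrA -expRD ler_wpM2l// ler_expR /e; lra.
    rewrite ler_expR lerN2 ler_wpM2l//.
    by rewrite /e gerBl.
  apply: (le_trans H3).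
  have H4 : ((1 + n%:R * e / 2) ^+ 2 <= expR (n%:R * e))%R.
    have -> : (n%:R * e = (n%:R * e / 2) * 2%:R)%R by field.
    by rewrite expRM_natr mulfK// lerXn2r ?nnegrE ?expR_ge0 ?expR_ge1Dx//
      addr_ge0// divr_ge0// mulr_ge0// ltW.
  have b0 : (0 < 1 + n%:R * e / 2)%R.
    by rewrite ltr_pwDl// divr_ge0// mulr_ge0// ltW.
  have H5 : (n%:R + 1 <= C * (1 + n%:R * e / 2))%R.
    rewrite (_ : C * (1 + n%:R * e / 2) =
        (n%:R + 1) + (2 / e + n%:R * e / 2))%R; last by rewrite /C; field; exact: lt0r_neq0.
    by rewrite lerDl addr_ge0// divr_ge0// ?mulr_ge0// ltW.
  rewrite expRN /=.
  have n10 : (0 < n.+1%:R :> R)%R by [].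
  rewrite ler_pdivrMr ?expR_gt0// mulrAC ler_pdivlMr//.
  apply: (@le_trans _ _ (C ^+ 2 * (1 + n%:R * e / 2) ^+ 2)%R); last first.
    by rewrite ler_wpM2l// exprn_even_ge0.
  by rewrite -exprMn natr1 -expr2 lerXn2r ?nnegrE// ?(le_trans _ H5)// -natr1// addr_ge0.
exists 1%R => n; have /andP[p0 p1] := pn01 n.
rewrite subr0 ger0_norm// mul1r.
have /andP[a b] := y01 n.
have H1 : (pn c n x <= expR (- ((kn c n)%:R * expR (- (n%:R * x)))))%R.
  rewrite -mulrN mulrC expRM_natr /pn lerXn2r ?nnegrE ?subr_ge0 ?expR_ge0//.
  exact: expR_ge1Dx.
apply: (le_trans H1); rewrite expRN /= lef_pV2 ?posrE ?expR_gt0//.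
apply: le_trans (expR_ge1Dx _); rewrite -natr1 addrC lerD2l.
have H2 : (n%:R * expR (n%:R * c) <= (kn c n)%:R)%R by exact/ltW/truncnS_gt.
apply: (@le_trans _ _ (n%:R * expR (n%:R * c) * expR (- (n%:R * x)))%R).
  rewrite -mulrA -expRD ler_peMr// -expR0 ler_expR -mulrBr mulr_ge0// subr_ge0//.
by rewrite ler_wpM2r.
Qed.

Let pn_integral d (T : measurableType d) (P : probability T R) (X : T -> R) c n :
  measurable_fun setT X -> (forall w, 0 <= X w)%R ->
  \int[P]_w (pn c n (X w))%:E =
  \sum_(j < (kn c n).+1) (((-1) ^+ j *+ 'C(kn c n, j))%:E *
     \int[P]_w (expR (- ((j * n)%:R * X w)))%:E).
Proof.
move=> mX X0.
have mE a : measurable_fun setT (fun w => expR (- (a * X w)))%R.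
  by apply/measurable_EFinP; exact: (measurableT_comp (measurable_laplace_kernel a) mX).
have iE (j : nat) : P.-integrable setT (EFin \o (fun w => expR (- ((j * n)%:R * X w))))%R.
  by apply: integrable01 => // w; rewrite expR_ge0/= expR_le1 oppr_le0 mulr_ge0.
transitivity (\int[P]_w (\sum_(j < (kn c n).+1)
   (((-1) ^+ j *+ 'C(kn c n, j))%:E * (expR (- ((j * n)%:R * X w)))%:E))).
  apply: eq_integral => w _; rewrite /pn exprBn -sumEFin; apply: eq_bigr => j _.
  rewrite expr1n mulr1 -EFinM; congr (_%:E).
  by rewrite [RHS]mulrnAl -expRM_natl natrM mulrN mulrA.
rewrite integral_sum//.
  by apply: eq_bigr => j _; rewrite integralZl//; exact: iE.
by move=> j; apply: integrableZl => //; exact: iE.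
Qed.

Let tail_limit d (T : measurableType d) (P : probability T R) (X : T -> R) c :
  measurable_fun setT X -> (forall w, 0 <= X w)%R -> (0 <= c)%R ->
  \int[P]_w (pn c n (X w))%:E @[n --> \oo] --> P (X @^-1` `]c, +oo[).
Proof.
move=> mX X0 c0.
have mXc : measurable (X @^-1` `]c, +oo[).
  by rewrite -[_ @^-1` _]setTI; exact: mX.
rewrite -(setIT (X @^-1` _)) -integral_indic//.
apply: (@dominated_cvg _ _ _ P setT measurableT (fun n w => (pn c n (X w))%:E) _ (cst 1)) => //.
- move=> n; apply/measurable_EFinP; apply: measurable_funX.
  apply: measurable_funB => //; apply: measurableT_comp => //.
  by apply: measurable_funN; apply: measurable_funM.
- move=> w _; apply: cvg_EFin; first exact: nearW.
  have [K HK] := pn_bound c0 (X0 w).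
  rewrite indicE (_ : (w \in _) = (c < X w)%R); last first.
    by apply/idP/idP; rewrite inE /= in_itv/= andbT.
  apply/subr_cvg0/norm_cvg0P/(@squeeze_cvgr _ _ _ _ (cst 0%R) (fun n => K * harmonic n)%R).
  + by apply: nearW => n /=; rewrite normr_ge0 HK.
  + exact: cvg_cst.
  + by rewrite -[X in _ --> X](mulr0 K); apply: cvgMr; exact: cvg_harmonic.
- by apply: (@integrable01 _ _ _ (cst 1%R)) => // w; rewrite /= ler01 lexx.
- move=> n w _; rewrite lee_fin /=.
  have y01 : (0 <= expR (- (n%:R * X w)) <= 1)%R.
    by rewrite expR_ge0/= expR_le1 oppr_le0 mulr_ge0.
  have /andP[a b] := y01.
  by rewrite ger0_norm ?exprn_ge0 ?subr_ge0//= exprn_ile1// ?subr_ge0// gerBl.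
Qed.

(** Equal transforms give equal approximations of P(X > c), hence equal limits;
    for c < 0 both tails are 1. *)
Let laplace_unique_ge0 d1 d2 (T1 : measurableType d1) (T2 : measurableType d2)
    (P1 : probability T1 R) (P2 : probability T2 R)
    (X1 : T1 -> R) (X2 : T2 -> R) :
  measurable_fun setT X1 -> measurable_fun setT X2 ->
  (forall w, 0 <= X1 w)%R -> (forall w, 0 <= X2 w)%R ->
  (forall omega : R, (0 <= omega)%R ->
    \int[P1]_w (expR (- (omega * X1 w)))%:E =
    \int[P2]_w (expR (- (omega * X2 w)))%:E) ->
  eq_law P1 X1 P2 X2.
Proof.
move=> mX1 mX2 X10 X20 L; apply: eq_law_tail => // c.
have [c0|c0] := leP 0%R c.
  have h1 := @tail_limit _ _ P1 _ _ mX1 X10 c0; have h2 := @tail_limit _ _ P2 _ _ mX2 X20 c0.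
  have E : (fun n => \int[P1]_w (pn c n (X1 w))%:E) =
           (fun n => \int[P2]_w (pn c n (X2 w))%:E).
    apply/funext => n; rewrite !pn_integral//; apply: eq_bigr => j _.
    by rewrite L// mulr_ge0.
  by rewrite E in h1; exact: (cvg_unique _ h1 h2).
rewrite (_ : X1 @^-1` _ = setT); last first.
  by apply/seteqP; split=> w //= _; rewrite in_itv/= andbT (lt_le_trans c0).
rewrite (_ : X2 @^-1` _ = setT); last first.
  by apply/seteqP; split=> w //= _; rewrite in_itv/= andbT (lt_le_trans c0).
by rewrite !probability_setT.
Qed.


Lemma measure_ae_eq d (T : measurableType d) (P : probability T R) (A B : set T) :
  measurable A -> measurable B -> {ae P, forall w, A w <-> B w} -> P A = P B.
Proof.
move=> mA mB AB.
rewrite -(setIT A) -(setIT B) -!integral_indic//.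
apply: ge0_ae_eq_integral => //.
- exact/measurable_EFinP/measurable_indic.
- exact/measurable_EFinP/measurable_indic.
- apply: filterS AB => w AB _; rewrite /= !indicE; congr (_%:R%:E).
  by congr nat_of_bool; apply/idP/idP; rewrite !inE; apply AB.
Qed.

Lemma eq_law_ae d1 d (T1 : measurableType d1) (U : measurableType d)
    (P1 : probability T1 R) (X Y : T1 -> U) :
  measurable_fun setT X -> measurable_fun setT Y ->
  {ae P1, forall w, X w = Y w} -> eq_law P1 X P1 Y.
Proof.
move=> mX mY XY A mA; apply: measure_ae_eq.
- by rewrite -[_ @^-1` _]setTI; exact: mX.
- by rewrite -[_ @^-1` _]setTI; exact: mY.
- by apply: filterS XY => w /= ->.
Qed.

(** The transform does not see null sets, so the variables can be replaced by
    their positive parts. *)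
Lemma laplace_unique d1 d2 (T1 : measurableType d1) (T2 : measurableType d2)
    (P1 : probability T1 R) (P2 : probability T2 R)
    (X1 : T1 -> R) (X2 : T2 -> R) :
  measurable_fun setT X1 -> measurable_fun setT X2 ->
  {ae P1, forall w, 0 <= X1 w}%R -> {ae P2, forall w, 0 <= X2 w}%R ->
  (forall omega : R, (0 <= omega)%R ->
    \int[P1]_w (expR (- (omega * X1 w)))%:E =
    \int[P2]_w (expR (- (omega * X2 w)))%:E) ->
  eq_law P1 X1 P2 X2.
Proof.
move=> mX1 mX2 X10 X20 L A mA.
have mm d (T : measurableType d) (X : T -> R) : measurable_fun setT X ->
    measurable_fun setT (fun w => Num.max 0 (X w))%R.
  by move=> mX; exact: measurable_maxr.
have ex d (T : measurableType d) (P : probability T R) (X : T -> R) (omega : R) :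
    measurable_fun setT X -> {ae P, forall w, 0 <= X w}%R ->
    \int[P]_w (expR (- (omega * X w)))%:E =
    \int[P]_w (expR (- (omega * Num.max 0%R (X w))))%:E.
  move=> mX X0; apply: ge0_ae_eq_integral => //.
  - exact: (measurableT_comp (measurable_laplace_kernel omega) mX).
  - exact: (measurableT_comp (measurable_laplace_kernel omega) (mm _ _ _ mX)).
  - by apply: filterS X0 => w w0 _; rewrite max_r.
have el d (T : measurableType d) (P : probability T R) (X : T -> R) :
    measurable_fun setT X -> {ae P, forall w, 0 <= X w}%R ->
    eq_law P X P (fun w => Num.max 0 (X w))%R.
  move=> mX X0; apply: eq_law_ae => //; first exact: mm.
  by apply: filterS X0 => w w0; rewrite max_r.
rewrite (el _ _ _ _ mX1 X10)// (el _ _ _ _ mX2 X20)//.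
apply: laplace_unique_ge0 => //; try exact: mm.
- by move=> w; rewrite le_max lexx.
- by move=> w; rewrite le_max lexx.
- by move=> omega o0; rewrite -(ex _ _ P1 X1)// -(ex _ _ P2 X2)// L.
Qed.

End laws_on_the_line.

(** * Densities and integrals on the line *)

Section set_integrals.
Local Open Scope ereal_scope.

Lemma integral_set_indic d (T : measurableType d) (R : realType)
    (mu : {measure set T -> \bar R}) (A : set T) (g : T -> \bar R) :
  \int[mu]_(x in A) g x = \int[mu]_x (g x * (\1_A x)%:E).
Proof.
rewrite integral_mkcond; apply: eq_integral => x _.
by rewrite patchE indicE; case: ifP => _; rewrite ?mule1 ?mule0.
Qed.

Lemma tonelli_set d1 d2 (T1 : measurableType d1) (T2 : measurableType d2)
    (R : realType) (m1 : {sigma_finite_measure set T1 -> \bar R})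
    (m2 : {sigma_finite_measure set T2 -> \bar R})
    (A : set T1) (B : set T2) (f : T1 -> T2 -> \bar R) :
  measurable A -> measurable B ->
  measurable_fun (A `*` B) (fun z => f z.1 z.2) ->
  (forall x y, A x -> B y -> 0 <= f x y) ->
  \int[m1]_(x in A) \int[m2]_(y in B) f x y =
  \int[m2]_(y in B) \int[m1]_(x in A) f x y.
Proof.
move=> mA mB mf f0.
pose g : T1 * T2 -> \bar R := (fun z => f z.1 z.2) \_ (A `*` B).
have mg : measurable_fun setT g.
  by apply/(measurable_restrictT _ _).1 => //; exact: measurableX.
have g0 z : 0 <= g z.
  by rewrite /g patchE; case: ifPn => // /set_mem[Az Bz]; exact: f0.
have := fubini_tonelli (m1 := m1) (m2 := m2) g mg g0.
have gE x y : g (x, y) = if (x \in A) && (y \in B) then f x y else 0.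
  rewrite /g patchE /=; congr (if _ then _ else _).
  by apply/idP/andP; rewrite !inE.
move=> H.
transitivity (\int[m1]_x \int[m2]_y g (x, y)).
  rewrite integral_mkcond; apply: eq_integral => x _.
  rewrite patchE; case: ifPn => xA.
    rewrite integral_mkcond; apply: eq_integral => y _.
    by rewrite patchE gE xA.
  by rewrite integral0_eq// => y _; rewrite gE (negbTE xA).
rewrite H.
rewrite [RHS]integral_mkcond; apply: eq_integral => y _.
rewrite patchE; case: ifPn => yB.
  rewrite [RHS]integral_mkcond; apply: eq_integral => x _.
  by rewrite patchE gE yB andbT.
by rewrite integral0_eq// => x _; rewrite gE (negbTE yB) andbF.
Qed.

Import HBNNSimple.

(** True for indicators by hypothesis, then for simple functions by linearity
    and in general by monotone convergence on both sides. *)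
Lemma integral_density d (T : measurableType d) (R : realType)
    (mu m : {measure set T -> \bar R}) (f : T -> R) (g : T -> \bar R) :
  measurable_fun setT f -> (forall x, 0 <= f x)%R ->
  (forall A, measurable A -> m A = \int[mu]_(x in A) (f x)%:E) ->
  measurable_fun setT g -> (forall x, 0 <= g x) ->
  \int[m]_x g x = \int[mu]_x (g x * (f x)%:E).
Proof.
move=> mf f0 mE mg g0.
pose h := nnsfun_approx measurableT mg.
have gh x : (EFin \o h ^~ x) n @[n --> \oo] --> g x.
  by apply: cvg_nnsfun_approx => // y _; exact: g0.
transitivity (limn (fun n => \int[m]_x (h n x)%:E)).
  rewrite -monotone_convergence//.
  - by apply: eq_integral => x _; apply/esym/cvg_lim => //; exact: gh.
  - by move=> n; exact/measurable_EFinP.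
  - by move=> n x _; rewrite lee_fin.
  - by move=> x _ a b ab; rewrite lee_fin; exact/lefP/nd_nnsfun_approx.
transitivity (limn (fun n => \int[mu]_x ((h n x)%:E * (f x)%:E))); last first.
  rewrite -monotone_convergence//.
  - apply: eq_integral => x _; apply/cvg_lim => //.
    by apply: cvgeZr => //; exact: gh.
  - move=> n; apply: emeasurable_funM; exact/measurable_EFinP.
  - by move=> n x _; rewrite mule_ge0// lee_fin.
  - move=> x _ a b ab; rewrite lee_wpmul2r ?lee_fin//.
    exact/lefP/nd_nnsfun_approx.
congr (limn _); apply/funext => n.
have mh k : measurable (h n @^-1` [set k]) by [].
transitivity (\sum_(k \in range (h n)) (k%:E * m (h n @^-1` [set k]))).
  by rewrite integralT_nnsfun sintegralE.
transitivity (\sum_(k \in range (h n))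
    \int[mu]_x ((k * \1_(h n @^-1` [set k]) x)%:E * (f x)%:E)).
  apply: eq_fsbigr => k /set_mem[y _ <-].
  rewrite mE// [in LHS]integral_set_indic -ge0_integralZl//.
  - apply: eq_integral => x _; rewrite EFinM -muleA; congr (_ * _).
    exact: muleC.
  - by apply: emeasurable_funM; exact/measurable_EFinP.
  - by move=> x _; rewrite mule_ge0// lee_fin.
  - by rewrite lee_fin.
rewrite -ge0_integral_fsum//.
- apply: eq_integral => x _; rewrite [in RHS]fimfunE -fsumEFin//.
  by rewrite ge0_mule_fsuml// => k; rewrite nnfun_muleindic_ge0.
- move=> k; apply: emeasurable_funM; last exact/measurable_EFinP.
  by apply/measurable_EFinP/measurable_funM => //; exact: measurable_indic.
- by move=> k x _; rewrite mule_ge0 ?lee_fin// -lee_fin nnfun_muleindic_ge0.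
Qed.

Lemma has_density_integral d (T : measurableType d) (R : realType)
    (P : probability T R) (X : T -> R) (f : R -> R) (g : R -> \bar R) :
  measurable_fun setT X -> has_density P X f ->
  measurable_fun setT g -> (forall x, 0 <= g x) ->
  \int[P]_w g (X w) = \int[lebesgue_measure]_x (g x * (f x)%:E).
Proof.
move=> mX [mf f0 PX] mg g0.
have mX' : measurable_fun setT (X : T -> measurableTypeR R) by [].
rewrite -(@integral_density _ (measurableTypeR R) R lebesgue_measure
  (image_measure P mX') f g mf f0 PX mg g0).
exact: (ge0_integral_image P mX' mg).
Qed.

End set_integrals.

Section real_integrals.
Context {R : realType}.
Local Notation mu := (@lebesgue_measure R).
Local Open Scope ereal_scope.

(** The measure A |-> c |A / c| gives the intervals their length, so it is
    Lebesgue measure. *)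
Lemma integral_scaling (c : R) (f : R -> \bar R) : (0 < c)%R ->
  measurable_fun setT f -> (forall x, 0 <= f x) ->
  \int[mu]_(x in `]0%R, +oo[) f x =
  c%:E * \int[mu]_(x in `]0%R, +oo[) f (c * x)%R.
Proof.
move=> c0 mf f0.
have mc : measurable_fun setT (( *%R c) : measurableTypeR R -> measurableTypeR R).
  exact: measurable_funM.
pose m : {measure set (measurableTypeR R) -> \bar R} := mscale (NngNum (ltW c0)) (image_measure mu mc).
have mE A : measurable A -> m A = mu A.
  move=> mA; symmetry; refine (lebesgue_measure_unique (mu := m) _ mA) => //= _ [[a b]] _ <-.
  rewrite -[RHS]/(c%:E * mu ((fun x : R => c * x)%R @^-1` `]a, b])).
  rewrite (_ : _ @^-1` _ = `]c^-1 * a, c^-1 * b]%classic)%R; last first.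
    apply/seteqP; split=> x /=; rewrite !in_itv/=;
      by rewrite ltr_pdivrMl// ler_pdivlMl.
  rewrite !lebesgue_measure_itv/= !lte_fin ltr_pM2l ?invr_gt0//.
  case: ifPn => _; last by rewrite mule0.
  by rewrite -!EFinB -EFinM -mulrBr mulrA divff ?gt_eqF// mul1r.
transitivity (\int[m]_(x in `]0%R, +oo[) f x).
  by apply: eq_measure_integral => A mA _; exact/esym/mE.
rewrite ge0_integral_mscale//; last exact: measurable_funTS.
congr (_ * _).
have := @ge0_integral_pushforward _ _ _ _ _ _ mc mu `]0%R, +oo[%classic f.
move=> ->//; last exact: measurable_funTS.
congr (integral _ _ _); apply/seteqP; split=> x /=; rewrite !in_itv/= !andbT.
  by rewrite pmulr_rgt0.
by move=> x0; rewrite mulr_gt0.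
Qed.

Lemma integral_expR_ray (b c : R) : (0 < b)%R ->
  \int[mu]_(x in `[c, +oo[) (expR (- (b * x)))%:E = (b^-1 * expR (- (b * c)))%:E.
Proof.
move=> b0.
have cE : continuous (fun x : R => expR (- (b * x)))%R.
  move=> x; apply: continuous_comp; last exact: continuous_expR.
  by apply: continuousN; apply: continuousM => //; exact: cst_continuous.
have dE x : is_derive x (1 : R)%R (fun x : R => - (b^-1 * expR (- (b * x))))%R
    (expR (- (b * x))).
  apply: is_derive_eq.
  rewrite !(scaler0, add0r, addr0, oppr0, scaler1) /=.
  by rewrite /GRing.scale/=; field; rewrite gt_eqF.
rewrite (@ge0_continuous_FTC2y _ _
   (fun x => - (b^-1 * expR (- (b * x))))%R _ 0)//.
- by rewrite sub0e -EFinN opprK.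
- exact: continuous_subspaceT.
- rewrite -[X in _ --> X]oppr0; apply: cvgN.
  rewrite -[X in _ --> X](mulr0 b^-1%R); apply: cvgMr.
  apply: (@cvg_comp _ _ _ (fun x => b * x)%R (fun z => expR (- z))%R _ (pinfty_nbhs R));
    last exact: cvgr_expR.
  exact: gt0_cvgMry.
- by apply: cvgN; apply: cvgMr; apply/cvg_at_right_filter; exact: cE.
- by move=> x _; rewrite derive1E; have [_ ->] := dE x.
Qed.

Lemma FTC2_segment (a b : R) (f F : R -> R) : (a < b)%R ->
  {within `[a, b], continuous f} ->
  (forall x, x \in `[a, b] -> is_derive x (1%R : R) F (f x)) ->
  \int[mu]_(x in `[a, b]) (f x)%:E = (F b - F a)%:E.
Proof.
move=> ab cf dF.
have cF x : x \in `[a, b] -> {for x, continuous F}.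
  by move=> /dF [dx _]; apply/differentiable_continuous/derivable1_diffP.
rewrite EFinB; apply: continuous_FTC2 => //.
- split.
  + by move=> x /subset_itv_oo_cc /dF [].
  + by apply/cvg_at_right_filter/cF; rewrite in_itv/= lexx ltW.
  + by apply/cvg_at_left_filter/cF; rewrite in_itv/= lexx ltW.
- by move=> x /subset_itv_oo_cc /dF [_ xf]; rewrite derive1E.
Qed.

(** The integrand may be unbounded at the endpoints: the formula on the compact
    intervals that exhaust ]a, b[ passes to the limit by monotone convergence. *)
Lemma FTC2_oo_ge0 (a b : R) (f F : R -> R) : (a < b)%R ->
  {in `]a, b[, forall x, 0 <= f x}%R ->
  {in `]a, b[, continuous f} ->
  (forall x, x \in `]a, b[ -> is_derive x (1 : R)%R F (f x)) ->
  F x @[x --> a^'+] --> F a -> F x @[x --> b^'-] --> F b ->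
  \int[mu]_(x in `]a, b[) (f x)%:E = (F b - F a)%:E.
Proof.
move=> ab f0 cf dF Fa Fb.
pose e : R := (b - a)%R; have e0 : (0 < e)%R by rewrite subr_gt0.
pose u (n : nat) := (a + e / n.+3%:R)%R; pose v (n : nat) := (b - e / n.+3%:R)%R.
have en (n : nat) : (0 < e / n.+3%:R)%R by rewrite divr_gt0.
have uv (n : nat) : (u n < v n)%R.
  have : (e / n.+3%:R < e / 2)%R by rewrite ltr_pM2l// ltf_pV2 ?posrE// ltr_nat.
  by rewrite /u /v /e; move: (_ / n.+3%:R)%R => z; lra.
pose I n := `[u n, v n]%classic.
have sub n x : I n x -> x \in `]a, b[.
  rewrite /I /= !in_itv/= => /andP[ux xv].
  by rewrite (lt_le_trans _ ux) ?ltrDl//= (le_lt_trans xv)// ltrBlDr ltrDl.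
have subI n x : I n x -> x \in `]a, b[ by exact: sub.
have cI n : {within I n, continuous f}.
  by apply: continuous_in_subspaceT => x /set_mem /sub; exact: cf.
have bigI : \bigcup_n I n = `]a, b[%classic.
  apply/seteqP; split=> x /=; first by move=> [n _ /sub].
  rewrite in_itv/= => /andP[ax xb].
  pose k := maxn (Num.trunc (e / (x - a))) (Num.trunc (e / (b - x))).
  exists k => //; rewrite /I /= in_itv/=; apply/andP; split.
    rewrite /u -lerBrDl ler_pdivrMr// mulrC -ler_pdivrMr ?subr_gt0//.
    apply/ltW/(lt_le_trans (truncnS_gt _)); rewrite ler_nat.
    exact: leq_trans (leq_maxl _ _) (leq_trans (leqnSn _) (leqnSn _)).
  rewrite /v lerBrDr -lerBrDl ler_pdivrMr// mulrC -ler_pdivrMr ?subr_gt0//.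
  apply/ltW/(lt_le_trans (truncnS_gt _)); rewrite ler_nat.
  exact: leq_trans (leq_maxr _ _) (leq_trans (leqnSn _) (leqnSn _)).
have ndI : {homo I : n m / (n <= m)%N >-> (n <= m)%O}.
  move=> n m nm; apply/subsetPset => x; rewrite /I /= !in_itv/= => /andP[ux xv].
  have h : (e / m.+3%:R <= e / n.+3%:R)%R.
    by rewrite ler_pM2l// lef_pV2 ?posrE// ler_nat.
  by rewrite (le_trans _ ux) ?lerD2l//= (le_trans xv)// lerD2l lerN2.
have H1 : \int[mu]_(x in I n) (f x)%:E @[n --> \oo] -->
    \int[mu]_(x in `]a, b[) (f x)%:E.
  rewrite -bigI; apply: ge0_nondecreasing_set_cvg_integral => //.
  - by move=> n; exact: measurable_itv.
  - move=> n; apply/measurable_EFinP.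
    by apply: subspace_continuous_measurable_fun; [exact: measurable_itv|exact: cI].
  - by move=> n x /sub /f0; rewrite lee_fin.
have H2 n : \int[mu]_(x in I n) (f x)%:E = (F (v n))%:E - (F (u n))%:E.
  have H := FTC2_segment (uv n) (cI n) (fun x xI => dF x (sub n x xI)).
  by rewrite /I H EFinB.
apply: (cvg_unique _ H1) => //.
rewrite (funext H2) EFinB.
have e3 : (e / n.+3%:R)%R @[n --> \oo] --> (0 : R)%R.
  rewrite -(mulr0 e); apply: cvgMr.
  have := @cvg_harmonic R; rewrite -(cvg_shiftn 2) /= => h.
  by under eq_fun do rewrite -[_.+3]addn2 -addn1 addnAC addn1.
apply: cvgeB => //; apply: cvg_EFin; try exact: nearW.
  apply: (cvg_at_leftP _ _ _).1 Fb _ _; split.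
    by move=> n; rewrite /v ltrBlDr ltrDl.
  by rewrite -[X in _ --> X]subr0; apply: cvgB => //; exact: cvg_cst.
apply: (cvg_at_rightP _ _ _).1 Fa _ _; split.
  by move=> n; rewrite /u ltrDl.
by rewrite -[X in _ --> X]addr0; apply: cvgD => //; exact: cvg_cst.
Qed.

End real_integrals.

(** * Frullani, gamma and beta integrals *)

Section special_integrals.
Context {R : realType}.
Local Notation mu := (@lebesgue_measure R).

(** (1 - e^{- omega s}) / s is the integral of e^{- u s} over u in [0, omega];
    exchanging the integrals leaves the integral of 1 / (u + a). *)
Lemma frullani (a omega : R) : 0 < a -> 0 <= omega ->
  (\int[mu]_(s in `]0%R, +oo[)
     ((1 - expR (- (omega * s))) * (s^-1 * expR (- (s * a))))%:E =
   (ln (1 + omega / a))%:E)%E.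
Proof.
move=> a0; rewrite le_eqVlt => /predU1P[<-|o0].
  rewrite mul0r addr0 ln1 integral0_eq// => s _.
  by rewrite mul0r oppr0 expR0 subrr mul0r.
have inner (s : R) : 0 < s ->
    (((1 - expR (- (omega * s))) * (s^-1 * expR (- (s * a))))%:E =
    \int[mu]_(u in `[0%R, omega]) (expR (- ((u + a) * s)))%:E)%E.
  move=> s0.
  have cE : continuous (fun u : R => expR (- ((u + a) * s))).
    move=> x; apply: continuous_comp; last exact: continuous_expR.
    apply: continuousN; apply: continuousM; last exact: cst_continuous.
    by apply: continuousD => //; exact: cst_continuous.
  have dE x : is_derive x (1%R : R) (fun u : R => - (s^-1 * expR (- ((u + a) * s))))%R
      (expR (- ((x + a) * s))).
    apply: is_derive_eq.
    rewrite !(scaler0, add0r, addr0, oppr0, scaler1) /=.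
    by rewrite /GRing.scale/=; field; rewrite gt_eqF.
  rewrite (FTC2_segment o0 _ (fun x _ => dE x)); last exact: continuous_subspaceT.
  rewrite !add0r opprK [(omega + a) * s]mulrDl opprD expRD (mulrC s a); congr EFin; ring.
under eq_integral.
  move=> s; rewrite inE/= in_itv/= andbT => s0.
  rewrite (inner _ s0); over.
have mE : measurable_fun ((`]0, +oo[%classic : set R) `*` (`[0, omega]%classic : set R))
    (fun z : R * R => (expR (- ((z.2 + a) * z.1)))%:E).
  apply/measurable_funTS/measurable_EFinP/measurableT_comp => //.
  apply: measurable_funN; apply: measurable_funM => //.
  exact: measurable_funD.
rewrite (@tonelli_set _ _ _ _ _ mu mu _ _ (fun s u => (expR (- ((u + a) * s)))%:E))//=.
transitivity (\int[mu]_(u in `[0%R, omega]) ((u + a)^-1)%:E)%E.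
  apply: eq_integral => u; rewrite inE/= in_itv/= => /andP[u0 _].
  have ua : 0 < u + a by rewrite ltr_wpDl.
  rewrite integral_itv_obnd_cbnd.
    by rewrite integral_expR_ray// mulr0 oppr0 expR0 mulr1.
  by apply: measurable_funTS; exact: measurable_laplace_kernel.
have dL x : x \in `[0, omega] -> is_derive x (1%R : R) (fun u : R => ln (u + a)) (x + a)^-1.
  rewrite in_itv/= => /andP[x0 _].
  have xa : 0 < x + a by rewrite ltr_wpDl.
  have dg : is_derive x (1%R : R) (fun u : R => u + a) 1.
    by apply: is_derive_eq; rewrite addr0.
  have h : is_derive x (1%R : R) (@ln R \o (fun u : R => u + a)) ((x + a)^-1 * 1).
    by apply: is_derive1_comp; exact: is_derive1_ln.
  by rewrite mulr1 in h.
rewrite (FTC2_segment o0 _ dL).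
  rewrite add0r -ln_div ?posrE ?addr_gt0//; congr (ln _)%:E.
  by field; rewrite gt_eqF.
apply: continuous_in_subspaceT => x; rewrite inE/= in_itv/= => /andP[x0 _].
apply: cvgV; first by rewrite gt_eqF// ltr_wpDl.
by apply: cvgD => //; exact: cvg_cst.
Qed.

Lemma mulr_powR (x p : R) : 0 < x -> x * x `^ p = x `^ (p + 1).
Proof.
move=> x0; have xn0 : x != 0 by rewrite gt_eqF.
by rewrite addrC powRD ?xn0 ?implybT// powRr1// ltW.
Qed.

Lemma powRN_le1 (y p : R) : 0 <= p -> 1 <= y -> y `^ (- p) <= 1.
Proof.
move=> p0 y1; have y0 := lt_le_trans ltr01 y1.
rewrite powRN invf_le1 ?powR_gt0//.
apply: (@le_trans _ _ (1 `^ p)); first by rewrite powR1.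
by apply: ge0_ler_powR; rewrite ?nnegrE// ltW.
Qed.

(** Tilting by e^{- omega x} turns the density into one of the same shape with
    rate omega + 1/c, up to a constant J(omega + 1/c) / J(1/c) that scaling
    evaluates.  The value at omega = 0 fixes the normalisation, so that
    the Gamma function itself never has to be computed. *)
Lemma gamma_laplace d (T : measurableType d) (P : probability T R) (X : T -> R)
    (theta c omega : R) : 0 < theta -> 0 < c -> 0 <= omega ->
  measurable_fun setT X -> has_density P X (gamma_pdf theta c) ->
  (\int[P]_w (expR (- (omega * X w)))%:E = ((1 + omega * c) `^ (- theta))%:E)%E.
Proof.
move=> t0 c0 o0 mX PX.
pose J (b : R) := (\int[mu]_(x in `]0%R, +oo[) (x `^ (theta - 1) * expR (- (b * x)))%:E)%E.
have mJ (b : R) : measurable_fun setT (fun x : R => (x `^ (theta - 1) * expR (- (b * x)))%:E).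
  apply/measurable_EFinP; apply: measurable_funM; first exact: measurable_powR.
  by apply/measurable_EFinP; exact: measurable_laplace_kernel.
have J0 (b x : R) : (0 <= (x `^ (theta - 1) * expR (- (b * x)))%:E)%E.
  by rewrite lee_fin mulr_ge0 ?powR_ge0 ?expR_ge0.
have JE (b : R) : 0 < b -> J b = ((b `^ (- theta))%:E * J 1%R)%E.
  move=> b0; rewrite /J (integral_scaling b0 (mJ 1%R) (J0 1%R)).
  rewrite muleA -EFinM -ge0_integralZl//; last 2 first.
  - by apply: measurable_funTS; apply: measurableT_comp (mJ 1%R) _; exact: measurable_funM.
  - by rewrite lee_fin mulr_ge0 ?powR_ge0// ltW.
  apply: eq_integral => x; rewrite inE/= in_itv/= andbT => x0.
  have hb : b `^ (- theta) * b * b `^ (theta - 1) = 1.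
    by rewrite -mulrA mulr_powR// subrK powRN mulVf// gt_eqF// powR_gt0.
  rewrite -EFinM mul1r powRM ?ltW//; congr EFin.
  transitivity ((b `^ (- theta) * b * b `^ (theta - 1)) *
    (x `^ (theta - 1) * expR (- (b * x)))); first by rewrite hb mul1r.
  ring.
pose K := (Gamma_fun theta * c `^ theta)^-1.
have K0 : 0 <= K.
  rewrite invr_ge0 mulr_ge0 ?powR_ge0//; apply: Rintegral_ge0 => x _.
  by rewrite mulr_ge0 ?powR_ge0 ?expR_ge0.
have EK (w : R) : (\int[P]_x (expR (- (w * X x)))%:E = K%:E * J (w + c^-1)%R)%E.
  rewrite (has_density_integral mX PX (measurable_laplace_kernel w)); last by move=> x; rewrite lee_fin expR_ge0.
  rewrite /J -ge0_integralZl//; last first.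
    by apply: measurable_funTS; exact: mJ.
  rewrite [RHS]integral_mkcond; apply: eq_integral => x _.
  rewrite patchE -EFinM /gamma_pdf; case: ifPn => x0.
    rewrite ifT; last by rewrite inE/= in_itv/= x0.
    rewrite -EFinM; congr EFin; rewrite -/K mulrDl opprD expRD (mulrC c^-1); ring.
  by rewrite ifF ?mulr0//; apply/negbTE; rewrite notin_setE/= in_itv/= andbT; apply/negP.
have E1 := EK 0; have Eo := EK omega.
have c10 : 0 < c^-1 by rewrite invr_gt0.
rewrite add0r JE// in E1.
rewrite JE ?ltr_wpDl// in Eo.
have {E1} : (1 = (K * c `^ theta)%:E * J 1%R)%E.
  rewrite EFinM -muleA; move: E1; under eq_integral do rewrite mul0r oppr0 expR0.
  rewrite integral_probability_cst powRN.
  rewrite -[c^-1]powR_inv1 ?ltW// -powRrM mulN1r powRN invrK //.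
move=> E1.
have ec : (omega + c^-1) `^ (- theta) = (1 + omega * c) `^ (- theta) * c `^ theta.
  have -> : 1 + omega * c = c * (omega + c^-1) by field; rewrite gt_eqF.
  rewrite powRM ?ltW ?ltr_wpDl// [in RHS]powRN mulrAC mulVf ?mul1r//.
  by rewrite gt_eqF// powR_gt0.
rewrite Eo muleA -EFinM ec mulrCA EFinM -muleA -E1 mule1.
by [].
Qed.

(** The integrand is the derivative of b^theta (a b + c (1 - b))^{-theta} / c,
    which vanishes at 0 and equals a^{-theta} / c at 1. *)
Lemma beta_integral (theta a c : R) : 0 < theta -> 0 < a -> 0 < c ->
  (\int[mu]_(b in `]0%R, 1%R[)
    (theta * b `^ (theta - 1) * (a * b + c * (1 - b)) `^ (- (theta + 1)))%:E =
   (a `^ (- theta) * c^-1)%:E)%E.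
Proof.
move=> t0 a0 c0.
pose D (b : R) := a * b + c * (1 - b).
have D0 (b : R) : 0 <= b <= 1 -> 0 < D b.
  move=> /andP[b0 b1]; rewrite /D; have [->|bn0] := eqVneq b 0.
    by rewrite mulr0 add0r subr0 mulr1.
  rewrite ltr_pwDl ?mulr_ge0 ?subr_ge0//; last exact: ltW.
  by rewrite mulr_gt0// lt_neqAle eq_sym bn0.
pose F (b : R) := b `^ theta * D b `^ (- theta) * c^-1.
have dD (b : R) : is_derive b (1%R : R) D (a - c).
  rewrite /D; apply: is_derive_eq.
  rewrite !(scaler0, add0r, addr0, oppr0, scaler1) /GRing.scale/=; ring.
have dF (b : R) : 0 < b -> 0 < D b -> is_derive b (1%R : R) F
    (theta * b `^ (theta - 1) * D b `^ (- (theta + 1))).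
  move=> b0 Db.
  have d1 := @is_derive1_powR _ theta b b0.
  have d3 : is_derive b (1%R : R) ((fun x : R => x `^ (- theta)) \o D)
      (- theta * D b `^ (- theta - 1) * (a - c)).
    by apply: is_derive1_comp; exact: is_derive1_powR.
  have h := is_deriveM (is_deriveM d1 d3) (is_derive_cst (c^-1 : R) b (1%R : R)).
  refine (@is_derive_eq _ _ _ _ _ _ _ _ h _).
  rewrite scaler0 add0r /GRing.scale/=.
  have -> : b `^ theta = b * b `^ (theta - 1) by rewrite mulr_powRB1// ltW.
  have -> : - theta - 1 = - (theta + 1) by ring.
  have -> : D b `^ (- theta) = D b * D b `^ (- (theta + 1)).
    by rewrite mulr_powR//; congr (_ `^ _); ring.
  by rewrite /D; field; rewrite gt_eqF.
have D1 (b : R) : b \in `]0, 1[ -> 0 < D b.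
  by rewrite in_itv/= => /andP[b0 b1]; rewrite D0// !ltW.
have cD (b : R) : {for b, continuous D}.
  by apply: differentiable_continuous; apply/derivable1_diffP; have [] := dD b.
have cpow (p x : R) : 0 < x -> {for x, continuous (fun z : R => z `^ p)}.
  move=> x0; apply: differentiable_continuous; apply/derivable1_diffP.
  by have [] := @is_derive1_powR _ p x x0.
have cDp (p b : R) : 0 < D b -> {for b, continuous (fun z : R => D z `^ p)}.
  move=> Db.
  exact: (@continuous_comp _ _ _ D (fun z : R => z `^ p) b (cD b) (cpow p _ Db)).
pose f (b : R) := theta * b `^ (theta - 1) * D b `^ (- (theta + 1)).
have f0 : {in `]0, 1[, forall b, 0 <= f b}.
  move=> b; rewrite in_itv/= => /andP[b0 b1].
  by rewrite !mulr_ge0 ?powR_ge0// ltW.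
have cf : {in `]0, 1[, continuous f}.
  move=> b b01; have Db := D1 b b01.
  move: b01; rewrite in_itv/= => /andP[b0 b1].
  rewrite /continuous_at /f; apply: cvgM; last exact: cDp.
  by apply: cvgM; [exact: cvg_cst|exact: cpow].
have df (b : R) : b \in `]0, 1[ -> is_derive b (1%R : R) F (f b).
  move=> b01; have Db := D1 b b01.
  by move: b01; rewrite in_itv/= => /andP[b0 b1]; exact: dF.
have F0 : F x @[x --> 0^'+] --> F 0.
  rewrite /F; apply: cvgM; last exact: cvg_cst.
  apply: cvgM; first by rewrite powR0 ?gt_eqF//; exact: powR_cvg0.
  by apply: cvg_at_right_filter; apply: cDp; apply: D0; rewrite lexx ler01.
have F1 : F x @[x --> 1^'-] --> F 1.
  rewrite /F; apply: cvgM; last exact: cvg_cst.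
  apply: cvgM; apply: cvg_at_left_filter; first exact: cpow.
  by apply: cDp; apply: D0; rewrite lexx ler01.
have := FTC2_oo_ge0 ltr01 f0 cf df F0 F1; rewrite /f => ->.
rewrite /F /D powR1 powR0 ?gt_eqF// !mul0r subr0 mulr1 subrr mulr0 addr0.
by rewrite mul1r.
Qed.

End special_integrals.

(** * The Levy density of Sigma *)

Lemma measurable_invr (R : realType) : measurable_fun [set: R] (@GRing.inv R).
Proof.
rewrite (_ : GRing.inv = (fun x : R => if 0 < x then x `^ (-1) else
   if x < 0 then - ((- x) `^ (-1)) else 0)); last first.
  apply/funext => x; case: ltgtP => [x0|x0|<-]; last by rewrite invr0.
    by rewrite powR_inv1// ltW.
  by rewrite powR_inv1 ?oppr_ge0 ?ltW// invrN opprK.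
apply: measurable_fun_ifT; first exact: measurable_fun_ltr.
  exact: measurable_powR.
apply: measurable_fun_ifT => //; first exact: measurable_fun_ltr.
have mN : measurable_fun setT (fun t : R => - t) by exact: measurable_funN.
by apply: measurable_funN; exact: (measurableT_comp (@measurable_powR R (-1)) mN).
Qed.

Lemma measurable_integral_set d1 d2 (T1 : measurableType d1)
    (T2 : measurableType d2) (R : realType)
    (m2 : {sigma_finite_measure set T2 -> \bar R}) (B : set T2)
    (f : T1 -> T2 -> \bar R) :
  measurable B -> measurable_fun (setT `*` B) (fun z => f z.1 z.2) ->
  (forall x y, B y -> (0 <= f x y)%E) ->
  measurable_fun setT (fun x => \int[m2]_(y in B) f x y)%E.
Proof.
move=> mB mf f0.
pose g : T1 * T2 -> \bar R := (fun z => f z.1 z.2) \_ (setT `*` B).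
have mg : measurable_fun setT g.
  by apply/(measurable_restrictT _ _).1 => //; exact: measurableX.
have g0 z : (0 <= g z)%E.
  by rewrite /g patchE; case: ifPn => // /set_mem[_ Bz]; exact: f0.
have := measurable_fun_fubini_tonelli_F (m2 := m2) g mg g0.
congr measurable_fun; apply/funext => x; rewrite /fubini_F [RHS]integral_mkcond.
apply: eq_integral => y _; rewrite /g !patchE/=; congr (if _ then _ else _).
by apply/idP/idP; rewrite !inE => // -[].
Qed.

Section levy_densities.
Context {R : realType} {dV : measure_display} {TV : measurableType dV}
  (PV : probability TV R) (V : TV -> R).
Hypotheses (mV : measurable_fun setT V) (V01 : forall w, 0 <= V w <= 1).
Local Notation mu := (@lebesgue_measure R).

(** e^{-s/v} with the value 0 at v = 0, which is what the convention
    e^{-oo} = 0 prescribes. *)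
Definition inv_exp (s v : R) : R := if 0 < v then expR (- (s / v)) else 0.

Definition mean_inv_exp (s : R) : \bar R := (\int[PV]_w (inv_exp s (V w))%:E)%E.

Lemma inv_expE (s v : R) : 0 < s -> 0 <= v ->
  expeR (- (s%:E / v%:E))%E = (inv_exp s v)%:E.
Proof.
move=> s0; rewrite /inv_exp inver le_eqVlt eq_sym => /predU1P[->|v0].
  by rewrite eqxx ltxx gt0_muley ?lte_fin.
by rewrite gt_eqF// v0 -EFinM.
Qed.

Lemma inv_exp_ge0 (s v : R) : 0 <= inv_exp s v.
Proof. by rewrite /inv_exp; case: ifP => // _; exact: expR_ge0. Qed.

Lemma inv_exp_le (s v : R) : 0 <= s -> v <= 1 -> inv_exp s v <= expR (- s).
Proof.
move=> s0 v1; rewrite /inv_exp; case: ifPn => [v0|_]; last exact: expR_ge0.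
by rewrite ler_expR lerN2 ler_peMr// invf_ge1.
Qed.

Lemma measurable_inv_exp d (T : measurableType d) (f g : T -> R) :
  measurable_fun setT f -> measurable_fun setT g ->
  measurable_fun setT (fun t => inv_exp (f t) (g t)).
Proof.
move=> mf mg; apply: measurable_fun_ifT => //.
  exact: measurable_fun_ltr.
apply: measurableT_comp => //; apply: measurable_funN; apply: measurable_funM => //.
exact: (measurableT_comp (@measurable_invr R) mg).
Qed.

Let mk1 (s : R) : measurable_fun setT (fun w => (inv_exp s (V w))%:E).
Proof. by apply/measurable_EFinP/measurable_inv_exp. Qed.

Let k0 (s : R) w : (0 <= (inv_exp s (V w))%:E)%E.
Proof. by rewrite lee_fin inv_exp_ge0. Qed.

Lemma mean_inv_exp_ge0 (s : R) : (0 <= mean_inv_exp s)%E.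
Proof. by apply: integral_ge0 => w _; exact: k0. Qed.

Lemma mean_inv_exp_le (s : R) : 0 <= s -> (mean_inv_exp s <= (expR (- s))%:E)%E.
Proof.
move=> s0; rewrite -[leRHS](@integral_probability_cst _ _ _ PV).
apply: ge0_le_integral => //.
by move=> w _; rewrite lee_fin inv_exp_le//; have /andP[] := V01 w.
Qed.

Lemma mean_inv_exp_fin (s : R) : 0 <= s -> mean_inv_exp s \is a fin_num.
Proof.
move=> s0; rewrite ge0_fin_numE ?mean_inv_exp_ge0//.
by rewrite (le_lt_trans (mean_inv_exp_le s0))// ltry.
Qed.

Lemma measurable_mean_inv_exp : measurable_fun setT mean_inv_exp.
Proof.
pose f (z : R * TV) := (inv_exp z.1 (V z.2))%:E.
have mf : measurable_fun setT f.
  by apply/measurable_EFinP/measurable_inv_exp => //; exact: measurableT_comp.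
by apply: (measurable_fun_fubini_tonelli_F (m2 := PV) f mf) => z; exact: k0.
Qed.

(** On V = 0 the quotient s / 0 is +oo, so the exponential is 0, as for
    [inv_exp]. *)
Lemma expect_exp_invE (s c : R) : 0 < s -> 0 < c ->
  expect_exp_inv PV (fun w => V w / c) s = mean_inv_exp (s * c).
Proof.
move=> s0 c0; apply: eq_integral => w _; have /andP[v0 _] := V01 w.
rewrite inv_expE ?divr_ge0 ?(ltW c0)// /inv_exp; congr EFin.
rewrite ltr_pdivlMr// mul0r; case: ifPn => // vp; congr expR.
by field; rewrite !gt_eqF.
Qed.

Lemma expect_exp_invE1 (s : R) : 0 < s -> expect_exp_inv PV V s = mean_inv_exp s.
Proof.
move=> s0; apply: eq_integral => w _; have /andP[v0 _] := V01 w.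
by rewrite inv_expE.
Qed.

(* 1 / v <= x, for x >= 1 *)
Let above (x v : R) : R := if 0 < v then (if 1 <= x * v then 1 else 0) else 0.

Let measurable_above d (T : measurableType d) (f g : T -> R) :
  measurable_fun setT f -> measurable_fun setT g ->
  measurable_fun setT (fun t => above (f t) (g t)).
Proof.
move=> mf mg; apply: measurable_fun_ifT => //; first exact: measurable_fun_ltr.
apply: measurable_fun_ifT => //.
by apply: measurable_fun_ler => //; exact: measurable_funM.
Qed.

Let above_ge0 x v : 0 <= above x v.
Proof. by rewrite /above; case: ifP => // _; case: ifP. Qed.

Let cdf_invE x : cdf_inv PV V x = (\int[PV]_w (above x (V w))%:E)%E.
Proof.
rewrite /cdf_inv; set A := [set w | _].
have AE : A = [set w | 0 < V w] `&` [set w | 1 <= x * V w].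
  apply/seteqP; split=> w; rewrite /A /= inver; have /andP[v0 _] := V01 w.
    case: eqP => [->|/eqP vn0]; first by rewrite leye_eq.
    have vp : 0 < V w by rewrite lt_neqAle eq_sym vn0.
    by rewrite lee_fin => h; split=> //; rewrite -ler_pdivrMr// div1r.
  by move=> [vp h]; rewrite gt_eqF// lee_fin -[leLHS]div1r ler_pdivrMr.
have mA : measurable A.
  rewrite AE; apply: measurableI.
    by have := measurable_fun_ltr (measurable_cst (0 : R)) mV => /(_ measurableT [set true] I); rewrite setTI.
  have h : measurable_fun setT (fun w => x * V w) by exact: measurable_funM.
  by have := measurable_fun_ler (measurable_cst (1 : R)) h => /(_ measurableT [set true] I); rewrite setTI.
rewrite -(setIT A) -integral_indic//; apply: eq_integral => w _.
rewrite indicE /above AE; congr EFin.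
case: ifPn => vp; last by rewrite memNset// => -[/= vp']; rewrite vp' in vp.
case: ifPn => h; first by rewrite mem_set.
by rewrite memNset// => -[/= _ h']; rewrite h' in h.
Qed.

Let cdf_inv01 x : (0 <= cdf_inv PV V x <= 1)%E.
Proof.
rewrite cdf_invE integral_ge0 ?andTb; last by move=> w _; rewrite lee_fin above_ge0.
rewrite -[leRHS](@integral_probability_cst _ _ _ PV).
apply: ge0_le_integral => //.
- by move=> w _; rewrite lee_fin above_ge0.
- exact/measurable_EFinP/measurable_above.
- by move=> w _; rewrite lee_fin /above; case: ifP => // _; case: ifP.
Qed.

Let ccdf_ge0 x : (0 <= 1 - cdf_inv PV V x)%E.
Proof.
have /andP[F0 F1] := cdf_inv01 x.
have Ff : cdf_inv PV V x \is a fin_num.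
  by rewrite ge0_fin_numE// (le_lt_trans F1)// ltry.
by rewrite -(fineK Ff) -EFinB lee_fin subr_ge0 -lee_fin fineK.
Qed.

Let measurable_cdf_inv : measurable_fun setT (cdf_inv PV V).
Proof.
rewrite (funext cdf_invE).
pose f (z : R * TV) := (above z.1 (V z.2))%:E.
have mf : measurable_fun setT f.
  by apply/measurable_EFinP/measurable_above => //; exact: measurableT_comp.
apply: (measurable_fun_fubini_tonelli_F (m2 := PV) f mf) => z.
by rewrite lee_fin above_ge0.
Qed.

Let measurable_expM (s : R) : measurable_fun setT (fun x : R => expR (- (s * x))).
Proof.
by apply/measurable_EFinP; exact: measurable_laplace_kernel.
Qed.

Lemma rho_Sigma_ge0 s : (0 <= rho_Sigma PV V s)%E.
Proof.
by apply: integral_ge0 => x _; rewrite mule_ge0 ?lee_fin ?expR_ge0.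
Qed.

(** For fixed V, the integral of e^{-sx} over x >= 1/V is e^{-s/V} / s, and
    the restriction to x >= 1 is automatic since V <= 1. *)
Let cdf_inv_part s : 0 < s ->
  (\int[mu]_(x in `[1%R, +oo[) ((expR (- (s * x)))%:E * cdf_inv PV V x) =
   (s^-1)%:E * mean_inv_exp s)%E.
Proof.
move=> s0.
under eq_integral.
  move=> x _; rewrite cdf_invE -ge0_integralZl ?lee_fin ?expR_ge0//; last 2 first.
  - exact/measurable_EFinP/measurable_above.
  - by move=> w _; rewrite lee_fin above_ge0.
  over.
rewrite (@tonelli_set _ _ _ _ _ mu PV _ _
  (fun x w => (expR (- (s * x)))%:E * (above x (V w))%:E)%E)//; last 2 first.
- apply/measurable_funTS/emeasurable_funM; apply/measurable_EFinP.
    exact: (measurableT_comp (measurable_expM s) measurable_fst).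
  by apply: measurable_above => //; exact: measurableT_comp.
- by move=> x w _ _; rewrite -EFinM lee_fin mulr_ge0 ?expR_ge0.
rewrite -ge0_integralZl//; last by rewrite lee_fin invr_ge0 ltW.
apply: eq_integral => w _; have /andP[v0 v1] := V01 w.
rewrite /inv_exp; case: ifPn => vp; last first.
  rewrite mule0 integral0_eq// => x _.
  by rewrite /above (negbTE vp) mule0.
rewrite -EFinM -(integral_expR_ray _ s0).
rewrite [LHS]integral_mkcond [RHS]integral_mkcond.
apply: eq_integral => x _; rewrite !patchE /above vp.
have -> : (x \in `[(V w)^-1, +oo[%classic) = (1 <= x * V w).
  by apply/idP/idP; rewrite inE/= in_itv/= andbT -[X in X <= x]div1r ler_pdivrMr.
case: ifPn => [_|]; case: ifPn; rewrite ?mule1 ?mule0//.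
move=> h; rewrite notin_setE/= in_itv/= andbT => /negP; rewrite -ltNge => x1.
exfalso; move: h; apply/negP; rewrite -ltNge.
have [x0|x0] := leP 0 x; first by rewrite (le_lt_trans _ x1)// ler_piMr.
by rewrite (le_lt_trans (mulr_le0_ge0 (ltW x0) v0)).
Qed.

(** The tail 1 - F_{1/V} and F_{1/V} add up to 1, and the integral of e^{-sx}
    over x >= 1 is e^{-s} / s. *)
Lemma rho_Sigma_decomposition s : 0 < s ->
  (s^-1 * expR (- s))%:E = (rho_Sigma PV V s + (s^-1)%:E * mean_inv_exp s)%E.
Proof.
move=> s0; rewrite -cdf_inv_part// /rho_Sigma -ge0_integralD//=; last 4 first.
- by move=> x _; rewrite mule_ge0 ?lee_fin ?expR_ge0.
- apply/measurable_funTS/emeasurable_funM.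
    by apply/measurable_EFinP; exact: measurable_expM.
  by apply: emeasurable_funB.
- by move=> x _; rewrite mule_ge0 ?lee_fin ?expR_ge0//; have /andP[] := cdf_inv01 x.
- apply/measurable_funTS/emeasurable_funM => //.
  by apply/measurable_EFinP; exact: measurable_expM.
have := integral_expR_ray 1 s0; rewrite mulr1 => <-.
apply: eq_integral => x _.
have /andP[F0 F1] := cdf_inv01 x.
have Ff : cdf_inv PV V x \is a fin_num.
  by rewrite ge0_fin_numE// (le_lt_trans F1)// ltry.
by rewrite -muleDr ?subeK ?mule1 ?fin_num_adde_defl.
Qed.

Lemma rho_SigmaE s : 0 < s ->
  rho_Sigma PV V s = ((s^-1 * expR (- s))%:E - (s^-1)%:E * mean_inv_exp s)%E.
Proof.
move=> s0; rewrite rho_Sigma_decomposition// addeK//.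
by rewrite fin_numM// mean_inv_exp_fin// ltW.
Qed.

Lemma rho_Sigma_le s : 0 < s -> (rho_Sigma PV V s <= (s^-1 * expR (- s))%:E)%E.
Proof.
move=> s0; rewrite [leRHS]rho_Sigma_decomposition// leeDl//.
by rewrite mule_ge0 ?mean_inv_exp_ge0// lee_fin invr_ge0 ltW.
Qed.

Lemma rho_Sigma_fin s : 0 < s -> rho_Sigma PV V s \is a fin_num.
Proof.
move=> s0; rewrite ge0_fin_numE ?rho_Sigma_ge0//.
by rewrite (le_lt_trans (rho_Sigma_le s0))// ltry.
Qed.

Let measurable_inv_expR : measurable_fun setT (fun s : R => s^-1 * expR (- s)).
Proof.
apply: measurable_funM; first exact: measurable_invr.
by apply: measurableT_comp => //; exact: measurable_funN.
Qed.

Let measurable_inv_mean :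
  measurable_fun setT (fun s : R => (s^-1)%:E * mean_inv_exp s)%E.
Proof.
apply: emeasurable_funM; last exact: measurable_mean_inv_exp.
by apply/measurable_EFinP; exact: measurable_invr.
Qed.

Let pos_itv : [set s : R | 0 < s] = `]0, +oo[%classic.
Proof. by apply/seteqP; split=> s /=; rewrite in_itv/= andbT. Qed.

Lemma measurable_rho_Sigma : measurable_fun (`]0, +oo[%classic : set R) (rho_Sigma PV V).
Proof.
have h : measurable_fun setT
    (fun s : R => (s^-1 * expR (- s))%:E - (s^-1)%:E * mean_inv_exp s)%E.
  by apply: emeasurable_funB => //; exact/measurable_EFinP.
apply: (@eq_measurable_fun _ _ _ _ _
    (fun s : R => (s^-1 * expR (- s))%:E - (s^-1)%:E * mean_inv_exp s)%E).
  by move=> s; rewrite inE/= in_itv/= andbT => s0; rewrite rho_SigmaE.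
exact: measurable_funTS.
Qed.

(** Near 0 the weight min(1, s) compensates the factor 1/s, and at infinity
    the exponential is integrable: both at once since
    min(1, s) e^{-as} / s <= e^{-as}. *)
Lemma min1_exp_integrable (f : R -> \bar R) (a : R) : 0 < a ->
  measurable_fun (`]0, +oo[%classic : set R) f ->
  (forall s : R, 0 < s -> (0 <= f s)%E) ->
  (forall s : R, 0 < s -> (f s <= (s^-1 * expR (- (a * s)))%:E)%E) ->
  levy_density f.
Proof.
move=> a0 mf f0 fle; split; [by rewrite pos_itv|by []|].
apply: (@le_lt_trans _ _ (\int[mu]_(s in `]0%R, +oo[) (expR (- (a * s)))%:E)%E).
  apply: ge0_le_integral => //.
  - move=> s; rewrite /= in_itv/= andbT => s0.
    by rewrite mule_ge0 ?f0// lee_fin le_min ler01 ltW.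
  - apply: emeasurable_funM => //; apply/measurable_funTS/measurable_EFinP.
    exact: measurable_minr.
  - by apply/measurable_funTS/measurable_EFinP; exact: measurable_expM.
  - move=> s; rewrite /= in_itv/= andbT => s0.
    apply: (@le_trans _ _ (s%:E * (s^-1 * expR (- (a * s)))%:E)%E).
      apply: lee_pmul => //; last exact: fle.
      + by rewrite lee_fin le_min ler01 ltW.
      + exact: f0.
      + by rewrite lee_fin ge_min lexx orbT.
    by rewrite -EFinM mulrA divff ?gt_eqF// mul1r.
rewrite integral_itv_obnd_cbnd; last first.
  by apply/measurable_funTS/measurable_EFinP; exact: measurable_expM.
by rewrite integral_expR_ray// ltry.
Qed.

Lemma levy_density_rho_Sigma : levy_density (rho_Sigma PV V).
Proof.
apply: (min1_exp_integrable ltr01 measurable_rho_Sigma) => s s0.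
  exact: rho_Sigma_ge0.
by rewrite mul1r; exact: rho_Sigma_le.
Qed.

(** Frullani's integral with a = 1/V, averaged over V; on V = 0 both sides
    vanish. *)
Lemma integral_mean_inv_exp (omega : R) : 0 <= omega ->
  (\int[mu]_(s in `]0%R, +oo[)
     ((1 - expR (- (omega * s)))%:E * ((s^-1)%:E * mean_inv_exp s)) =
   \int[PV]_w (ln (1 + omega * V w))%:E)%E.
Proof.
move=> o0.
have e0 (s : R) : 0 < s -> 0 <= (1 - expR (- (omega * s))) * s^-1.
  move=> s0; rewrite mulr_ge0 ?invr_ge0 ?(ltW s0)// subr_ge0 expR_le1 oppr_le0.
  by rewrite mulr_ge0// ltW.
transitivity (\int[mu]_(s in `]0%R, +oo[) \int[PV]_w
    ((1 - expR (- (omega * s))) * s^-1 * inv_exp s (V w))%:E)%E.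
  apply: eq_integral => s; rewrite inE/= in_itv/= andbT => s0.
  rewrite muleA -EFinM -ge0_integralZl//; last by rewrite lee_fin e0.
rewrite (@tonelli_set _ _ _ _ _ mu PV _ _
  (fun s w => ((1 - expR (- (omega * s))) * s^-1 * inv_exp s (V w))%:E))//; last 2 first.
- apply/measurable_funTS/measurable_EFinP; apply: measurable_funM.
    apply: measurable_funM.
      apply: measurable_funB => //.
      exact: (measurableT_comp (measurable_expM omega) measurable_fst).
    exact: (measurableT_comp (@measurable_invr R) measurable_fst).
  by apply: measurable_inv_exp => //; exact: measurableT_comp.
- move=> s w; rewrite /= in_itv/= andbT => s0 _.
  by rewrite lee_fin mulr_ge0 ?inv_exp_ge0 ?e0.
apply: eq_integral => w _; have /andP[v0 v1] := V01 w.
have [vp|vn] := ltP 0 (V w); last first.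
  have -> : V w = 0 by apply/eqP; rewrite eq_le v0 andbT.
  rewrite mulr0 addr0 ln1 integral0_eq// => s _.
  by rewrite /inv_exp ltxx mulr0.
have := @frullani R (V w)^-1 omega; rewrite invrK invr_gt0 => <-//.
by apply: eq_integral => s _; rewrite /inv_exp vp mulrA.
Qed.

Lemma integral_ln1p_fin (omega : R) : 0 <= omega ->
  (\int[PV]_w (ln (1 + omega * V w))%:E)%E \is a fin_num.
Proof.
move=> o0; have l0 w : 0 <= ln (1 + omega * V w).
  by rewrite ln_ge0// lerDl mulr_ge0//; have /andP[] := V01 w.
rewrite ge0_fin_numE; last by apply: integral_ge0 => w _; rewrite lee_fin.
apply: (@le_lt_trans _ _ (\int[PV]_w omega%:E)%E); last first.
  by rewrite integral_probability_cst ltry.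
apply: ge0_le_integral => //.
- by move=> w _; rewrite lee_fin.
- apply/measurable_EFinP; apply: (measurableT_comp (@measurable_ln R)).
  by apply: measurable_funD => //; exact: measurable_funM.
- move=> w _; have /andP[v0 v1] := V01 w; rewrite lee_fin.
  apply: (le_trans (le_ln1Dx _)).
    by rewrite (lt_le_trans _ (mulr_ge0 o0 v0))// ltrN10.
  by rewrite ler_piMr.
Qed.

(** The difference of the exponents of the gamma and of the generalised gamma
    convolution; it makes sense because the second one is finite. *)
Lemma laplace_exponent_rho_Sigma (omega : R) : 0 <= omega ->
  (\int[mu]_(s in `]0%R, +oo[)
     ((1 - expR (- (omega * s)))%:E * rho_Sigma PV V s) =
   (ln (1 + omega))%:E - \int[PV]_w (ln (1 + omega * V w))%:E)%E.
Proof.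
move=> o0; rewrite -integral_mean_inv_exp//.
have := @frullani R 1 omega ltr01 o0; rewrite divr1 => <-.
have e0 (s : R) : 0 < s -> (0 <= (1 - expR (- (omega * s)))%:E)%E.
  by move=> s0; rewrite lee_fin subr_ge0 expR_le1 oppr_le0 mulr_ge0// ltW.
have me : measurable_fun setT (fun s : R => (1 - expR (- (omega * s)))%:E).
  by apply/measurable_EFinP; exact: measurable_funB.
have -> : (\int[mu]_(s in `]0%R, +oo[)
     ((1 - expR (- (omega * s))) * (s^-1 * expR (- (s * 1))))%:E =
   \int[mu]_(s in `]0%R, +oo[)
     ((1 - expR (- (omega * s)))%:E * rho_Sigma PV V s) +
   \int[mu]_(s in `]0%R, +oo[)
     ((1 - expR (- (omega * s)))%:E * ((s^-1)%:E * mean_inv_exp s)))%E.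
  rewrite -ge0_integralD//.
  - apply: eq_integral => s; rewrite inE/= in_itv/= andbT => s0.
    rewrite mulr1 EFinM rho_Sigma_decomposition// ge0_muleDr ?rho_Sigma_ge0//.
    by rewrite mule_ge0 ?mean_inv_exp_ge0// lee_fin invr_ge0 ltW.
  - move=> s; rewrite /= in_itv/= andbT => s0.
    by rewrite mule_ge0 ?e0 ?rho_Sigma_ge0.
  - apply: emeasurable_funM; [exact: measurable_funTS|exact: measurable_rho_Sigma].
  - move=> s; rewrite /= in_itv/= andbT => s0.
    by rewrite !mule_ge0 ?e0 ?mean_inv_exp_ge0// lee_fin invr_ge0 ltW.
  - by apply/measurable_funTS/emeasurable_funM.
by rewrite addeK// integral_mean_inv_exp// integral_ln1p_fin.
Qed.

(** Frullani's integral with a = 1 and omega = 1/V - 1 evaluates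
    the integral of (e^{-s} - e^{-s/V}) / s as - ln V.  Finiteness of the mean
    forces V > 0 almost surely. *)
Lemma integral_rho_Sigma (varrho : R) :
  (varrho%:E = \int[PV]_w (- lne (V w)%:E))%E ->
  (\int[mu]_(s in `]0%R, +oo[) rho_Sigma PV V s = varrho%:E)%E.
Proof.
move=> hv.
have mlne : measurable_fun setT (fun w => (- lne (V w)%:E)%E).
  rewrite (_ : (fun w => _) = (fun w => if 0 < V w then (- ln (V w))%:E else +oo%E)).
    apply: measurable_fun_ifT => //; first exact: measurable_fun_ltr.
    apply/measurable_EFinP/measurable_funN.
    exact: (measurableT_comp (@measurable_ln R)).
  apply/funext => w; case: ifPn => v0; first by rewrite lne_EFin.
  by rewrite le0_lneNy// lee_fin leNgt.
have lne0 w : (0 <= - lne (V w)%:E)%E.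
  by rewrite oppe_ge0 lne_le0 lee_fin; have /andP[] := V01 w.
have Vpos : {ae PV, forall w, 0 < V w}.
  have : PV.-integrable setT (fun w => - lne (V w)%:E)%E.
    apply/integrableP; split => //; under eq_integral do rewrite gee0_abs//.
    by rewrite -hv ltry.
  move=> /(integrable_ae measurableT); apply: filterS => w /(_ I).
  apply: contraPT; rewrite -leNgt => v0.
  by rewrite le0_lneNy ?lee_fin.
have r0 (s : R) w : 0 < s -> 0 <= s^-1 * (expR (- s) - inv_exp s (V w)).
  move=> s0; rewrite mulr_ge0 ?invr_ge0 ?(ltW s0)// subr_ge0 inv_exp_le ?(ltW s0)//.
  by have /andP[] := V01 w.
transitivity (\int[mu]_(s in `]0%R, +oo[) \int[PV]_w
    (s^-1 * (expR (- s) - inv_exp s (V w)))%:E)%E.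
  apply: eq_integral => s; rewrite inE/= in_itv/= andbT => s0.
  have iV0 : (0 <= (s^-1)%:E)%E by rewrite lee_fin invr_ge0 ltW.
  rewrite rho_SigmaE// EFinM -[in LHS](@integral_probability_cst _ _ _ PV (expR (- s))%:E).
  rewrite -muleBr//; last first.
    by rewrite fin_num_adde_defl// fin_numN mean_inv_exp_fin// ltW.
  under [RHS]eq_integral do rewrite EFinM.
  rewrite ge0_integralZl//; last 2 first.
  - apply/measurable_EFinP; apply: measurable_funB => //.
    exact: measurable_inv_exp.
  - by move=> w _; rewrite lee_fin subr_ge0 inv_exp_le ?(ltW s0)//; have /andP[] := V01 w.
  congr (_ * _)%E; under [RHS]eq_integral do rewrite EFinB.
  rewrite integralB//.
    exact: (@integrable_bounded _ _ _ PV (cst (expR (- s))) `|expR (- s)|).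
  apply: (@integrable_bounded _ _ _ PV (fun w => inv_exp s (V w)) (expR (- s))).
    exact: measurable_inv_exp.
  by move=> w; rewrite ger0_norm ?inv_exp_ge0// inv_exp_le ?(ltW s0)//; have /andP[] := V01 w.
rewrite (@tonelli_set _ _ _ _ _ mu PV _ _
  (fun s w => (s^-1 * (expR (- s) - inv_exp s (V w)))%:E))//; last 2 first.
- apply/measurable_funTS/measurable_EFinP; apply: measurable_funM.
    exact: (measurableT_comp (@measurable_invr R) measurable_fst).
  apply: measurable_funB.
    apply: measurableT_comp => //; apply: measurable_funN => //.
  by apply: measurable_inv_exp => //; exact: measurableT_comp.
- by move=> s w; rewrite /= in_itv/= andbT => s0 _; rewrite lee_fin r0.
rewrite hv.
apply: ge0_ae_eq_integral => //.
- apply: (@measurable_integral_set _ _ _ _ _ mu _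
    (fun w s => (s^-1 * (expR (- s) - inv_exp s (V w)))%:E)) => //.
    apply/measurable_funTS/measurable_EFinP; apply: measurable_funM.
      exact: (measurableT_comp (@measurable_invr R) measurable_snd).
    apply: measurable_funB.
      by apply: measurableT_comp => //; apply: measurable_funN.
    by apply: measurable_inv_exp => //; exact: measurableT_comp.
  by move=> w s; rewrite /= in_itv/= andbT => s0; rewrite lee_fin r0.
- by move=> w _; apply: integral_ge0 => s; rewrite /= in_itv/= andbT => s0; rewrite lee_fin r0.
- apply: filterS Vpos => w v0 _; have /andP[_ v1] := V01 w.
  rewrite lne_EFin//.
  have h : 0 <= (V w)^-1 - 1 by rewrite subr_ge0 invf_ge1.
  have := @frullani R 1 _ ltr01 h; rewrite divr1 (_ : 1 + _ = (V w)^-1); last by ring.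
  rewrite lnV ?posrE// EFinN => <-.
  apply: eq_integral => s _; congr EFin; rewrite /inv_exp v0 mulr1.
  rewrite mulrCA mulrBl mul1r -expRD; congr (_ * (_ - expR _)).
  by field; rewrite gt_eqF.
Qed.

End levy_densities.

(** * Decomposition of the gamma Levy density *)

Section levy_khintchine.
Context {R : realType}.
Local Notation mu := (@lebesgue_measure R).

(** Only the values on ]0, +oo[ enter the definition. *)
Lemma has_levy_density_eq d (T : measurableType d) (P : probability T R)
    (Z : R -> T -> R) (rho rho' : R -> \bar R) :
  (forall s, 0 < s -> rho s = rho' s) ->
  has_levy_density P Z rho -> has_levy_density P Z rho'.
Proof.
move=> rr [subZ [mrho rho0 irho] LZ]; split => //; first split.
- apply: (@eq_measurable_fun _ _ _ _ _ rho) => // s.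
  by rewrite inE/=; exact: rr.
- by move=> s s0; rewrite -rr//; exact: rho0.
- rewrite (_ : integral _ _ _ = \int[mu]_(s in `]0%R, +oo[) ((Num.min 1 s)%:E * rho s))%E//.
  by apply: eq_integral => s; rewrite inE/= in_itv/= andbT => s0; rewrite rr.
- move=> t omega t0 o0; rewrite LZ//; congr (expeR (- (_ * _)))%E.
  by apply: eq_integral => s; rewrite inE/= in_itv/= andbT => s0; rewrite rr.
Qed.

Lemma subordinator_laplace0 d (T : measurableType d) (P : probability T R)
    (Z : R -> T -> R) (omega : R) : subordinator P Z ->
  (\int[P]_w (expR (- (omega * Z 0 w)))%:E = 1)%E.
Proof.
move=> [mZ Z0 _ _ _]; rewrite -[RHS](@integral_probability_cst _ _ _ P).
apply: ge0_ae_eq_integral => //.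
- exact: (measurableT_comp (measurable_laplace_kernel omega) (mZ _ (lexx _))).
- by apply: filterS Z0 => w /= -> _; rewrite mulr0 oppr0 expR0.
Qed.

Lemma expeR_powR (x t : R) : 0 < x ->
  expeR (- (t%:E * (ln x)%:E))%E = (x `^ (- t))%:E.
Proof. by move=> x0; rewrite /= /powR gt_eqF// mulNr. Qed.

(** The Laplace transform (1 + omega / delta)^{-t} has the right exponent by
    Frullani's integral.  The gamma density describes the process only at
    t > 0, so t = 0 is treated apart. *)
Lemma gamma_subordinator_levy d (T : measurableType d) (P : probability T R)
    (delta : R) (G : R -> T -> R) : 0 < delta ->
  gamma_subordinator P 1 delta^-1 G ->
  has_levy_density P G (fun s => (s^-1 * expR (- (s * delta)))%:E).
Proof.
move=> d0 [subG dG]; split => //.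
  apply: (min1_exp_integrable d0).
  - apply/measurable_funTS/measurable_EFinP/measurable_funM; first exact: measurable_invr.
    under eq_fun do rewrite mulrC.
    by apply/measurable_EFinP; exact: measurable_laplace_kernel.
  - by move=> s s0; rewrite lee_fin mulr_ge0 ?expR_ge0// invr_ge0 ltW.
  - by move=> s s0; rewrite (mulrC delta).
move=> t omega; rewrite le_eqVlt => /predU1P[<-|t0] o0.
  by rewrite subordinator_laplace0// mul0e oppe0 expeR0.
have [mG _ _ _ _] := subG.
have c0 : 0 < delta^-1 by rewrite invr_gt0.
rewrite (@gamma_laplace _ _ _ P (G t) t delta^-1)//; last 2 first.
- by apply: mG; exact: ltW.
- by have := dG t t0; rewrite mul1r.
rewrite frullani// expeR_powR//.
by rewrite ltr_pwDl// divr_ge0// ltW.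
Qed.

Context {dV : measure_display} {TV : measurableType dV}
  (PV : probability TV R) (V : TV -> R).
Hypotheses (mV : measurable_fun setT V) (V01 : forall w, 0 <= V w <= 1).

(** A change of scale: e^{-s/(V/delta)} = e^{-s delta / V}. *)
Lemma GGC_levy d (T : measurableType d) (P : probability T R)
    (delta : R) (Omega : R -> T -> R) : 0 < delta ->
  is_GGC P 1 PV (fun w => V w / delta) Omega ->
  has_levy_density P Omega
    (fun s => ((s^-1)%:E * expect_exp_inv PV V (s * delta))%E).
Proof.
move=> d0 [_ _ _ _]; apply: has_levy_density_eq => s s0.
by rewrite div1r expect_exp_invE// expect_exp_invE1// mulr_gt0.
Qed.

Lemma levy_decomposition (delta s : R) : 0 < delta -> 0 < s ->
  ((s^-1 * expR (- (s * delta)))%:E =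
   delta%:E * rho_Sigma PV V (s * delta)
   + (s^-1)%:E * expect_exp_inv PV V (s * delta))%E.
Proof.
move=> d0 s0; have sd0 : 0 < s * delta by rewrite mulr_gt0.
rewrite expect_exp_invE1// rho_SigmaE//.
rewrite -(fineK (mean_inv_exp_fin PV mV V01 (ltW sd0))).
rewrite -[X in (_ - X)%E]EFinM -EFinB -!EFinM -EFinD; congr EFin.
by field; rewrite !gt_eqF.
Qed.

(** The multiplication of extended reals by s is measurable piece by piece: at
    the two infinities and on the real line. *)
Lemma measurable_expeRN (s : R) : 0 < s ->
  measurable_fun [set: \bar R] (fun x => expeR (- (s%:E * x)))%E.
Proof.
move=> s0.
rewrite (_ : (fun x => _) = (fun x => if x == +oo%E then 0%E else
   if x == -oo%E then +oo%E else (expR (- (s * fine x)))%:E)).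
  apply: measurable_fun_ifT => //.
    apply: (measurable_fun_bool true).
    rewrite setTI (_ : _ @^-1` _ = [set +oo%E]); first exact: emeasurable_set1.
    by apply/seteqP; split => x /= /eqP.
  apply: measurable_fun_ifT => //.
    apply: (measurable_fun_bool true).
    rewrite setTI (_ : _ @^-1` _ = [set -oo%E]); first exact: emeasurable_set1.
    by apply/seteqP; split => x /= /eqP.
  apply/measurable_EFinP; apply: measurableT_comp => //; apply: measurable_funN.
  by apply: measurable_funM => //; exact: fine_measurable.
apply/funext => -[r| |] //=; first by rewrite gt0_muley ?lte_fin.
by rewrite gt0_muleNy ?lte_fin.
Qed.

(** 1/V = 1 + X in law, so e^{-s/V} = e^{-s} e^{-sX}; on V = 0 both are 0. *)
Lemma rho_Sigma_ratio dX (TX : measurableType dX) (PX : probability TX R)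
    (X : TX -> \bar R) (s : R) : measurable_fun setT X ->
  eq_law PX X PV (fun w => ((1 - V w)%:E / (V w)%:E)%E) -> 0 < s ->
  (rho_Sigma PV V s = (s^-1 * expR (- s))%:E
     * (1 - \int[PX]_w expeR (- (s%:E * X w))))%E.
Proof.
move=> mX hX s0.
have mR : measurable_fun setT (fun w => ((1 - V w)%:E / (V w)%:E)%E).
  rewrite (_ : (fun w => _) = (fun w => if 0 < V w then ((1 - V w) * (V w)^-1)%:E else +oo%E)).
    apply: measurable_fun_ifT => //; first exact: measurable_fun_ltr.
    apply/measurable_EFinP/measurable_funM; first exact: measurable_funB.
    exact: (measurableT_comp (@measurable_invr R) mV).
  apply/funext => w; have /andP[v0 _] := V01 w; rewrite inver.
  have [->|vn0] := eqVneq (V w) 0; first by rewrite ltxx subr0 mul1e.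
  by rewrite lt_neqAle eq_sym vn0 v0 EFinM.
rewrite (ge0_eq_law_integral mX mR (measurable_expeRN s0) (fun _ => expeR_ge0 _) hX).
have -> : (\int[PV]_w expeR (- (s%:E * ((1 - V w)%:E / (V w)%:E))) =
    (expR s)%:E * mean_inv_exp PV V s)%E.
  rewrite -ge0_integralZl//; last 2 first.
  - by apply/measurable_EFinP/measurable_inv_exp.
  - by move=> *; rewrite lee_fin ?inv_exp_ge0 ?expR_ge0.
  apply: eq_integral => w _; have /andP[v0 _] := V01 w; rewrite inver /inv_exp.
  have [->|vn0] := eqVneq (V w) 0.
    by rewrite ltxx subr0 mul1e gt0_muley ?lte_fin// mule0.
  have vp : 0 < V w by rewrite lt_neqAle eq_sym vn0.
  rewrite vp -[X in (s%:E * X)%E]EFinM -[X in (- X)%E]EFinM -EFinN.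
  rewrite -[RHS]EFinM -expRD; congr (expR _)%:E.
  by field.
rewrite rho_SigmaE// -(fineK (mean_inv_exp_fin PV mV V01 (ltW s0))).
rewrite -[X in (_ - X)%E]EFinM -EFinB -[X in (1 - X)%E]EFinM -EFinB -EFinM; congr EFin.
by rewrite mulrBr mulr1 mulrA -(mulrA s^-1) -expRD addNr expR0 mulr1.
Qed.

End levy_khintchine.

(** * Triples of independent variables and laws of functions *)

Section independence_tools.
Context {d} {T : measurableType d} {R : realType} (P : probability T R).

Lemma indep2_comp d1 d2 d3 d4 (U1 : measurableType d1) (U2 : measurableType d2)
    (W1 : measurableType d3) (W2 : measurableType d4)
    (X : T -> U1) (Y : T -> U2) (f : U1 -> W1) (g : U2 -> W2) :
  measurable_fun setT f -> measurable_fun setT g ->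
  indep2 P X Y -> indep2 P (f \o X) (g \o Y).
Proof.
move=> mf mg XY A B mA mB.
have mfA : measurable (f @^-1` A) by rewrite -[_ @^-1` _]setTI; exact: mf.
have mgB : measurable (g @^-1` B) by rewrite -[_ @^-1` _]setTI; exact: mg.
exact: (XY _ _ mfA mgB).
Qed.

Lemma indep2C d1 d2 (U1 : measurableType d1) (U2 : measurableType d2)
    (X : T -> U1) (Y : T -> U2) : indep2 P X Y -> indep2 P Y X.
Proof. by move=> XY A B mA mB; rewrite setIC muleC; exact: XY. Qed.

Lemma indep3_upto (X Y Z : T -> R) : indep3 P X Y Z ->
  indep_upto P 3 (fun i => nth X [:: X; Y; Z] i).
Proof.
move=> iXYZ A mA.
have := iXYZ (enum 'I_3) (fun i => A i) (enum_uniq _) (fun i => mA i).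
rewrite big_enum/= => H.
transitivity (\prod_(i < 3) P (tnth [tuple X; Y; Z] i @^-1` A i))%E.
  rewrite -H; congr (P _); apply/seteqP; split=> w /= h i /=.
    by move=> _; have := h i (ltn_ord i); rewrite (tnth_nth X).
  move=> i3; have := h (Ordinal i3); rewrite (tnth_nth X)/=; apply.
  by rewrite mem_enum.
by apply: eq_bigr => i _; rewrite (tnth_nth X).
Qed.

(** The grouping used below: the last two variables together against the first,
    then against each other. *)
Lemma indep3_pairs (X Y Z : T -> R) :
  measurable_fun setT X -> measurable_fun setT Y -> measurable_fun setT Z ->
  indep3 P X Y Z ->
  indep2 P (fun w => (Y w, Z w)) X /\ indep2 P Y Z.
Proof.
move=> mX mY mZ /indep3_upto i3.
have m3 i : (i < 1 + 2)%N -> measurable_fun setT (nth X [:: X; Y; Z] i).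
  by case: i => [|[|[|]]].
have h1 := indep_upto_group m3 i3.
have m2 i : (i < 1 + 1)%N -> measurable_fun setT (nth X [:: X; Y; Z] (1 + i)%N).
  by case: i => [|[|]].
have h2 := indep_upto_group m2 (indep_upto_shift (a := 1) (n := 2) i3).
have mt n (i : 'I_n) := measurable_tnth (T := R) i.
split.
- apply: indep2C.
  have := indep2_comp (f := fun t : 1.-tuple R => tnth t ord0)
    (g := fun t : 2.-tuple R => (tnth t ord0, tnth t ord_max)) (mt _ _)
    (measurable_fun_pair (mt _ _) (mt _ _)) h1.
  rewrite (_ : _ \o _ = X); last by apply/funext => w; rewrite /= tnth_mktuple.
  rewrite (_ : _ \o _ = (fun w => (Y w, Z w)))//.
  by apply/funext => w; rewrite /= !tnth_mktuple.
- have := indep2_comp (f := fun t : 1.-tuple R => tnth t ord0)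
    (g := fun t : 1.-tuple R => tnth t ord0) (mt _ _) (mt _ _) h2.
  rewrite (_ : _ \o _ = Y); last by apply/funext => w; rewrite /= tnth_mktuple.
  by rewrite (_ : _ \o _ = Z)//; apply/funext => w; rewrite /= tnth_mktuple.
Qed.

Lemma indep3_integral (X Y Z : T -> R) (f : (R * R) * R -> \bar R) :
  measurable_fun setT X -> measurable_fun setT Y -> measurable_fun setT Z ->
  indep2 P (fun w => (Y w, Z w)) X -> indep2 P Y Z ->
  measurable_fun setT f -> (forall z, 0 <= f z)%E ->
  (\int[P]_w f ((Y w, Z w), X w) =
   \int[P]_w1 \int[P]_w2 \int[P]_w f ((Y w1, Z w2), X w))%E.
Proof.
move=> mX mY mZ iYZX iYZ mf f0.
have mYZ : measurable_fun setT (fun w => (Y w, Z w)) by exact: measurable_fun_pair.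
rewrite (indep2_integral mYZ mX mf f0 iYZX).
pose g (z : R * R) := (\int[P]_w f (z, X w))%E.
have mg : measurable_fun setT g.
  apply: (@measurable_integral_set _ _ _ _ _ P setT (fun z w => f (z, X w))) => //.
  apply: measurable_funTS; apply: (measurableT_comp mf).
  apply: measurable_fun_pair => //; exact: measurableT_comp.
have g0 z : (0 <= g z)%E by exact: integral_ge0.
exact: (indep2_integral mY mZ mg g0 iYZ).
Qed.

End independence_tools.

Section laws.
Context {R : realType}.

Lemma eq_law_sym d1 d2 d (T1 : measurableType d1) (T2 : measurableType d2)
    (U : measurableType d) (P1 : probability T1 R) (P2 : probability T2 R)
    (X1 : T1 -> U) (X2 : T2 -> U) : eq_law P1 X1 P2 X2 -> eq_law P2 X2 P1 X1.
Proof. by move=> h A mA; rewrite h. Qed.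

Lemma eq_law_trans d1 d2 d3 d (T1 : measurableType d1) (T2 : measurableType d2)
    (T3 : measurableType d3) (U : measurableType d) (P1 : probability T1 R)
    (P2 : probability T2 R) (P3 : probability T3 R)
    (X1 : T1 -> U) (X2 : T2 -> U) (X3 : T3 -> U) :
  eq_law P1 X1 P2 X2 -> eq_law P2 X2 P3 X3 -> eq_law P1 X1 P3 X3.
Proof. by move=> h1 h2 A mA; rewrite h1// h2. Qed.

Lemma eq_law_comp d1 d2 d d' (T1 : measurableType d1) (T2 : measurableType d2)
    (U : measurableType d) (W : measurableType d') (P1 : probability T1 R)
    (P2 : probability T2 R) (X1 : T1 -> U) (X2 : T2 -> U) (f : U -> W) :
  measurable_fun setT f ->
  eq_law P1 X1 P2 X2 -> eq_law P1 (f \o X1) P2 (f \o X2).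
Proof.
move=> mf h A mA.
have mfA : measurable (f @^-1` A) by rewrite -[_ @^-1` _]setTI; exact: mf.
exact: (h _ mfA).
Qed.

Lemma eq_law_ae_in d1 d2 d (T1 : measurableType d1) (T2 : measurableType d2)
    (U : measurableType d) (P1 : probability T1 R) (P2 : probability T2 R)
    (X1 : T1 -> U) (X2 : T2 -> U) (A : set U) :
  measurable_fun setT X1 -> measurable_fun setT X2 -> measurable A ->
  eq_law P1 X1 P2 X2 -> {ae P2, forall w, A (X2 w)} ->
  {ae P1, forall w, A (X1 w)}.
Proof.
move=> mX1 mX2 mA h12 hA.
have mAC : measurable (~` A) by exact: measurableC.
have m1 : measurable (X1 @^-1` ~` A) by rewrite -[_ @^-1` _]setTI; exact: mX1.
have m2 : measurable (X2 @^-1` ~` A) by rewrite -[_ @^-1` _]setTI; exact: mX2.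
exists (X1 @^-1` ~` A); split => //.
rewrite [LHS](h12 _ mAC).
have [h _] := negligibleP P2 m2.
exact: h.
Qed.

Lemma has_density_ae_in d (T : measurableType d) (P : probability T R)
    (X : T -> R) (f : R -> R) (A : set R) :
  measurable_fun setT X -> measurable A -> (forall x, ~ A x -> f x = 0) ->
  has_density P X f -> {ae P, forall w, A (X w)}.
Proof.
move=> mX mA fA [mf f0 PX].
have mAC : measurable (~` A) by exact: measurableC.
have m1 : measurable (X @^-1` ~` A) by rewrite -[_ @^-1` _]setTI; exact: mX.
exists (X @^-1` ~` A); split => //.
by rewrite [LHS](PX _ mAC) integral0_eq// => x /= /fA ->.
Qed.

(** Uniform bounds on the derivative allow differentiation under the mean. *)
Lemma mean_derivable d (T : measurableType d) (P : probability T R)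
    (f df : R -> T -> R) (a b K : R) :
  (forall x, x \in `]a, b[ -> measurable_fun setT (f x)) ->
  (forall x w, x \in `]a, b[ -> `|f x w| <= K) ->
  (forall x w, x \in `]a, b[ -> is_derive x (1%R : R) (f ^~ w) (df x w)) ->
  (forall x w, x \in `]a, b[ -> `|df x w| <= K) ->
  forall x, x \in `]a, b[ ->
  is_derive x (1%R : R) (fun x => \int[P]_w f x w) (\int[P]_w df x w).
Proof.
move=> mf fK dfE dfK x xab.
have intf y : `]a, b[%classic y -> P.-integrable setT (EFin \o f y).
  by move=> /= yab; apply: (@integrable_bounded _ _ _ _ _ K) => [|w]; [exact: mf|exact: fK].
have der y w : `]a, b[%classic y -> setT w -> derivable (f ^~ w) y 1.
  by move=> yab _; have [] := dfE y w yab.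
have K0 : 0 <= Num.max 0 K by rewrite le_max lexx.
have intG : P.-integrable setT (EFin \o (fun=> Num.max 0 K) : T -> \bar R).
  by apply: (@integrable_bounded _ _ _ _ _ (Num.max 0 K)) => // w; rewrite ger0_norm.
have pE y w : y \in `]a, b[ -> partial1of2 f y w = df y w.
  by move=> yab; rewrite partial1of2E; have [_ ->] := dfE y w yab.
have ub y w : `]a, b[%classic y -> setT w -> `|partial1of2 f y w| <= Num.max 0 K.
  by move=> yab _; rewrite pE// le_max dfK// orbT.
split.
  exact: (derivable_under_integral measurableT xab intf der (fun=> K0) intG ub).
have := differentiation_under_integral measurableT xab intf der (fun=> K0) intG ub.
rewrite derive1E => ->; apply: eq_Rintegral => w _.
by rewrite -pE.
Qed.

End laws.

(** * A differential equation for the mean of powers *)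

Section cifarelli_regazzini.
Context {R : realType}.

Lemma Rintegral_cst_prob d (T : measurableType d) (P : probability T R) (r : R) :
  \int[P]_w r = r.
Proof. by rewrite /Rintegral integral_probability_cst. Qed.

Lemma is_derive_affine (c u : R) :
  is_derive u (1%R : R) (fun u : R => 1 + u * c) c.
Proof.
have h := is_deriveD (is_derive_cst (1 : R) u (1%R : R))
  (is_deriveM (is_derive_id u (1%R : R)) (is_derive_cst c u (1%R : R))).
refine (@is_derive_eq _ _ _ _ _ _ _ _ h _).
by rewrite scaler0 !add0r /GRing.scale/= mulr1.
Qed.

(** For u > -1/2 and m in [0, 1] one has 1 + u m >= 1/2, which bounds the
    integrands.  The interval starts below 0 so that u = 0 is interior. *)
Lemma mean_power_derive d (T : measurableType d) (P : probability T R)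
    (m : T -> R) (theta b : R) : 0 < theta ->
  measurable_fun setT m -> (forall w, 0 <= m w <= 1) ->
  forall u, u \in `](- 2^-1), b[ ->
  is_derive u (1%R : R) (fun u => \int[P]_w (1 + u * m w) `^ (- theta))
    (\int[P]_w (- theta * (1 + u * m w) `^ (- theta - 1) * m w)).
Proof.
move=> t0 mm m01.
have lb u w : u \in `](- 2^-1), b[ -> 2^-1 <= 1 + u * m w.
  rewrite in_itv/= => /andP[u1 _]; have /andP[m0 m1] := m01 w.
  have [u0|u0] := leP 0 u; first by have := mulr_ge0 u0 m0; lra.
  have : - u * m w <= - u by rewrite ler_piMr// oppr_ge0 ltW.
  by rewrite mulNr; lra.
have pos u w : u \in `](- 2^-1), b[ -> 0 < 1 + u * m w.
  by move=> /(lb u w); apply: lt_le_trans; rewrite invr_gt0.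
have pw (p : R) u w : 0 <= p -> u \in `](- 2^-1), b[ ->
    (1 + u * m w) `^ (- p) <= 2^-1 `^ (- p).
  move=> p0 uab; rewrite !powRN lef_pV2 ?posrE ?powR_gt0 ?pos//.
  by apply: ge0_ler_powR; rewrite ?nnegrE ?(ltW (pos _ _ uab))// ?lb.
pose K := 2^-1 `^ (- theta) + theta * 2^-1 `^ (- (theta + 1)) : R.
apply: (@mean_derivable _ _ _ _ _ _ _ _ K).
- move=> u uab; apply: (measurableT_comp (@measurable_powR R _)).
  by apply: measurable_funD => //; exact: measurable_funM.
- move=> u w uab; rewrite ger0_norm ?powR_ge0// (le_trans (pw _ _ _ (ltW t0) uab))//.
  by rewrite /K lerDl mulr_ge0 ?powR_ge0// ltW.
- move=> u w uab.
  have d1 := is_derive_affine (m w) u.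
  have d2 := is_derive1_powR (- theta) (pos u w uab).
  exact: (@is_derive1_comp _ (fun y : R => y `^ (- theta))
    (fun u : R => 1 + u * m w) u _ _ d2 d1).
- move=> u w uab; have /andP[m0 m1] := m01 w.
  rewrite -opprD !mulNr normrN ger0_norm ?mulr_ge0 ?powR_ge0 ?(ltW t0)//.
  apply: (@le_trans _ _ (theta * 2^-1 `^ (- (theta + 1)))).
    rewrite -[leRHS]mulr1; apply: ler_pM => //.
      by rewrite mulr_ge0 ?powR_ge0// ltW.
    by rewrite ler_pM2l// pw// addr_ge0// ltW.
  by rewrite /K lerDr powR_ge0.
Qed.

Lemma mean_ln_derive d (T : measurableType d) (P : probability T R)
    (v : T -> R) (b : R) : 0 < b ->
  measurable_fun setT v -> (forall w, 0 <= v w <= 1) ->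
  forall u, u \in `](- 2^-1), b[ ->
  is_derive u (1%R : R) (fun u => \int[P]_w ln (1 + u * v w))
    (\int[P]_w ((1 + u * v w)^-1 * v w)).
Proof.
move=> b0 mv v01.
have lb u w : u \in `](- 2^-1), b[ -> 2^-1 <= 1 + u * v w <= 1 + b.
  rewrite in_itv/= => /andP[u1 ub]; have /andP[v0 v1] := v01 w.
  have [u0|u0] := leP 0 u.
    have : u * v w <= u by rewrite ler_piMr.
    by have := mulr_ge0 u0 v0; lra.
  have : - u * v w <= - u by rewrite ler_piMr// oppr_ge0 ltW.
  have : 0 <= - u * v w by rewrite mulr_ge0// oppr_ge0 ltW.
  by rewrite mulNr; lra.
have pos u w : u \in `](- 2^-1), b[ -> 0 < 1 + u * v w.
  by move=> /(lb u w)/andP[+ _]; apply: lt_le_trans; rewrite invr_gt0.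
pose K := 2 + b : R.
apply: (@mean_derivable _ _ _ _ _ _ _ _ K).
- move=> u uab; apply: (measurableT_comp (@measurable_ln R)).
  by apply: measurable_funD => //; exact: measurable_funM.
- move=> u w uab; have /andP[l1 l2] := lb u w uab; have p := pos u w uab.
  rewrite ler_norml; apply/andP; split; last first.
    by have := @le_ln1Dx _ (u * v w); rewrite /K; lra.
  rewrite -[ln _]opprK -lnV ?posrE// lerN2.
  have := @le_ln1Dx R ((1 + u * v w)^-1 - 1).
  have : (1 + u * v w)^-1 <= 2.
    by rewrite -[leRHS]invrK lef_pV2 ?posrE ?invr_gt0.
  rewrite (_ : 1 + ((1 + u * v w)^-1 - 1) = (1 + u * v w)^-1); last by ring.
  have : 0 < (1 + u * v w)^-1 by rewrite invr_gt0.
  by rewrite /K; lra.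
- move=> u w uab.
  have d1 := is_derive_affine (v w) u.
  have d2 := is_derive1_ln (pos u w uab).
  exact: (@is_derive1_comp _ (@ln R) (fun u : R => 1 + u * v w) u _ _ d2 d1).
- move=> u w uab; have /andP[v0 v1] := v01 w; have p := pos u w uab.
  have /andP[l1 l2] := lb u w uab.
  have : (1 + u * v w)^-1 <= 2.
    by rewrite -[leRHS]invrK lef_pV2 ?posrE ?invr_gt0.
  have p' : 0 < (1 + u * v w)^-1 by rewrite invr_gt0.
  rewrite ger0_norm; last by rewrite mulr_ge0// ltW.
  move=> h.
  apply: (@le_trans _ _ ((1 + u * v w)^-1)); first by rewrite ler_piMr// ltW.
  by rewrite /K; lra.
Qed.

(** Write psi(u) for the mean of (1 + u m)^{-theta} and K(u) for that of
    ln(1 + u v).  As u m = (1 + u m) - 1, multiplying the derivatives by u gives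
    u psi' = - theta (psi - E (1 + u m)^{-(theta + 1)}) and
    u K' = 1 - E (1 + u v)^{-1}, so the hypothesis says that psi e^{theta K} has
    derivative 0; at u = 0 it is 1. *)
Lemma mean_power_ode d (T : measurableType d) (P : probability T R)
    d' (T' : measurableType d') (P' : probability T' R)
    (m : T -> R) (v : T' -> R) (theta : R) : 0 < theta ->
  measurable_fun setT m -> (forall w, 0 <= m w <= 1) ->
  measurable_fun setT v -> (forall w, 0 <= v w <= 1) ->
  (forall u, 0 < u -> \int[P]_w (1 + u * m w) `^ (- (theta + 1)) =
    (\int[P]_w (1 + u * m w) `^ (- theta)) * \int[P']_w (1 + u * v w)^-1) ->
  forall u, 0 <= u -> \int[P]_w (1 + u * m w) `^ (- theta) =
    expR (- (theta * \int[P']_w ln (1 + u * v w))).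
Proof.
move=> t0 mm m01 mv v01 H u; rewrite le_eqVlt => /predU1P[<-|u0].
  under eq_Rintegral do rewrite mul0r addr0 powR1.
  under [in RHS]eq_Rintegral do rewrite mul0r addr0 ln1.
  by rewrite !Rintegral_cst_prob mulr0 oppr0 expR0.
pose psi (u : R) := \int[P]_w (1 + u * m w) `^ (- theta).
pose K (u : R) := \int[P']_w ln (1 + u * v w).
pose Phi (u : R) := psi u * expR (theta * K u).
have b0 : 0 < u + 1 by rewrite addr_gt0.
have dpsi := mean_power_derive P (b := u + 1) t0 mm m01.
have dK := mean_ln_derive P' b0 mv v01.
have dPhi x : x \in `](- 2^-1), (u + 1)[ -> is_derive x (1%R : R) Phi
    (psi x * (theta * (\int[P']_w ((1 + x * v w)^-1 * v w)) * expR (theta * K x)) +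
     expR (theta * K x) * (\int[P]_w (- theta * (1 + x * m w) `^ (- theta - 1) * m w))).
  move=> xab.
  pose tK (x : R) := theta * K x.
  have dtK : is_derive x (1%R : R) tK
      (theta * \int[P']_w ((1 + x * v w)^-1 * v w)).
    exact: (is_deriveZ _ (dK x xab)).
  have de : is_derive x (1%R : R) (expR \o tK) (expR (tK x) *
      (theta * \int[P']_w ((1 + x * v w)^-1 * v w))).
    exact: (is_derive1_comp (is_derive_expR (tK x)) dtK).
  refine (@is_derive_eq _ _ _ _ _ _ _ _ (is_deriveM (dpsi x xab) de) _).
  rewrite /GRing.scale/= /psi /tK; ring.
have dPhi0 x : x \in `]0, u[ -> is_derive x (1%R : R) Phi 0.
  rewrite in_itv/= => /andP[x0 xu].
  have xab : x \in `](- 2^-1), (u + 1)[ by rewrite in_itv/=; lra.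
  have posm w : 0 < 1 + x * m w.
    by have /andP[? _] := m01 w; rewrite ltr_pwDl// mulr_ge0// ltW.
  have posv w : 0 < 1 + x * v w.
    by have /andP[? _] := v01 w; rewrite ltr_pwDl// mulr_ge0// ltW.
  refine (@is_derive_eq _ _ _ _ _ _ _ _ (dPhi x xab) _).
  have fv : x * (\int[P']_w ((1 + x * v w)^-1 * v w)) = 1 - \int[P']_w (1 + x * v w)^-1.
    rewrite -RintegralZl//; last first.
      apply: (@integrable_bounded _ _ _ _ _ 1) => [|w].
        apply: measurable_funM => //; apply: (measurableT_comp (@measurable_invr R)).
        by apply: measurable_funD => //; exact: measurable_funM.
      have /andP[v0 v1] := v01 w.
      rewrite ger0_norm; last by rewrite mulr_ge0// invr_ge0 ltW.
      rewrite mulrC ler_pdivrMr// mul1r (le_trans v1)// lerDl mulr_ge0//.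
      exact: ltW.
    rewrite -[X in _ = X - _](Rintegral_cst_prob P' 1) -RintegralB//.
    - apply: eq_Rintegral => w _; field.
      by rewrite gt_eqF.
    - by apply: (@integrable01 _ _ _ _ (fun=> 1)) => // w; rewrite ler01 lexx.
    - apply: (@integrable_bounded _ _ _ _ _ 1) => [|w].
        apply: (measurableT_comp (@measurable_invr R)).
        by apply: measurable_funD => //; exact: measurable_funM.
      rewrite ger0_norm; last by rewrite invr_ge0 ltW.
      rewrite invf_le1// lerDl mulr_ge0//; [exact: ltW|by case/andP: (v01 w)].
  have bp (p : R) w : 0 <= p -> `|(1 + x * m w) `^ (- p)| <= 1.
    move=> p0; rewrite ger0_norm ?powR_ge0// powRN_le1//.
    by rewrite lerDl mulr_ge0//; [exact: ltW|case/andP: (m01 w)].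
  have mp (p : R) : measurable_fun setT (fun w => (1 + x * m w) `^ p).
    apply: (measurableT_comp (@measurable_powR R _)).
    by apply: measurable_funD => //; exact: measurable_funM.
  have fm : x * (\int[P]_w (- theta * (1 + x * m w) `^ (- theta - 1) * m w)) =
      - theta * (psi x - \int[P]_w (1 + x * m w) `^ (- (theta + 1))).
    rewrite -RintegralZl//; last first.
      apply: (@integrable_bounded _ _ _ _ _ theta) => [|w].
        by apply: measurable_funM => //; apply: measurable_funM.
      have /andP[m0 m1] := m01 w.
      rewrite -opprD !mulNr normrN -mulrA normrM (gtr0_norm t0) ler_piMr ?(ltW t0)//.
      rewrite normrM mulr_ile1// ?bp ?addr_ge0 ?(ltW t0)//.
      by rewrite ger0_norm.
    rewrite /psi -RintegralB//.
    - rewrite -RintegralZl//.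
        apply: eq_Rintegral => w _; rewrite -opprD.
        have -> : (1 + x * m w) `^ (- theta) = (1 + x * m w) * (1 + x * m w) `^ (- (theta + 1)).
          by rewrite mulr_powR//; congr (_ `^ _); ring.
        ring.
      apply: (@integrable_bounded _ _ _ _ _ 2) => [|w].
        exact: measurable_funB.
      by rewrite (le_trans (ler_normB _ _))// (_ : 2 = 1 + 1 :> R)// lerD// bp// ?addr_ge0 ?ltW.
    - by apply: (@integrable_bounded _ _ _ _ _ 1) => // w; rewrite bp ?ltW.
    - by apply: (@integrable_bounded _ _ _ _ _ 1) => // w; rewrite bp ?addr_ge0 ?ltW.
  apply: (mulfI (lt0r_neq0 x0)); rewrite mulr0 mulrDr.
  rewrite [X in _ + X = _]mulrCA fm H//.
  rewrite (_ : x * _ = psi x * theta * expR (theta * K x) *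
    (x * \int[P']_w ((1 + x * v w)^-1 * v w))); last by ring.
  by rewrite fv /psi; ring.
have cPhi : {within `[0, u], continuous Phi}.
  apply: continuous_in_subspaceT => x; rewrite inE/= in_itv/= => /andP[x0 xu].
  have xab : x \in `](- 2^-1), (u + 1)[ by rewrite in_itv/=; lra.
  by apply: differentiable_continuous; apply/derivable1_diffP; have [] := dPhi x xab.
have [c _ E] := MVT_segment (ltW u0) dPhi0 cPhi.
have : Phi u = Phi 0 by apply/eqP; rewrite -subr_eq0 E mul0r.
rewrite {2}/Phi /psi /K.
under eq_Rintegral do rewrite mul0r addr0 powR1.
under [in X in _ = _ * expR (_ * X)]eq_Rintegral do rewrite mul0r addr0 ln1.
rewrite !Rintegral_cst_prob mulr0 expR0 mulr1 /Phi => h.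
change (psi u = expR (- (theta * K u))).
by rewrite expRN -[LHS]mulr1 -(mulfV (lt0r_neq0 (expR_gt0 (theta * K u)))) mulrA h mul1r.
Qed.

End cifarelli_regazzini.

(** * Solutions of the beta equation lie in the unit interval *)

Section beta_fixed_point.
Context {R : realType}.

(** [beta_integral] with a = c = 1 gives B(theta, 1) = 1 / theta. *)
Lemma beta1_pdfE (theta x : R) : 0 < theta ->
  real_beta_pdf theta 1 x = if 0 < x < 1 then theta * x `^ (theta - 1) else 0.
Proof.
move=> t0; rewrite /real_beta_pdf; case: ifP => // /andP[x0 x1].
rewrite subrr powRr0 mulr1.
suff -> : Beta_fun theta 1 = theta^-1 by rewrite invrK mulrC.
rewrite /Beta_fun /Rintegral subrr.
have := beta_integral t0 ltr01 ltr01.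
rewrite powR1 divr1.
have -> : (\int[lebesgue_measure]_(b in `]0%R, 1%R[)
    (theta * b `^ (theta - 1) * (1 * b + 1 * (1 - b)) `^ (- (theta + 1)))%:E =
  theta%:E * \int[lebesgue_measure]_(b in `]0%R, 1%R[)
    (b `^ (theta - 1) * (1 - b) `^ 0)%:E)%E.
  rewrite -ge0_integralZl//.
  - apply: eq_integral => b _; rewrite !mul1r subrKC powR1 mulr1 powRr0 mulr1.
    by rewrite EFinM.
  - apply/measurable_EFinP; apply: measurable_funM.
      exact: measurable_funTS (@measurable_powR _ _).
    apply: measurable_funTS; apply: (measurableT_comp (@measurable_powR R _)).
    exact: measurable_funB.
  - by move=> b _; rewrite lee_fin mulr_ge0 ?powR_ge0.
  - by rewrite lee_fin ltW.
case: (\int[_]_(_ in _) _)%E => [r| |]/=.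
- by rewrite -EFinM => -[tr]; apply: (mulfI (lt0r_neq0 t0)); rewrite tr divff// gt_eqF.
- by rewrite gt0_muley ?lte_fin.
- by rewrite gt0_muleNy ?lte_fin.
Qed.

Lemma beta1_ae d (T : measurableType d) (P : probability T R) (B : T -> R)
    (theta : R) : measurable_fun setT B ->
  has_density P B (real_beta_pdf theta 1) -> {ae P, forall w, 0 < B w < 1}.
Proof.
move=> mB PB.
have h : {ae P, forall w, `]0, 1[%classic (B w)}.
  apply: (@has_density_ae_in R _ _ P B (real_beta_pdf theta 1) `]0, 1[%classic) => //.
  by move=> x x01; rewrite /real_beta_pdf; case: ifP.
by apply: filterS h => w /=; rewrite in_itv.
Qed.

(** Projection onto [0, 1]: it changes M on a null set only and makes the
    bounds on powers of 1 + u M hold everywhere. *)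
Definition clamp (x : R) : R := Num.max 0 (Num.min x 1).

Lemma clamp01 x : 0 <= clamp x <= 1.
Proof. by rewrite /clamp le_max lexx/= ge_max ler01/= ge_min lexx orbT. Qed.

Lemma clamp_id x : 0 <= x <= 1 -> clamp x = x.
Proof. by move=> /andP[x0 x1]; rewrite /clamp min_l// max_r. Qed.

Lemma measurable_clamp : measurable_fun setT clamp.
Proof. by apply: measurable_maxr => //; exact: measurable_minr. Qed.

(** Let gap be the distance to [0, 1], a convex function that vanishes at V:
    the gap of B M + (1 - B) V is at most B times that of M.  Since M need not be
    integrable, this is tested with the bounded increasing function
    h(x) = 1 - e^{- gap x}.  The equation gives the mean of h(M) as at most that
    of g = 1 - e^{- B gap M} <= h(M), so g = h(M) almost surely, and B < 1 leaves
    gap M = 0. *)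
Lemma fixed_point_support d (T : measurableType d) (P : probability T R)
    dV (TV : measurableType dV) (PV : probability TV R) (V : {RV PV >-> R})
    (M : {RV P >-> R}) (theta : R) : (forall w, 0 <= V w <= 1) ->
  M_equation theta PV V P M -> {ae P, forall w, 0 <= M w <= 1}.
Proof.
move=> V01 [e [T' [P' [B [M' [V' [_ PB M'M V'V MB]]]]]]].
have mB : measurable_fun setT B by [].
have mM' : measurable_fun setT M' by [].
have mV' : measurable_fun setT V' by [].
have B01 := beta1_ae mB PB.
have V'01 : {ae P', forall w, 0 <= V' w <= 1}.
  have := @eq_law_ae_in R _ _ _ _ _ _ P' PV V' V `[0, 1]%classic mV' _ (measurable_itv _) V'V.
  move=> h; have {}h : {ae P', forall w, `[0, 1]%classic (V' w)}.
    by apply: h => //; apply: aeW => w /=; rewrite in_itv/=; exact: V01.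
  by apply: filterS h => w /=; rewrite in_itv.
pose gap (x : R) : R := Num.max 0 (Num.max (- x) (x - 1)).
have mgap : measurable_fun setT gap.
  apply: measurable_maxr => //; apply: measurable_maxr; first exact: measurable_funN.
  exact: measurable_funB.
have gap0 x : 0 <= gap x by rewrite le_max lexx.
have gap1 x : - x <= gap x by rewrite /gap !le_max lexx orbT.
have gap2 x : x - 1 <= gap x by rewrite /gap !le_max lexx !orbT.
have gap_le x c : 0 <= c -> - x <= c -> x - 1 <= c -> gap x <= c.
  by move=> c0 c1 c2; rewrite /gap !ge_max c0 c1 c2.
clearbody gap.
pose g w := 1 - expR (- (clamp (B w) * gap (M' w))).
pose k w := expR (- (clamp (B w) * gap (M' w))) - expR (- gap (M' w)).
pose h x := 1 - expR (- gap x).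
have gE w : g w = 1 - expR (- (clamp (B w) * gap (M' w))) by [].
have kE w : k w = expR (- (clamp (B w) * gap (M' w))) - expR (- gap (M' w)) by [].
have hdef x : h x = 1 - expR (- gap x) by [].
have h0 x : 0 <= h x by rewrite subr_ge0 expR_le1 oppr_le0.
have mcB : measurable_fun setT (fun w => clamp (B w) * gap (M' w)).
  by apply: measurable_funM; apply: measurableT_comp => //; exact: measurable_clamp.
have meN (f : T' -> R) : measurable_fun setT f -> measurable_fun setT (fun w => expR (- f w)).
  by move=> mf; apply: measurableT_comp => //; exact: measurable_funN.
have mg : measurable_fun setT g by apply: measurable_funB => //; exact: meN.
have mk : measurable_fun setT k.
  by apply: measurable_funB; apply: meN => //; exact: measurableT_comp.
have mh : measurable_fun setT h.
  by apply: measurable_funB => //; apply: measurableT_comp => //; exact: measurable_funN.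
have g0 w : 0 <= g w.
  by rewrite subr_ge0 expR_le1 oppr_le0 mulr_ge0//; case/andP: (clamp01 (B w)).
have k0 w : 0 <= k w.
  by rewrite subr_ge0 ler_expR lerN2 ler_piMl//; case/andP: (clamp01 (B w)).
clearbody g k h.
have E : (\int[P']_w (h (M' w))%:E = \int[P']_w (g w)%:E + \int[P']_w (k w)%:E)%E.
  rewrite -ge0_integralD//.
  - by apply: eq_integral => w _; rewrite -EFinD; congr EFin; rewrite hdef gE kE; ring.
  - by move=> w _; rewrite lee_fin.
  - exact/measurable_EFinP.
  - by move=> w _; rewrite lee_fin.
  - exact/measurable_EFinP.
have hE : (\int[P']_w (h (M' w))%:E =
    \int[P']_w (h (B w * M' w + (1 - B w) * V' w))%:E)%E.
  have mhE : measurable_fun setT (EFin \o h) by exact/measurable_EFinP.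
  have hE0 x : (0 <= (EFin \o h) x)%E by rewrite lee_fin.
  rewrite (@ge0_eq_law_integral _ _ _ _ _ _ _ _ _ _ _ (EFin \o h) mM' _ mhE hE0 M'M)//.
  apply: (@ge0_eq_law_integral _ _ _ _ _ _ _ _ _ _ _ (EFin \o h) _ _ mhE hE0 MB) => //.
  apply: measurable_funD; apply: measurable_funM => //; exact: measurable_funB.
have le : (\int[P']_w (h (M' w))%:E <= \int[P']_w (g w)%:E)%E.
  rewrite hE; apply: (@ae_ge0_le_integral _ _ _ P' setT measurableT (fun w => (h (B w * M' w + (1 - B w) * V' w))%:E) (fun w => (g w)%:E)).
  - by move=> w _; rewrite lee_fin.
  - apply/measurable_EFinP; apply: (measurableT_comp mh).
    apply: measurable_funD; apply: measurable_funM => //; exact: measurable_funB.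
  - by move=> w _; rewrite lee_fin.
  - exact/measurable_EFinP.
  - apply: filterS2 B01 V'01 => w /andP[b0 b1] /andP[v0 v1] _.
    rewrite lee_fin hdef gE (@clamp_id (B w)) ?(ltW b0) ?(ltW b1)//.
    rewrite lerD2l lerN2 ler_expR lerN2.
    have bM1 := ler_wpM2l (ltW b0) (gap1 (M' w)).
    have bM2 := ler_wpM2l (ltW b0) (gap2 (M' w)).
    have c0 : 0 <= 1 - B w by rewrite subr_ge0 ltW.
    have cv1 := mulr_ge0 c0 v0.
    have cv2 : (1 - B w) * V' w <= 1 - B w by rewrite ler_piMr.
    by apply: gap_le; [rewrite mulr_ge0// ltW|lra|lra].
have Ig : (\int[P']_w (g w)%:E)%E \is a fin_num.
  rewrite ge0_fin_numE; last by apply: integral_ge0 => w _; rewrite lee_fin.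
  apply: (@le_lt_trans _ _ (\int[P']_w (1 : R)%:E)%E); last first.
    by rewrite integral_probability_cst ltry.
  apply: ge0_le_integral => //.
  - by move=> w _; rewrite lee_fin.
  - exact/measurable_EFinP.
  - by move=> w _; rewrite gE lee_fin lerBlDr lerDl expR_ge0.
have Ik : (\int[P']_w `|(k w)%:E| = 0)%E.
  apply/eqP; rewrite eq_le; apply/andP; split; last by exact: integral_ge0.
  have -> : (\int[P']_w `|(k w)%:E| = \int[P']_w (k w)%:E)%E.
    by apply: eq_integral => w _; rewrite gee0_abs// lee_fin.
  by move: le; rewrite E -leeBrDl// subee.
have mkE : measurable_fun setT (EFin \o k) by exact/measurable_EFinP.
have [kae _] := @ae_eq_integral_abs _ _ _ P' setT measurableT (EFin \o k) mkE.
have {}kae : {ae P', forall w, k w = 0}.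
  by apply: filterS (kae Ik) => w /(_ I) /= [].
have M'01 : {ae P', forall w, `[0, 1]%classic (M' w)}.
  apply: filterS2 kae B01 => w + /andP[b0 b1].
  rewrite kE (@clamp_id (B w)) ?(ltW b0) ?(ltW b1)// => /eqP.
  rewrite subr_eq0 => /eqP/expR_inj/oppr_inj kw.
  have gap_0 : gap (M' w) = 0.
    have /eqP : (1 - B w) * gap (M' w) = 0 by rewrite mulrBl mul1r kw subrr.
    by rewrite mulf_eq0 subr_eq0 gt_eqF//= => /eqP.
  have := gap1 (M' w); have := gap2 (M' w).
  by rewrite /= in_itv/= gap_0; lra.
have := eq_law_ae_in _ _ (measurable_itv _) (eq_law_sym M'M) M'01.
move=> /(_ (@measurable_funPT _ _ _ _ M) mM').
by apply: filterS => w /=; rewrite in_itv.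
Qed.

End beta_fixed_point.

(** * The gamma decomposition *)

Section gamma_decomposition.
Context {R : realType}.

(** The factorisation behind the differential equation: for fixed m and v the
    mean over B is [beta_integral] with a = 1 + u m and c = 1 + u v, because
    1 + u (b m + (1 - b) v) = a b + c (1 - b). *)
Lemma fixed_point_mean_power d (T : measurableType d) (P : probability T R)
    dV (TV : measurableType dV) (PV : probability TV R) (V : {RV PV >-> R})
    (M : {RV P >-> R}) (theta : R) : 0 < theta -> (forall w, 0 <= V w <= 1) ->
  M_equation theta PV V P M -> forall u, 0 < u ->
  \int[P]_w (1 + u * clamp (M w)) `^ (- (theta + 1)) =
  (\int[P]_w (1 + u * clamp (M w)) `^ (- theta)) * \int[PV]_w (1 + u * V w)^-1.
Proof.
move=> t0 V01 eqM u u0.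
have M01 := fixed_point_support V01 eqM.
case: eqM => e [T' [P' [B [M' [V' [iBMV PB M'M V'V MB]]]]]].
have mB : measurable_fun setT B by [].
have mM' : measurable_fun setT M' by [].
have mV' : measurable_fun setT V' by [].
have B01 := beta1_ae mB PB.
have in01 d1 (T1 : measurableType d1) (P1 : probability T1 R) (X : T1 -> R)
    d2 (T2 : measurableType d2) (P2 : probability T2 R) (Y : T2 -> R) :
    measurable_fun setT X -> measurable_fun setT Y -> eq_law P1 X P2 Y ->
    {ae P2, forall w, 0 <= Y w <= 1} -> {ae P1, forall w, 0 <= X w <= 1}.
  move=> mX mY XY Y01.
  have := @eq_law_ae_in R _ _ _ _ _ _ P1 P2 X Y `[0, 1]%classic mX mY (measurable_itv _) XY.
  move=> h; have {}h : {ae P1, forall w, `[0, 1]%classic (X w)}.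
    by apply: h; apply: filterS Y01 => w; rewrite /= in_itv.
  by apply: filterS h => w /=; rewrite in_itv.
have V'01 : {ae P', forall w, 0 <= V' w <= 1}.
  by apply: (in01 _ _ _ _ _ _ _ V) V'V _ => //; apply: aeW => w; exact: V01.
have M'01 : {ae P', forall w, 0 <= M' w <= 1}.
  exact: (in01 _ _ _ _ _ _ _ M) M'M M01.
have [iMVB iMV] := indep3_pairs mB mM' mV' iBMV.
pose a (x : R) := 1 + u * clamp x.
have a1 x : 1 <= a x.
  by rewrite /a lerDl mulr_ge0 ?(ltW u0)//; case/andP: (clamp01 x).
have a0 x : 0 < a x by rewrite (lt_le_trans ltr01).
have ma : measurable_fun setT a.
  by apply: measurable_funD => //; apply: measurable_funM => //; exact: measurable_clamp.
have mpow p : measurable_fun setT (fun x => (a x `^ p)%:E).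
  apply/measurable_EFinP; exact: (measurableT_comp (@measurable_powR R p)).
have minv : measurable_fun setT (fun x => ((a x)^-1)%:E).
  apply/measurable_EFinP; exact: (measurableT_comp (@measurable_invr R)).
have pow0 p x : (0 <= (a x `^ p)%:E)%E by rewrite lee_fin powR_ge0.
have inv0 x : (0 <= ((a x)^-1)%:E)%E by rewrite lee_fin invr_ge0 ltW.
pose F (z : (R * R) * R) : \bar R :=
  ((a z.1.1 * z.2 + a z.1.2 * (1 - z.2)) `^ (- (theta + 1)))%:E.
have mF : measurable_fun setT F.
  apply/measurable_EFinP; apply: (measurableT_comp (@measurable_powR R _)).
  apply: measurable_funD; apply: measurable_funM => //.
  - by apply: (measurableT_comp ma); exact: (measurableT_comp measurable_fst).
  - by apply: (measurableT_comp ma); exact: (measurableT_comp measurable_snd).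
  - exact: measurable_funB.
have F0 z : (0 <= F z)%E by rewrite lee_fin powR_ge0.
have mrhs : measurable_fun setT (fun w => B w * M' w + (1 - B w) * V' w).
  by apply: measurable_funD; apply: measurable_funM => //; exact: measurable_funB.
have E : (\int[P]_w (a (M w) `^ (- (theta + 1)))%:E =
    (\int[P]_w (a (M w) `^ (- theta))%:E) * \int[PV]_w ((a (V w))^-1)%:E)%E.
  rewrite (@ge0_eq_law_integral _ _ _ _ _ _ _ _ _ _ _
    (fun x => (a x `^ (- (theta + 1)))%:E) _ mrhs (mpow _) (pow0 _) MB)//.
  transitivity (\int[P']_w F ((M' w, V' w), B w))%E.
    apply: ge0_ae_eq_integral => //.
    - exact: (measurableT_comp (mpow _)).
    - apply: (measurableT_comp mF); apply: measurable_fun_pair => //.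
      exact: measurable_fun_pair.
    - apply: filterS3 B01 M'01 V'01 => w /andP[b0 b1] m01 v01 _.
      rewrite /F/=; congr (_ `^ _)%:E; rewrite /a (clamp_id m01) (clamp_id v01) clamp_id; first by ring.
      case/andP: m01 => m0 m1; case/andP: v01 => v0 v1.
      have c0 : 0 <= 1 - B w by rewrite subr_ge0 ltW.
      rewrite addr_ge0 ?mulr_ge0 ?(ltW b0)//=.
      have : B w * M' w <= B w by rewrite ler_piMr// ltW.
      have : (1 - B w) * V' w <= 1 - B w by rewrite ler_piMr.
      by lra.
  rewrite (indep3_integral mB mM' mV' iMVB iMV mF F0).
  transitivity (\int[P']_w1 \int[P']_w2
      ((a (M' w1) `^ (- theta))%:E * ((a (V' w2))^-1)%:E))%E.
    apply: eq_integral => w1 _; apply: eq_integral => w2 _.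
    have mFB : measurable_fun setT (fun b => F ((M' w1, V' w2), b)).
      by apply: (measurableT_comp mF); exact: measurable_fun_pair.
    rewrite (has_density_integral mB PB mFB (fun b => F0 _)).
    rewrite -EFinM -(beta_integral t0 (a0 (M' w1)) (a0 (V' w2))).
    rewrite [RHS]integral_mkcond; apply: eq_integral => b _.
    rewrite (beta1_pdfE _ t0) patchE mem_setE in_itv/=.
    by case: ifP => _; rewrite ?mule0// -EFinM mulrC.
  have -> : (\int[P]_w (a (M w) `^ (- theta))%:E = \int[P']_w (a (M' w) `^ (- theta))%:E)%E.
    by apply: (@ge0_eq_law_integral _ _ _ _ _ _ _ _ _ _ _
      (fun x => (a x `^ (- theta))%:E)) => //; exact: eq_law_sym.
  have -> : (\int[PV]_w ((a (V w))^-1)%:E = \int[P']_w ((a (V' w))^-1)%:E)%E.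
    by apply: (@ge0_eq_law_integral _ _ _ _ _ _ _ _ _ _ _
      (fun x => ((a x)^-1)%:E)) => //; exact: eq_law_sym.
  have mM'p : measurable_fun setT (fun w => (a (M' w) `^ (- theta))%:E).
    exact: (measurableT_comp (mpow _)).
  have mV'i : measurable_fun setT (fun w => ((a (V' w))^-1)%:E).
    exact: (measurableT_comp minv).
  rewrite -ge0_integralZr//; last exact: integral_ge0.
  by apply: eq_integral => w1 _; rewrite ge0_integralZl.
rewrite /Rintegral -fineM.
- rewrite E; congr (fine (_ * _)%E).
  by apply: eq_integral => w _; rewrite /a clamp_id.
- apply: integral01_fin.
    apply: (measurableT_comp (@measurable_powR R _)); exact: (measurableT_comp ma).
  by move=> w; rewrite powR_ge0/= powRN_le1 ?(ltW t0)//; exact: a1.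
- apply: integral01_fin.
    apply: (measurableT_comp (@measurable_invr R)).
    by apply: measurable_funD => //; exact: measurable_funM.
  move=> w; have /andP[v0 _] := V01 w.
  have : 1 <= 1 + u * V w by rewrite lerDl mulr_ge0// ltW.
  by move=> h; rewrite invr_ge0 (le_trans ler01)//= invf_le1// (lt_le_trans ltr01).
Qed.

(** The Cifarelli-Regazzini (Markov-Krein) identity for Dirichlet means, obtained
    here from the distributional equation alone. *)
Lemma cifarelli_regazzini d (T : measurableType d) (P : probability T R)
    dV (TV : measurableType dV) (PV : probability TV R) (V : {RV PV >-> R})
    (M : {RV P >-> R}) (theta : R) : 0 < theta -> (forall w, 0 <= V w <= 1) ->
  M_equation theta PV V P M -> forall u, 0 <= u ->
  (\int[P]_w ((1 + u * clamp (M w)) `^ (- theta))%:E)%E =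
  (expR (- (theta * \int[PV]_w ln (1 + u * V w))))%:E.
Proof.
move=> t0 V01 eqM u u0.
rewrite -(@mean_power_ode _ _ _ P _ _ PV (fun w => clamp (M w)) V)//.
- rewrite /Rintegral fineK//.
  have p1 w : 1 <= 1 + u * clamp (M w).
    by rewrite lerDl mulr_ge0//; case/andP: (clamp01 (M w)).
  apply: integral01_fin => [|w]; last by rewrite powR_ge0/= powRN_le1// ltW.
  apply: (measurableT_comp (@measurable_powR R _)).
  apply: measurable_funD => //; apply: measurable_funM => //.
  exact: (measurableT_comp measurable_clamp).
- exact: (measurableT_comp measurable_clamp).
- by move=> w; exact: clamp01.
- exact: fixed_point_mean_power.
Qed.

(** Given M, the transform of G M at omega is that of G at omega M.  The factors
    (1 + omega)^{-theta} e^{theta K} of S and e^{- theta K} of G M multiply to the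
    transform of gamma_theta. *)
Lemma gamma_decomposition dV (TV : measurableType dV) (PV : probability TV R)
    (V : {RV PV >-> R}) (theta : R)
    dS (TS : measurableType dS) (PS : probability TS R) (Sigma : R -> TS -> R)
    d (T : measurableType d) (P : probability T R) (S G M : {RV P >-> R})
    dG (TG : measurableType dG) (PG : probability TG R) (gamma : {RV PG >-> R}) :
  (forall w, 0 <= V w <= 1) -> 0 < theta ->
  has_levy_density PS Sigma (rho_Sigma PV V) ->
  has_density PG gamma (gamma_pdf theta 1) ->
  indep3 P S G M -> eq_law P S PS (Sigma theta) -> eq_law P G PG gamma ->
  M_equation theta PV V P M ->
  eq_law PG gamma P (fun w => S w + G w * M w).
Proof.
move=> V01 t0 [subS _ LS] dgam iSGM SS GG eqM.
have mV : measurable_fun setT V by [].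
have mS : measurable_fun setT S by [].
have mG : measurable_fun setT G by [].
have mM : measurable_fun setT M by [].
have mgam : measurable_fun setT gamma by [].
have [mSig Sig0 Sigmon _ _] := subS.
have [iGMS iGM] := indep3_pairs mS mG mM iSGM.
have dG' : has_density P G (gamma_pdf theta 1).
  by case: dgam => m1 m2 m3; split => // A mA; rewrite GG// m3.
have pos d1 (T1 : measurableType d1) (P1 : probability T1 R) (X : T1 -> R) :
    measurable_fun setT X -> has_density P1 X (gamma_pdf theta 1) ->
    {ae P1, forall w, 0 <= X w}.
  move=> mX dX.
  have : {ae P1, forall w, `[0, +oo[%classic (X w)}.
    apply: (has_density_ae_in mX (measurable_itv _) _ dX) => x /=.
    rewrite in_itv/= andbT => /negP; rewrite -ltNge => x0.
    by rewrite /gamma_pdf ltNge (ltW x0).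
  by apply: filterS => w; rewrite /= in_itv/= andbT.
have S0 : {ae P, forall w, 0 <= S w}.
  have : {ae P, forall w, `[0, +oo[%classic (S w)}.
    apply: (eq_law_ae_in mS (mSig _ (ltW t0)) (measurable_itv _) SS).
    apply: filterS2 Sig0 Sigmon => w z0 [mon _]; rewrite /= in_itv/= andbT -z0.
    by apply: mon => //; exact: ltW.
  by apply: filterS => w; rewrite /= in_itv/= andbT.
have M01 := fixed_point_support V01 eqM.
have mcM : measurable_fun setT (fun w => clamp (M w)).
  exact: (measurableT_comp measurable_clamp).
apply: laplace_unique => //.
- by apply: measurable_funD => //; exact: measurable_funM.
- exact: pos.
- apply: filterS3 S0 (pos _ _ _ _ mG dG') M01 => w s0 g0 /andP[m0 _].
  by rewrite addr_ge0// mulr_ge0.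
move=> omega o0.
rewrite (gamma_laplace t0 ltr01 o0 mgam dgam) mulr1.
pose k (x : R) : \bar R := (expR (- (omega * x)))%:E.
have mk : measurable_fun setT k.
  exact: measurable_laplace_kernel.
have k0 x : (0 <= k x)%E by rewrite lee_fin expR_ge0.
pose q (z : R * R) : \bar R := k (z.1 * clamp z.2).
have mq : measurable_fun setT q.
  apply: (measurableT_comp mk); apply: measurable_funM => //.
  exact: (measurableT_comp measurable_clamp).
have q0 z : (0 <= q z)%E by exact: k0.
have mGM : measurable_fun setT (fun w => (G w, M w)) by exact: measurable_fun_pair.
transitivity (\int[P]_w (q (G w, M w) * k (S w)))%E; last first.
  apply: ge0_ae_eq_integral => //.
  - apply: emeasurable_funM; first exact: (measurableT_comp mq mGM).
    exact: (measurableT_comp mk).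
  - apply: (measurableT_comp mk); apply: measurable_funD => //; exact: measurable_funM.
  - by move=> w _; rewrite mule_ge0.
  - apply: filterS M01 => w m01 _; rewrite /q /k/= clamp_id// -EFinM -expRD.
    by congr (expR _)%:E; ring.
rewrite (indep2_integralM mGM mS mq mk q0 k0 iGMS).
have -> : (\int[P]_w k (S w) = \int[PS]_w k (Sigma theta w))%E.
  by apply: (ge0_eq_law_integral _ _ mk k0 SS) => //; exact: mSig (ltW t0).
rewrite [X in (_ * X)%E](LS _ _ (ltW t0) o0).
have -> : (\int[P]_w q (G w, M w) =
    \int[P]_w ((1 + omega * clamp (M w)) `^ (- theta))%:E)%E.
  pose q' (z : R * R) := q (z.2, z.1).
  have mq' : measurable_fun setT q'.
    by apply: (measurableT_comp mq); exact: measurable_fun_pair.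
  rewrite (indep2_integral mM mG mq' (fun z => q0 _) (indep2C iGM)).
  apply: eq_integral => w _.
  have c0 : 0 <= omega * clamp (M w) by rewrite mulr_ge0//; case/andP: (clamp01 (M w)).
  rewrite -[X in 1 + X]mulr1 -(gamma_laplace t0 ltr01 c0 mG dG').
  by apply: eq_integral => w' _; congr (expR _)%:E; rewrite /=; ring.
rewrite (cifarelli_regazzini t0 V01 eqM o0).
rewrite (laplace_exponent_rho_Sigma PV mV V01 o0).
have fK := integral_ln1p_fin PV mV V01 o0.
rewrite /Rintegral; move: fK; case: (\int[PV]_w _)%E => // r _.
transitivity (expR (- (theta * r)) * expR (- (theta * (ln (1 + omega) - r))))%:E => //.
rewrite -expRD /powR gt_eqF ?ltr_pwDl//; congr (expR _)%:E; ring.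
Qed.

End gamma_decomposition.

(** * Existence of a solution of the beta equation *)

(** The carrier is the copy of the line on which the Lebesgue measure lives. *)
Definition density_measure {R : realType} (f : R -> R)
    (mf : measurable_fun setT f) (f0 : forall x, 0 <= f x)
    (A : set (measurableTypeR R)) : \bar R :=
  (\int[lebesgue_measure]_(x in A) (f x)%:E)%E.

Section density_measure.
Context {R : realType} (f : R -> R).
Hypothesis mf : measurable_fun setT f.
Hypothesis f0 : forall x, 0 <= f x.

Let m_set0 : density_measure mf f0 set0 = 0%E.
Proof. exact: integral_set0. Qed.

Let m_ge0 A : (0 <= density_measure mf f0 A)%E.
Proof. by apply: integral_ge0 => x _; rewrite lee_fin. Qed.

Let m_sigma_additive : semi_sigma_additive (density_measure mf f0).
Proof.
move=> F mF tF mUF; rewrite /density_measure ge0_integral_bigcup//.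
- apply: is_cvg_ereal_nneg_natsum_cond => n _ _; exact: m_ge0.
- by apply/measurable_EFinP; exact: measurable_funTS.
- by move=> x _; rewrite lee_fin.
Qed.

HB.instance Definition _ := isMeasure.Build _ _ _ (density_measure mf f0)
  m_set0 m_ge0 m_sigma_additive.

End density_measure.

(** An alias of [density_measure] whose type records the total mass, so that a
    probability structure can be attached to it. *)
Definition density_prob {R : realType} (f : R -> R)
    (mf : measurable_fun setT f) (f0 : forall x, 0 <= f x)
    (f1 : (\int[lebesgue_measure]_x (f x)%:E = 1)%E) :=
  density_measure mf f0.

Section density_prob.
Context {R : realType} (f : R -> R).
Hypothesis mf : measurable_fun setT f.
Hypothesis f0 : forall x, 0 <= f x.
Hypothesis f1 : (\int[lebesgue_measure]_x (f x)%:E = 1)%E.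

HB.instance Definition _ := Measure.on (density_prob mf f0 f1).

Let m_setT : density_prob mf f0 f1 setT = 1%E.
Proof. exact: f1. Qed.

HB.instance Definition _ :=
  @Measure_isProbability.Build _ _ _ (density_prob mf f0 f1) m_setT.

End density_prob.

Lemma density_probability {R : realType} (f : R -> R) :
  measurable_fun setT f -> (forall x, 0 <= f x) ->
  (\int[lebesgue_measure]_x (f x)%:E = 1)%E ->
  exists P : probability (measurableTypeR R) R,
    forall A, measurable A -> P A = (\int[lebesgue_measure]_(x in A) (f x)%:E)%E.
Proof. by move=> mf f0 f1; exists (density_prob mf f0 f1). Qed.

(** Taking some of the three events trivial gives the subfamilies. *)
Lemma indep3_of_triple {d} {T : measurableType d} {R : realType}
    (P : probability T R) (X Y Z : T -> R) :
  (forall A B C, measurable A -> measurable B -> measurable C ->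
    P (X @^-1` A `&` (Y @^-1` B `&` Z @^-1` C)) =
    (P (X @^-1` A) * (P (Y @^-1` B) * P (Z @^-1` C)))%E) ->
  indep3 P X Y Z.
Proof.
move=> h s A us mA.
pose A' (i : 'I_3) := if i \in s then A i else setT.
have mA' i : measurable (A' i) by rewrite /A'; case: ifP.
have E i : P (tnth [tuple X; Y; Z] i @^-1` A' i) =
    if i \in s then P (tnth [tuple X; Y; Z] i @^-1` A i) else 1%E.
  by rewrite /A'; case: ifP => // _; rewrite preimage_setT probability_setT.
rewrite big_uniq//= big_mkcond/=; under eq_bigr do rewrite -E.
rewrite !big_ord_recl big_ord0 mule1.
have := h (A' ord0) (A' (lift ord0 ord0)) (A' (lift ord0 (lift ord0 ord0)))
  (mA' _) (mA' _) (mA' _).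
move=> <-; congr (P _); apply/seteqP; split=> w /=.
  move=> hw.
  have hw' i : A' i (tnth [tuple X; Y; Z] i w).
    by rewrite /A'; case: ifPn => // si; exact: hw.
  by split; [exact: (hw' ord0)|split; [exact: (hw' (lift ord0 ord0))|
    exact: (hw' (lift ord0 (lift ord0 ord0)))]].
move=> [h0 [h1 h2]] i /= si.
have : A' i (tnth [tuple X; Y; Z] i w).
  case: i {si} => -[|[|[|//]]] i3.
  - by rewrite (_ : Ordinal i3 = ord0)//; apply/val_inj.
  - by rewrite (_ : Ordinal i3 = lift ord0 ord0)//; apply/val_inj.
  - by rewrite (_ : Ordinal i3 = lift ord0 (lift ord0 ord0))//; apply/val_inj.
by rewrite /A' si.
Qed.

Section fixed_point_existence.
Context {R : realType} {dB dV} {TB : measurableType dB} {TV : measurableType dV}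
  (PB : probability TB R) (PV : probability TV R) (B : {RV PB >-> R})
  (V : {RV PV >-> R}).
Hypothesis B01 : forall w, 0 < B w < 1.
Hypothesis V01 : forall w, 0 <= V w <= 1.

Let W : probability (TB * TV)%type R := (PB \x PV)%E.

(** B m + (1 - B) V <= x if and only if m <= q x. *)
Let q (x : R) (z : TB * TV) : R := (x - (1 - B z.1) * V z.2) / B z.1.

Let mB1 : measurable_fun setT (fun z : TB * TV => B z.1).
Proof. exact: measurableT_comp. Qed.

Let mV2 : measurable_fun setT (fun z : TB * TV => V z.2).
Proof. exact: measurableT_comp. Qed.

Let mq x : measurable_fun setT (q x).
Proof.
apply: measurable_funM.
  by apply: measurable_funB => //; apply: measurable_funM => //; exact: measurable_funB.
exact: (measurableT_comp (@measurable_invr R)).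
Qed.

Let q_le x y z : x <= y -> q x z <= q y z.
Proof.
move=> xy; have /andP[b0 _] := B01 z.1.
by rewrite /q ler_pM2r ?invr_gt0// lerD2r.
Qed.

Let q_lt x y z : x < y -> q x z < q y z.
Proof.
move=> xy; have /andP[b0 _] := B01 z.1.
by rewrite /q ltr_pM2r ?invr_gt0// ltrD2r.
Qed.

Let q_lt0 x z : x < 0 -> q x z < 0.
Proof.
move=> x0; have /andP[b0 b1] := B01 z.1; have /andP[v0 _] := V01 z.2.
rewrite /q pmulr_llt0 ?invr_gt0// subr_lt0 (lt_le_trans x0)// mulr_ge0//.
by rewrite subr_ge0 ltW.
Qed.

Let q_ge1 x z : 1 <= x -> 1 <= q x z.
Proof.
move=> x1; have /andP[b0 b1] := B01 z.1; have /andP[v0 v1] := V01 z.2.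
rewrite /q ler_pdivlMr// mul1r.
have : (1 - B z.1) * V z.2 <= 1 - B z.1 by rewrite ler_piMr// subr_ge0 ltW.
by lra.
Qed.

(** Distribution functions of the probabilities on [0, 1]. *)
Definition unit_cdf (F : R -> R) :=
  [/\ {homo F : x y / x <= y}, (forall x, 0 <= F x <= 1),
      right_continuous F, (forall x, x < 0 -> F x = 0) &
      (forall x, 1 <= x -> F x = 1)].

(** The distribution function of B M + (1 - B) V when M has distribution
    function F. *)
Definition mix_cdf (F : R -> R) (x : R) : R := \int[W]_z F (q x z).

Let mF (F : R -> R) : {homo F : x y / x <= y} -> measurable_fun setT F.
Proof. by move=> ndF; exact: nondecreasing_measurable. Qed.

Let mFq (F : R -> R) x : {homo F : x y / x <= y} -> measurable_fun setT (fun z => F (q x z)).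
Proof. by move=> ndF; exact: (measurableT_comp (mF ndF)). Qed.

Let iFq (F : R -> R) x : {homo F : x y / x <= y} -> (forall x, 0 <= F x <= 1) ->
  W.-integrable setT (EFin \o (fun z => F (q x z))).
Proof.
by move=> ndF F01; apply: integrable01 => [|z]; [exact: mFq|exact: F01].
Qed.

Let bounded_cvg (f_ : nat -> TB * TV -> R) (f : TB * TV -> R) :
  (forall n, measurable_fun setT (f_ n)) -> measurable_fun setT f ->
  (forall n z, 0 <= f_ n z <= 1) -> (forall z, 0 <= f z <= 1) ->
  (forall z, f_ n z @[n --> \oo] --> f z) ->
  \int[W]_z f_ n z @[n --> \oo] --> \int[W]_z f z.
Proof.
move=> mf_ mf f_01 f01 ff.
apply: fine_cvg; rewrite /Rintegral fineK ?integral01_fin//.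
apply: (@dominated_cvg _ _ _ _ _ measurableT _ _ (fun=> 1%E)) => //.
- by move=> n; exact/measurable_EFinP.
- by move=> z _; apply/cvg_EFin => //; [exact: nearW|exact: ff].
- have h : W.-integrable setT (EFin \o (fun=> 1 : R)).
    by apply: integrable01 => // z; rewrite ler01 lexx.
  exact: h.
- by move=> n z _; rewrite /= lee_fin; have /andP[? ?] := f_01 n z; rewrite ger0_norm.
Qed.

Lemma mix_cdf_le F G : unit_cdf F -> unit_cdf G -> (forall x, F x <= G x) ->
  forall x, mix_cdf F x <= mix_cdf G x.
Proof.
move=> [ndF F01 _ _ _] [ndG G01 _ _ _] FG x.
by apply: le_Rintegral => //; exact: iFq.
Qed.

Lemma unit_cdf_mix F : unit_cdf F -> unit_cdf (mix_cdf F).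
Proof.
move=> [ndF F01 rcF F0 F1]; split.
- by move=> x y xy; apply: le_Rintegral => // [||z _]; [exact: iFq|exact: iFq|exact/ndF/q_le].
- move=> x; apply/andP; split.
    by apply: Rintegral_ge0 => z _; case/andP: (F01 (q x z)).
  rewrite -[leRHS](Rintegral_cst_prob W); apply: le_Rintegral => //.
  + exact: iFq.
  + by apply: (@integrable01 _ _ _ _ (fun=> 1)) => // z; rewrite ler01 lexx.
  + by move=> z _; case/andP: (F01 (q x z)).
- move=> x; apply/cvg_at_rightP => u [xu ux].
  apply: bounded_cvg => //; [by move=> n; exact: mFq|exact: mFq|] => z.
  have /cvg_at_rightP := rcF (q x z); apply; split=> [n|]; first exact: q_lt.
  apply: cvgM; last exact: cvg_cst.
  by apply: cvgB => //; exact: cvg_cst.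
- move=> x x0; rewrite /mix_cdf; under eq_Rintegral do rewrite F0 ?q_lt0//.
  exact: Rintegral_cst_prob.
- move=> x x1; rewrite /mix_cdf; under eq_Rintegral do rewrite F1 ?q_ge1//.
  exact: Rintegral_cst_prob.
Qed.

(** Iteration from the point mass at 0, whose distribution function is the
    largest one; monotonicity of [mix_cdf] makes the sequence decrease. *)
Let F_ n : R -> R := iter n mix_cdf (fun x => (0 <= x)%R%:R).

Let F_cdf n : unit_cdf (F_ n).
Proof.
elim: n => [|n IH]; last exact: unit_cdf_mix.
split=> /=.
- move=> x y xy; case: (leP 0 x) => // x0; first by rewrite (le_trans x0 xy).
- by move=> x; case: (0 <= x); rewrite /= ?lexx ?ler01.
- move=> x; have [x0|x0] := leP 0 x.
    apply: cvg_near_cst; near=> y.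
    have xy : x <= y by near: y; exact: nbhs_right_ge.
    by rewrite (le_trans x0 xy).
  apply: cvg_near_cst; near=> y.
  have y0 : y < 0 by near: y; exact: nbhs_right_lt.
  by rewrite (leNgt 0 y) y0.
- by move=> x x0; rewrite (leNgt 0 x) x0.
- by move=> x x1; rewrite (le_trans ler01 x1).
Unshelve. all: by end_near. Qed.

Let F_ni n x : F_ n.+1 x <= F_ n x.
Proof.
elim: n x => [|n IH] x; last exact: (mix_cdf_le (F_cdf n.+1) (F_cdf n)).
have [_ F01 _ F0 _] := F_cdf 1; rewrite [leRHS]/=.
by have [x0|x0] := leP 0 x; [case/andP: (F01 x)|rewrite F0].
Qed.

Let F_nonincr x : {homo F_ ^~ x : n m / (n <= m)%N >-> m <= n}.
Proof. by apply/nonincreasing_seqP => n; exact: F_ni. Qed.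

Let F_cvg x : cvgn (F_ ^~ x).
Proof.
apply: nonincreasing_is_cvgn; first exact: F_nonincr.
by exists 0 => _ [n _ <-]; have [_ F01 _ _ _] := F_cdf n; case/andP: (F01 x).
Qed.

Let Finf x := limn (F_ ^~ x).

Let Finf_le n x : Finf x <= F_ n x.
Proof. exact: (nonincreasing_cvgn_ge (@F_nonincr x) (@F_cvg x)). Qed.

(** Right-continuity survives because Finf is an infimum of right-continuous
    nondecreasing functions. *)
Let Finf_cdf : unit_cdf Finf.
Proof.
have nd : {homo Finf : x y / x <= y}.
  move=> x y xy; apply: ler_lim; [exact: F_cvg|exact: F_cvg|].
  by apply: nearW => n; have [ndF _ _ _ _] := F_cdf n; exact: ndF.
have F0 x : 0 <= Finf x.
  apply: limr_ge; first exact: F_cvg.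
  by apply: nearW => n; have [_ F01 _ _ _] := F_cdf n; case/andP: (F01 x).
split=> //.
- move=> x; rewrite F0/=; apply: (le_trans (Finf_le 0 x)).
  by have [_ F01 _ _ _] := F_cdf 0; case/andP: (F01 x).
- move=> x; apply/cvgrPdist_lt => e e0.
  have [n Fn] : exists n, F_ n x < Finf x + e / 2.
    have /cvgrPdist_lt/(_ (e / 2)) := @F_cvg x.
    move=> /(_ ltac:(by rewrite divr_gt0)) [n _ /(_ n (leqnn _))] h; exists n.
    by move: h; rewrite ltr_distlC => /andP[_].
  have [_ _ rc _ _] := F_cdf n.
  have /cvgrPdist_lt/(_ (e / 2)) := rc x => /(_ ltac:(by rewrite divr_gt0)) rcx.
  near=> y.
  have xy : x <= y by near: y; exact: nbhs_right_ge.
  rewrite distrC ger0_norm ?subr_ge0 ?nd//.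
  have : `|F_ n x - F_ n y| < e / 2 by near: y.
  rewrite ltr_distlC => /andP[_ h].
  have := Finf_le n y; lra.
- move=> x x0; apply/eqP; rewrite eq_le F0 andbT (le_trans (Finf_le 0 x))//=.
  by rewrite (leNgt 0 x) x0.
- move=> x x1; rewrite /Finf (_ : F_ ^~ x = fun=> 1) ?lim_cst//.
  by apply/funext => n; have [_ _ _ _ ->] := F_cdf n.
Unshelve. all: by end_near. Qed.

(** Both sides are the limit of F_(n+1) x, the left one by dominated
    convergence. *)
Let mix_Finf x : mix_cdf Finf x = Finf x.
Proof.
have [nd F01 _ _ _] := Finf_cdf.
have h1 : F_ n.+1 x @[n --> \oo] --> mix_cdf Finf x.
  apply: bounded_cvg => //; [|exact: mFq|].
  - by move=> n; apply: mFq; have [] := F_cdf n.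
  - by move=> n z; have [_ h _ _ _] := F_cdf n.
have h2 : F_ n.+1 x @[n --> \oo] --> Finf x.
  by rewrite (cvg_shiftS (F_ ^~ x)); exact: F_cvg.
exact: (cvg_unique _ h1 h2).
Qed.

(** The limit is a distribution function, hence that of a Lebesgue-Stieltjes
    probability. *)
Lemma mix_fixed_point : exists Q : probability (measurableTypeR R) R,
  forall x, Q `]-oo, x]%classic = (\int[W]_z Q `]-oo, q x z]%classic)%E.
Proof.
have [nd F01 rc F0 F1] := Finf_cdf.
have Ny0 : Finf x @[x --> -oo] --> (0 : R).
  apply: cvg_near_cst; near=> x.
  have x0 : x < 0 by near: x; exact: nbhs_ninfty_lt.
  exact: F0.
have y1 : Finf x @[x --> +oo] --> (1 : R).
  apply: cvg_near_cst; near=> x.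
  have x1 : 1 <= x by near: x; exact: nbhs_pinfty_ge.
  exact: F1.
pose F : cumulativeBounded (0 : R) (1 : R) := HB.pack Finf
  (isCumulative.Build _ _ _ Finf nd rc)
  (isCumulativeBounded.Build _ _ _ Finf Ny0 y1).
pose Q : probability (measurableTypeR R) R := lebesgue_stieltjes_measure F.
have QE x : Q `]-oo, x]%classic = (Finf x)%:E.
  have := cdf_lebesgue_stieltjes_id F x.
  by rewrite /= /cdf /distribution /pushforward preimage_id.
exists Q => x; rewrite QE -[in LHS]mix_Finf /mix_cdf /Rintegral fineK.
  by apply: eq_integral => z _; rewrite QE.
by apply: integrable_fin_num => //; exact: iFq.
Unshelve. all: by end_near. Qed.

End fixed_point_existence.

Section fixed_point_law.
Context {R : realType}.

(** The identity on the line with the beta law would do almost surely; the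
    values outside ]0, 1[ are replaced by 1/2 so that q is defined
    everywhere. *)
Lemma beta1_variable (theta : R) : 0 < theta ->
  exists (P : probability (measurableTypeR R) R) (B : {RV P >-> R}),
    (forall w, 0 < B w < 1) /\ has_density P B (real_beta_pdf theta 1).
Proof.
move=> t0; pose f : R -> R := real_beta_pdf theta 1.
have fE x : f x = if 0 < x < 1 then theta * x `^ (theta - 1) else 0 by exact: beta1_pdfE.
have mI : measurable_fun setT (fun x : R => 0 < x < 1).
  apply: (measurable_fun_bool true).
  rewrite (_ : _ `&` _ = `]0, 1[%classic); first exact: measurable_itv.
  by apply/seteqP; split => x /=; rewrite in_itv/=; [case|].
have mf : measurable_fun setT f.
  rewrite (_ : f = fun x => if 0 < x < 1 then theta * x `^ (theta - 1) else 0).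
    by apply: measurable_fun_ifT => //; exact: measurable_funM.
  by apply/funext => x; rewrite fE.
have f0 x : 0 <= f x.
  by rewrite fE; case: ifP => // _; rewrite mulr_ge0 ?powR_ge0// ltW.
have f1 : (\int[lebesgue_measure]_x (f x)%:E = 1)%E.
  have := beta_integral t0 ltr01 ltr01; rewrite powR1 divr1 => <-.
  rewrite [RHS]integral_mkcond; apply: eq_integral => x _.
  rewrite patchE mem_setE in_itv/= fE; case: ifP => // _.
  by rewrite !mul1r subrKC powR1 mulr1.
have [P PE] := density_probability mf f0 f1.
pose b (x : measurableTypeR R) : R := if 0 < x < 1 then x else 2^-1.
have mb : measurable_fun setT b by apply: measurable_fun_ifT.
pose B : {RV P >-> R} := mfun_of mb.
exists P, B; split=> [x|].
  by rewrite /B /= /b; case: ifP => // _; lra.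
split=> // A mA.
have mBA : measurable (b @^-1` A) by have := mb measurableT A mA; rewrite setTI.
rewrite [LHS](PE _ mBA) integral_mkcond [RHS]integral_mkcond.
apply: eq_integral => x _; rewrite !patchE; have := fE x.
case: ifPn => x01 fx; first rewrite (_ : (x \in b @^-1` A) = (x \in A))//.
  by apply/idP/idP; rewrite !inE /= /b x01.
by rewrite -/(f x) fx; do 2 case: ifP.
Qed.

(** On the product space the event B M' + (1 - B) V' <= x has the section
    M' <= q x at fixed (B, V'), so its probability is the right-hand side of
    [mix_fixed_point]. *)
Lemma M_equation_solution dV (TV : measurableType dV) (PV : probability TV R)
    (V : {RV PV >-> R}) (theta : R) : 0 < theta -> (forall w, 0 <= V w <= 1) ->
  exists (d : measure_display) (T : measurableType d)
    (P : probability T R) (M : {RV P >-> R}), M_equation theta PV V P M.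
Proof.
move=> t0 V01.
have [PB [B [B01 dB]]] := beta1_variable t0.
have [Q QE] := mix_fixed_point B01 V01.
pose W : probability (measurableTypeR R * TV)%type R := (PB \x PV)%E.
pose P' : probability ((measurableTypeR R * TV) * measurableTypeR R)%type R := (W \x Q)%E.
have mid : measurable_fun setT (idfun : measurableTypeR R -> R).
  exact: measurable_id.
pose M : {RV Q >-> R} := mfun_of mid.
have mB' : measurable_fun setT
    (fun z : (measurableTypeR R * TV) * measurableTypeR R => B z.1.1).
  by apply: measurableT_comp => //; exact: measurableT_comp.
have mV' : measurable_fun setT
    (fun z : (measurableTypeR R * TV) * measurableTypeR R => V z.1.2).
  by apply: measurableT_comp => //; exact: measurableT_comp.
have mM' : measurable_fun setT
    (fun z : (measurableTypeR R * TV) * measurableTypeR R => (z.2 : R)).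
  exact: measurable_snd.
pose B' : {RV P' >-> R} := mfun_of mB'.
pose M' : {RV P' >-> R} := mfun_of mM'.
pose V' : {RV P' >-> R} := mfun_of mV'.
have mpre d1 (T1 : measurableType d1) (X : T1 -> R) A : measurable_fun setT X ->
    measurable A -> measurable (X @^-1` A).
  by move=> mX mA; rewrite -[_ @^-1` _]setTI; exact: mX.
have tripleE A C D : measurable A -> measurable C -> measurable D ->
    P' (B' @^-1` A `&` (M' @^-1` C `&` V' @^-1` D)) =
    (PB (B @^-1` A) * (Q (M @^-1` C) * PV (V @^-1` D)))%E.
  move=> mA mC mD.
  have -> : B' @^-1` A `&` (M' @^-1` C `&` V' @^-1` D) =
      ((B @^-1` A) `*` (V @^-1` D)) `*` (M @^-1` C).
    by apply/seteqP; split=> -[[b v] m] /=; tauto.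
  transitivity (W ((B @^-1` A) `*` (V @^-1` D)) * Q (M @^-1` C))%E.
    by apply: product_measure1E; [apply: measurableX; exact: mpre|exact: mpre].
  rewrite (_ : W _ = PB (B @^-1` A) * PV (V @^-1` D))%E.
    by rewrite -muleA [(PV _ * _)%E]muleC.
  by apply: product_measure1E; exact: mpre.
have PB' A : measurable A -> P' (B' @^-1` A) = PB (B @^-1` A).
  move=> mA; have := tripleE A setT setT mA measurableT measurableT.
  by rewrite !preimage_setT !setIT !probability_setT !mule1.
have PM' A : measurable A -> P' (M' @^-1` A) = Q (M @^-1` A).
  move=> mA; have := tripleE setT A setT measurableT mA measurableT.
  by rewrite !preimage_setT setTI setIT !probability_setT mul1e mule1.
have PV' A : measurable A -> P' (V' @^-1` A) = PV (V @^-1` A).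
  move=> mA; have := tripleE setT setT A measurableT measurableT mA.
  by rewrite !preimage_setT !setTI !probability_setT !mul1e.
exists _, (measurableTypeR R), Q, M, _, _, P', B', M', V'; split=> //.
- apply: indep3_of_triple => A C D mA mC mD.
  by rewrite tripleE// PB'// PM'// PV'.
- by case: dB => m1 m2 m3; split => // A mA; rewrite PB'// m3.
have mrhs : measurable_fun setT (fun w => B' w * M' w + (1 - B' w) * V' w).
  by apply: measurable_funD; apply: measurable_funM => //; exact: measurable_funB.
apply: eq_law_tail => // c.
have mray : measurable (`]-oo, c]%classic : set R) by exact: measurable_itv.
suff E : Q (M @^-1` `]-oo, c]) =
    P' ((fun w => B' w * M' w + (1 - B' w) * V' w) @^-1` `]-oo, c]).
  have mE1 := mpre _ _ _ _ mid mray; have mE2 := mpre _ _ _ _ mrhs mray.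
  by rewrite -setCitvl !preimage_setC !probability_setC// E.
rewrite [LHS]QE; apply: eq_integral => z _; congr (Q _).
have /andP[b0 _] := B01 z.1.
have mE (m : R) : (m <= (c - (1 - B z.1) * V z.2) / B z.1) =
    (B z.1 * m + (1 - B z.1) * V z.2 <= c).
  by rewrite ler_pdivlMr// lerBrDr mulrC.
apply/seteqP; split=> m; rewrite /xsection /= in_itv/=.
  by rewrite mE => h; apply/mem_set; rewrite /= in_itv.
by move=> /set_mem; rewrite /= in_itv/= mE.
Qed.

End fixed_point_law.

(** * Random sums *)

Section discrete_variables.
Context {d} {T : measurableType d} {R : realType} {U : countType} (Y : T -> U).
Hypothesis mY : forall c, measurable (Y @^-1` [set c]).

Let level_measurable (D : set U) k :
  measurable (Y @^-1` (D `&` [set c | pickle c = k])).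
Proof.
have [[c [Dc ck]]|nc] := pselect (exists c, D c /\ pickle c = k).
  rewrite (_ : _ `&` _ = [set c])//; apply/seteqP; split=> [c' [_ /= c'k]|_ ->]//.
  by apply: (pcan_inj pickleK); rewrite /= c'k ck.
rewrite (_ : _ `&` _ = set0) ?preimage_set0//; apply/seteqP; split=> // c /= [Dc ck].
by apply: nc; exists c.
Qed.

Lemma discrete_preimage (D : set U) : measurable (Y @^-1` D).
Proof.
rewrite (_ : D = \bigcup_k (D `&` [set c | pickle c = k])).
  by rewrite preimage_bigcup; apply: bigcupT_measurable => k; exact: level_measurable.
by apply/seteqP; split=> [c Dc|c [k _ []]//]; exists (pickle c).
Qed.

Lemma discrete_measurable d' (V : measurableType d') (g : U -> V) :
  measurable_fun setT (g \o Y).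
Proof.
by move=> _ A mA; rewrite setTI comp_preimage; exact: discrete_preimage.
Qed.

(** Total probability over the countably many values of Y. *)
Lemma discrete_integral (P : probability T R) (F : T -> \bar R) (g : U -> \bar R) :
  measurable_fun setT F -> (forall w, 0 <= F w)%E -> (forall c, 0 <= g c)%E ->
  (forall c, \int[P]_(w in Y @^-1` [set c]) F w = g c * P (Y @^-1` [set c]))%E ->
  (\int[P]_w F w = \int[P]_w g (Y w))%E.
Proof.
move=> mF F0 g0 H.
pose E k := Y @^-1` [set c | pickle c = k].
have mE k : measurable (E k) by exact: discrete_preimage.
have tE : trivIset setT E.
  apply/trivIsetP => i j _ _ ij; rewrite -subset0 => w [/= wi wj].
  by move: ij; rewrite -wi -wj eqxx.
have UE : \bigcup_k E k = setT by apply/seteqP; split=> // w _; exists (pickle (Y w)).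
rewrite -UE ge0_integral_bigcup//; last by rewrite UE.
rewrite [RHS]ge0_integral_bigcup//; last by rewrite UE; exact: discrete_measurable.
apply: eq_eseriesr => k _.
have [[c ck]|nc] := pselect (exists c : U, pickle c = k).
  have -> : E k = Y @^-1` [set c].
    rewrite /E; congr (_ @^-1` _); apply/seteqP; split=> [c' /= c'k|_ -> //].
    by apply: (pcan_inj pickleK); rewrite /= c'k ck.
  rewrite H -integral_cst//; apply: eq_integral => w.
  by rewrite inE /= => ->.
have -> : E k = set0 by rewrite -subset0 => w /= wk; apply: nc; exists (Y w).
by rewrite !integral_set0.
Qed.

End discrete_variables.

(** A finite set of indices is contained in an initial segment; the events at
    the other indices are taken trivial. *)
Lemma mutual_indep_of_upto {d d'} {T : measurableType d} {U : measurableType d'}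
    {R : realType} (P : probability T R) (X : nat -> T -> U) :
  (forall m, indep_upto P m X) -> mutual_indep P X.
Proof.
move=> iX s A us mA.
pose m := (\max_(i <- s) i).+1.
have sm i : i \in s -> (i < m)%N by move=> si; rewrite ltnS; exact: leq_bigmax_seq.
pose A' i := if i \in s then A i else setT.
have mA' i : measurable (A' i) by rewrite /A'; case: ifP.
have := iX m A' mA'.
have -> : [set w | forall i, (i < m)%N -> A' i (X i w)] =
    \bigcap_(i in [set` s]) X i @^-1` A i.
  apply/seteqP; split=> w /= h i.
    by move=> /= si; have := h i (sm i si); rewrite /A' si.
  by move=> _; rewrite /A'; case: ifPn => // si; exact: h.
move=> ->; transitivity (\prod_(i <- iota 0 m | i \in s) P (X i @^-1` A i))%E.
  rewrite -[iota 0 m]/(index_iota 0 m) [RHS]big_mkcond/= big_mkord.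
  apply: eq_bigr => i _; rewrite /A'; case: ifP => // _.
  by rewrite preimage_setT probability_setT.
rewrite -big_filter; apply: perm_big; apply: uniq_perm => //.
  by rewrite filter_uniq// iota_uniq.
move=> i; rewrite mem_filter mem_iota/= add0n.
by case si: (i \in s) => //=; exact: sm.
Qed.

Section partial_sums.
Context {d} {T : measurableType d} {R : realType} (P : probability T R)
  (D : nat -> T -> R).
Hypothesis mD : forall k, measurable_fun setT (D k).
Hypothesis iD : forall n, indep_upto P n D.
Hypothesis eD : forall k, eq_law P (D k) P (D 0%N).

Definition partial_sum (n : nat) (w : T) : R := \sum_(k < n) D k w.

Lemma measurable_partial_sum n : measurable_fun setT (partial_sum n).
Proof. by apply: measurable_sum => k; exact: mD. Qed.

(** [partial_sum] as a function of a finite tuple of jumps, since independence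
    is only available between finite tuples. *)
Definition seq_sum (s : seq R) (n : nat) : R := \sum_(k < n) nth 0 s k.

Lemma measurable_seq_sum K n : measurable_fun setT (fun t : K.-tuple R => seq_sum t n).
Proof.
apply: measurable_sum => k; have [kK|Kk] := ltnP k K.
  rewrite (_ : (fun _ => _) = @tnth K R ^~ (Ordinal kK)); first exact: measurable_tnth.
  by apply/funext => t; rewrite (tnth_nth 0).
rewrite (_ : (fun _ => _) = fun=> 0)//.
by apply/funext => t; rewrite nth_default// size_tuple.
Qed.

Lemma seq_sumE a K n w : (n <= K)%N ->
  seq_sum [tuple D (a + i)%N w | i < K] n = \sum_(k < n) D (a + k)%N w.
Proof.
move=> nK; apply: eq_bigr => k _; have kK := leq_trans (ltn_ord k) nK.
by rewrite -(tnth_nth 0 _ (Ordinal kK)) tnth_mktuple.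
Qed.

Lemma partial_sumB a b w : (a <= b)%N ->
  partial_sum b w - partial_sum a w = \sum_(k < b - a) D (a + k)%N w.
Proof.
move=> ab; rewrite /partial_sum -(subnKC ab) big_split_ord/= addrAC subrr add0r.
by rewrite addKn.
Qed.

Lemma block_sum_law a n : eq_law P (fun w => \sum_(k < n) D (a + k)%N w) P (partial_sum n).
Proof.
have iDa : indep_upto P n (fun i => D (a + i)%N) by apply: indep_upto_shift; exact: iD.
have E := eq_law_mktuple (fun i _ => mD _) (fun i _ => mD i) iDa (iD n)
  (fun i _ => eq_law_trans (eD (a + i)%N) (eq_law_sym (eD i))).
have := eq_law_comp (measurable_seq_sum (K := n) n) E.
rewrite (_ : _ \o _ = fun w => \sum_(k < n) D (a + k)%N w); last first.
  by apply/funext => w; exact: seq_sumE.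
rewrite (_ : _ \o _ = partial_sum n)//.
by apply/funext => w; have := seq_sumE 0 w (leqnn n); rewrite /=; apply.
Qed.

Definition block_event m (c : nat -> nat) (A : nat -> set R) K : set (K.-tuple R) :=
  [set t | forall i, (i < m)%N -> A i (seq_sum t (c i.+1) - seq_sum t (c i))].
Arguments block_event : clear implicits.

Lemma measurable_block_event m c A K : (forall i, measurable (A i)) ->
  measurable (block_event m c A K).
Proof.
move=> mA; rewrite (_ : block_event m c A K = \bigcap_(i in `I_m)
    (fun t : K.-tuple R => seq_sum t (c i.+1) - seq_sum t (c i)) @^-1` (A i)); last first.
  by apply/seteqP; split.
apply: fin_bigcap_measurable => // i _; rewrite -[_ @^-1` _]setTI.
have mf : measurable_fun setT
    (fun t : K.-tuple R => seq_sum t (c i.+1) - seq_sum t (c i)).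
  by apply: measurable_funB; exact: measurable_seq_sum.
exact: mf.
Qed.

Lemma block_eventE m c A K w : (forall i, (i <= m)%N -> (c i <= K)%N) ->
  block_event m c A K [tuple D i w | i < K] <->
  (forall i, (i < m)%N -> A i (partial_sum (c i.+1) w - partial_sum (c i) w)).
Proof.
move=> cK.
have E n : (n <= K)%N -> seq_sum [tuple D i w | i < K] n = partial_sum n w.
  by move=> nK; exact: (seq_sumE 0).
by split=> h i im; have := h i im; rewrite !E// ?cK// ltnW.
Qed.

(** The sums over disjoint blocks of independent terms are independent, and each
    depends in law only on the length of its block. *)
Lemma partial_sum_blocks m (c : nat -> nat) (A : nat -> set R) :
  (forall i, (c i <= c i.+1)%N) -> (forall i, measurable (A i)) ->
  P [set w | forall i, (i < m)%N -> A i (partial_sum (c i.+1) w - partial_sum (c i) w)] =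
  (\prod_(i < m) P (partial_sum (c i.+1 - c i) @^-1` A i))%E.
Proof.
move=> cc mA; elim: m => [|m IH].
  rewrite big_ord0 (_ : [set _ | _] = setT) ?probability_setT//.
  by apply/seteqP; split.
have cm i : (i <= m)%N -> (c i <= c m)%N by exact: (homo_leq leqnn leq_trans cc).
rewrite big_ord_recr/= -IH.
have ig := indep_upto_group (fun i _ => mD i) (iD (c m + (c m.+1 - c m))).
have mS : measurable ((fun t : (c m.+1 - c m).-tuple R =>
    seq_sum t (c m.+1 - c m)) @^-1` A m).
  have := @measurable_seq_sum (c m.+1 - c m) (c m.+1 - c m) measurableT (A m) (mA m).
  by rewrite setTI.
have := ig _ _ (@measurable_block_event m c A (c m) mA) mS.
set E1 := _ `&` _ => H.
transitivity (P E1).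
  congr (P _); apply/seteqP; split=> w /=.
    move=> h; split.
      by apply/block_eventE => // i im; apply: h; exact: ltnW.
    change (A m (seq_sum [tuple D (c m + i)%N w | i < c m.+1 - c m] (c m.+1 - c m))).
    by rewrite seq_sumE// -partial_sumB//; exact: h.
  move=> [/block_eventE h1 h2].
  have {}h2 : A m (seq_sum [tuple D (c m + i)%N w | i < c m.+1 - c m] (c m.+1 - c m)).
    exact: h2.
  move=> i; rewrite ltnS leq_eqVlt => /predU1P[->|im].
    by move: h2; rewrite seq_sumE// -partial_sumB.
  exact: h1.
rewrite H; congr (_ * _)%E.
  congr (P _); apply/seteqP; split=> w /=; first by move/block_eventE; exact.
  by move=> h; apply/block_eventE.
rewrite -(@block_sum_law (c m) (c m.+1 - c m) (A m) (mA m)); congr (P _); apply/funext => w /=.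
change (A m (seq_sum [tuple D (c m + i)%N w | i < c m.+1 - c m] (c m.+1 - c m)) =
  A m (\sum_(k < c m.+1 - c m) D (c m + k)%N w)).
by rewrite seq_sumE.
Qed.

End partial_sums.

(** * Increments and transform of a random sum *)

Section compound_process.
Context {d} {T : measurableType d} {R : realType} (P : probability T R)
  (N : R -> T -> nat) (D : nat -> T -> R).
Hypothesis hN : poisson_process P N.
Hypothesis mD : forall k, measurable_fun setT (D k).
Hypothesis iD : forall n, indep_upto P n D.
Hypothesis eD : forall k, eq_law P (D k) P (D 0%N).
Hypothesis iND : indep_process_seq P N D.

Let S := partial_sum D.

Let mN t : 0 <= t -> measurable_fun setT (N t).
Proof. by have [mN _ _] := hN; exact: mN. Qed.

Let mN1 t c : 0 <= t -> measurable (N t @^-1` [set c]).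
Proof. by move=> t0; rewrite -[_ @^-1` _]setTI; exact: mN. Qed.

Let mNr u : 0 <= u -> measurable_fun setT (fun w => (N u w)%:R : R).
Proof.
move=> u0; apply: (discrete_measurable (Y := N u) _ (fun n => n%:R : R)) => c.
exact: mN1.
Qed.

Lemma measurable_random_sum t : 0 <= t ->
  measurable_fun setT (fun w => S (N t w) w).
Proof.
move=> t0 _ A mA; rewrite setTI.
rewrite (_ : _ @^-1` A = \bigcup_n (N t @^-1` [set n] `&` S n @^-1` A)).
  apply: bigcupT_measurable => n; apply: measurableI; first exact: mN1.
  by rewrite -[_ @^-1` _]setTI; exact: measurable_partial_sum.
by apply/seteqP; split=> [w /= h|w [n _ [/= -> //]]]; exists (N t w).
Qed.

Lemma count_nondecreasing t : (forall i, 0 <= t i) -> (forall i, t i <= t i.+1) ->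
  {ae P, forall w i, (N (t i) w <= N (t i.+1) w)%N}.
Proof.
move=> t0 tS; have [_ [_ _ Nmon _ _] _] := hN.
by apply: filterS Nmon => w [h _] i; rewrite -(ler_nat R); exact: h.
Qed.

Let sum_law j (A : set R) := P (S j @^-1` A).

(** Fix the values c of the counts at the times t: on this event the increments
    are block sums, which are independent of the counts.  Values c that are not
    nondecreasing have probability 0. *)
Lemma random_sum_increments m (t : nat -> R) (A : nat -> set R) :
  (forall i, 0 <= t i) -> (forall i, t i <= t i.+1) ->
  (forall i, measurable (A i)) ->
  (P [set w | forall i, (i < m)%N ->
        A i (S (N (t i.+1) w) w - S (N (t i) w) w)%R] =
   \int[P]_w \prod_(i < m) sum_law (N (t i.+1) w - N (t i) w) (A i))%E.
Proof.
move=> t0 tS mA.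
set F := [set w | _].
have mF : measurable F.
  rewrite (_ : F = \bigcap_(i in `I_m)
    (fun w => S (N (t i.+1) w) w - S (N (t i) w) w) @^-1` A i); last first.
    by apply/seteqP; split.
  apply: fin_bigcap_measurable => // i _; rewrite -[_ @^-1` _]setTI.
  have mf : measurable_fun setT (fun w => S (N (t i.+1) w) w - S (N (t i) w) w).
    by apply: measurable_funB; exact: measurable_random_sum.
  exact: mf.
pose tt := [tuple t i | i < m.+1].
pose Y w := [tuple N (tnth tt i) w | i < m.+1].
have Yn w i : (i <= m)%N -> nth 0%N (Y w) i = N (t i) w.
  rewrite -ltnS => im; rewrite -(tnth_nth 0%N _ (Ordinal im)) tnth_mktuple.
  by rewrite tnth_mktuple.
pose box_c (c : m.+1.-tuple nat) : set (m.+1.-tuple nat) :=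
  [set u : m.+1.-tuple nat | forall i : 'I_m.+1, [set nth 0%N c i] (tnth u i)].
have boxE c : box_c c = [set c].
  apply/seteqP; split=> [u /= h|_ -> i /=]; last by rewrite (tnth_nth 0%N).
  by apply: eq_from_tnth => i; rewrite (h i) (tnth_nth 0%N).
have mbox c : measurable (box_c c).
  by apply: measurable_box; exists (fun i => [set nth 0%N c i]).
have mY c : measurable (Y @^-1` [set c]).
  rewrite -boxE -[_ @^-1` _]setTI.
  have mYf : measurable_fun setT Y.
    apply/measurable_fun_tnthP => i.
    rewrite (_ : _ \o _ = N (t i)); first exact: mN.
    by apply/funext => w /=; rewrite !tnth_mktuple.
  exact: mYf.
pose g (c : m.+1.-tuple nat) : \bar R :=
  (\prod_(i < m) sum_law (nth 0%N c i.+1 - nth 0%N c i) (A i))%E.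
transitivity (\int[P]_w g (Y w))%E; last first.
  by apply: eq_integral => w _; apply: eq_bigr => i _; rewrite !Yn// ltnW.
rewrite -[F]setIT -integral_indic//; apply: (discrete_integral mY).
- exact/measurable_EFinP/measurable_indic.
- by move=> w; rewrite lee_fin.
- by move=> c; apply: prode_ge0 => i _; exact: measure_ge0.
move=> c; rewrite integral_indic//.
pose c' i := nth 0%N c (minn i m).
have [cc|ncc] := pselect (forall i, (c' i <= c' i.+1)%N); last first.
  have PY0 : P (Y @^-1` [set c]) = 0%E.
    have [E [mE PE0 sub]] := count_nondecreasing t0 tS.
    apply/eqP; rewrite eq_le measure_ge0 andbT -[leRHS]PE0.
    apply: le_measure; rewrite ?inE// => w /= Yc; apply: sub => /= h.
    apply: ncc => i; rewrite /c' -Yc; have [im|mi] := ltnP i m.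
      have -> : minn i.+1 m = i.+1 by exact/minn_idPl.
      by rewrite !Yn// ltnW.
    by have -> : minn i.+1 m = m by apply/minn_idPr; exact: leqW.
  rewrite PY0 mule0; apply/eqP; rewrite eq_le measure_ge0 andbT -PY0.
  by apply: le_measure; rewrite ?inE//; exact: measurableI.
have c'E i : (i <= m)%N -> c' i = nth 0%N c i by move=> /minn_idPl im; rewrite /c' im.
have c'm i : (i <= m)%N -> (c' i <= c' m)%N by exact: (homo_leq leqnn leq_trans cc).
have mev := @measurable_block_event R m c' A (c' m) mA.
transitivity (P (Y @^-1` box_c c `&`
    (fun w => [tuple D k w | k < c' m]) @^-1` @block_event R m c' A (c' m))).
  rewrite boxE setIC; congr (P _); apply/seteqP; split=> w /= [Yc h]; split => //.
    apply/(block_eventE D) => // i im.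
    by have := h i im; rewrite -!Yn ?(ltnW im)// Yc !c'E// ltnW.
  move=> i im; have := (block_eventE D A w c'm).1 h i im.
  by rewrite -!Yn ?(ltnW im)// Yc !c'E// ltnW.
have tt0 i : 0 <= tnth tt i by rewrite tnth_mktuple.
have ind := @iND _ (c' m) tt tt0 _ _ (mbox c) mev.
rewrite ind boxE muleC; congr (_ * _)%E.
transitivity (P [set w | forall i, (i < m)%N -> A i (S (c' i.+1) w - S (c' i) w)%R]).
  congr (P _); apply/seteqP; split=> w /=; first by move/(block_eventE D A w c'm).
  by move/(block_eventE D A w c'm).
rewrite (partial_sum_blocks mD iD eD m cc mA).
by apply: eq_bigr => i _; rewrite !c'E// ltnW.
Qed.


(** The increments of the count as real variables, in which form their
    independence is known; truncation recovers the integers. *)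
Let jump (t : nat -> R) i (w : T) : R := (N (t i.+1) w)%:R - (N (t i) w)%:R.

Let truncB (m n : nat) : Num.trunc (m%:R - n%:R : R) = (m - n)%N.
Proof.
have [nm|mn] := leqP n m.
  by apply: truncn_def; rewrite -natrB// lexx ltr_nat ltnSn.
rewrite (eqP (ltnW mn : (m - n == 0)%N)).
apply/truncn0Pn; rewrite -ltNge (@le_lt_trans _ _ 0)//.
by rewrite subr_le0 ler_nat ltnW.
Qed.

Let measurable_trunc c : measurable ((Num.trunc : R -> nat) @^-1` [set c]).
Proof.
case: c => [|c].
  rewrite (_ : _ @^-1` _ = `]-oo, 1[%classic)//.
  by apply/seteqP; split=> x /=; rewrite in_itv/= ltNge => /truncn0Pn.
rewrite (_ : _ @^-1` _ = `[c.+1%:R, c.+2%:R[%classic)//.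
apply/seteqP; split=> x /=; rewrite in_itv/= -truncn_gt_nat -truncn_le_nat.
  by move=> ->; rewrite !leqnn.
by move=> /andP[h1 h2]; apply/eqP; rewrite eqn_leq h1 h2.
Qed.

(** The probability that a block of x jumps has its sum in A. *)
Let jump_law (A : set R) (x : R) : \bar R := sum_law (Num.trunc x) A.

Let measurable_jump_law A : measurable_fun setT (jump_law A).
Proof. exact: (discrete_measurable measurable_trunc (fun j => sum_law j A)). Qed.

Let jump_law_ge0 A x : (0 <= jump_law A x)%E.
Proof. exact: measure_ge0. Qed.

Let measurable_jump t i : (forall i, 0 <= t i) -> measurable_fun setT (jump t i).
Proof.
by move=> t0; apply: measurable_funB; exact: mNr.
Qed.

Let increments_jump m (t : nat -> R) (A : nat -> set R) :
  (forall i, 0 <= t i) -> (forall i, t i <= t i.+1) ->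
  (forall i, measurable (A i)) ->
  (P [set w | forall i, (i < m)%N ->
        A i (S (N (t i.+1) w) w - S (N (t i) w) w)%R] =
   \int[P]_w \prod_(i < m) jump_law (A i) (jump t i w))%E.
Proof.
move=> t0 tS mA; rewrite random_sum_increments//; apply: eq_integral => w _.
by apply: eq_bigr => i _; rewrite /jump_law truncB.
Qed.

Let increment_jump (a b : R) (A : set R) : 0 <= a -> a <= b -> measurable A ->
  (P ((fun w => S (N b w) w - S (N a w) w)%R @^-1` A) =
   \int[P]_w jump_law A ((N b w)%:R - (N a w)%:R)%R)%E.
Proof.
move=> a0 ab mA; pose t (i : nat) := if i is 0%N then a else b.
have t0 i : 0 <= t i by case: i => //= i; exact: le_trans ab.
have tS i : t i <= t i.+1 by case: i.
have := increments_jump 1 t0 tS (fun=> mA).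
under eq_integral do rewrite big_ord_recl big_ord0 mule1/=.
move=> <-; congr (P _); apply/seteqP; split=> w /=; first by move=> h -[|//].
by move=> /(_ 0%N erefl).
Qed.

(** By [random_sum_increments] the joint law of the increments is a mean of a
    product of functions of the independent increments of the count. *)
Lemma random_sum_indep (t : nat -> R) :
  (forall i, 0 <= t i) -> (forall i, t i <= t i.+1) ->
  mutual_indep P (fun (i : nat) w => S (N (t i.+1) w) w - S (N (t i) w) w).
Proof.
move=> t0 tS; apply: mutual_indep_of_upto => m A mA.
have [_ [_ _ _ indN _] _] := hN.
have ij := mutual_indep_upto 0 m (indN t (t0 0%N) tS).
rewrite increments_jump//.
rewrite (@indep_upto_integral_prod _ _ _ _ _ _ m (jump t) (fun i => jump_law (A i)))//.
- by apply: eq_bigr => i _; rewrite increment_jump.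
- by move=> i _; exact: measurable_jump.
Qed.

(** The law of an increment is the image of that of the increment of the count
    under one and the same kernel. *)
Lemma random_sum_stationary (s t : R) : 0 <= s -> 0 <= t ->
  eq_law P (fun w => S (N (s + t) w) w - S (N s w) w) P (fun w => S (N t w) w).
Proof.
move=> s0 t0 A mA.
have [_ [_ N0 _ _ statN] _] := hN.
have N00 : {ae P, forall w, N 0 w = 0%N}.
  by apply: filterS N0 => w /eqP; rewrite pnatr_eq0 => /eqP.
have E1 : eq_law P (fun w => S (N t w) w) P (fun w => S (N t w) w - S (N 0 w) w).
  apply: eq_law_ae; first exact: measurable_random_sum.
    by apply: measurable_funB; exact: measurable_random_sum.
  by apply: filterS N00 => w ->; rewrite /S /partial_sum big_ord0 subr0.
rewrite (E1 _ mA) !increment_jump ?addr_ge0 ?lerDl//.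
rewrite (@ge0_eq_law_integral _ _ _ _ _ _ _ _ _ _ _ (jump_law A) _ (@mNr _ t0)
  (measurable_jump_law A) (jump_law_ge0 A) (statN s t s0 t0))//.
  apply: (@ge0_eq_law_integral _ _ _ _ _ _ _ _ _ _ _ (jump_law A)) => //.
  - exact: mNr.
  - by apply: measurable_funB; exact: mNr.
  - apply: eq_law_ae; first exact: mNr.
      by apply: measurable_funB; exact: mNr.
    by apply: filterS N00 => w ->; rewrite subr0.
by apply: measurable_funB; apply: mNr => //; exact: addr_ge0.
Qed.

Lemma partial_sum_laplace (omega : R) n :
  (\int[P]_w (expR (- (omega * S n w)))%:E =
   \prod_(i < n) \int[P]_w (expR (- (omega * D 0%N w)))%:E)%E.
Proof.
pose h (x : R) : \bar R := (expR (- (omega * x)))%:E.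
have mh : measurable_fun setT h.
  exact: measurable_laplace_kernel.
have h0 x : (0 <= h x)%E by rewrite lee_fin expR_ge0.
transitivity (\int[P]_w \prod_(i < n) h (D i w))%E.
  apply: eq_integral => w _; rewrite /h prodEFin; congr EFin.
  by rewrite mulr_sumr -sumrN expR_sum.
rewrite (@indep_upto_integral_prod _ _ _ _ _ _ n D (fun=> h))//.
by apply: eq_bigr => i _; apply: (ge0_eq_law_integral (mD _) (mD 0%N) mh h0 (eD i)).
Qed.

(** The exponential series, summed over the values of the count. *)
Lemma poisson_generating (t phi : R) : 0 < t -> 0 <= phi ->
  (\int[P]_w (phi ^+ N t w)%:E = (expR (- (t * (1 - phi))))%:E)%E.
Proof.
move=> t0 p0; have [_ _ pois] := hN.
have t0' := ltW t0.
have UE : \bigcup_k (N t @^-1` [set k]) = setT.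
  by apply/seteqP; split=> // w _; exists (N t w).
have mp : measurable_fun setT (fun w => (phi ^+ N t w)%:E).
  apply: (discrete_measurable (Y := N t) _ (fun n => (phi ^+ n)%:E)) => c.
  exact: mN1.
have mE k : measurable (N t @^-1` [set k]) by exact: mN1.
have tE : trivIset setT (fun k => N t @^-1` [set k]).
  apply/trivIsetP => i j _ _ ij; rewrite -subset0 => w [/= wi wj].
  by move: ij; rewrite -wi -wj eqxx.
have g0 w : (\bigcup_k (N t @^-1` [set k])) w -> (0 <= (phi ^+ N t w)%:E)%E.
  by move=> _; rewrite lee_fin exprn_ge0.
rewrite -[X in (\int[P]_(_ in X) _)%E]UE.
rewrite (ge0_integral_bigcup P mE (measurable_funTS mp) g0 tE).
pose a k := expR (- t) * exp_coeff (phi * t) k.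
have aE k : (\int[P]_(w in N t @^-1` [set k]) (phi ^+ N t w)%:E = (a k)%:E)%E.
  transitivity (\int[P]_(w in N t @^-1` [set k]) (phi ^+ k)%:E)%E.
    by apply: eq_integral => w; rewrite inE /= => ->.
  rewrite integral_cst//.
  rewrite [X in (_ * X)%E](pois t k t0) -EFinM; congr EFin.
  by rewrite /poisson_pmf t0 /a /exp_coeff/= exprMn; ring.
under eq_eseriesr do rewrite aE.
apply/cvg_lim => //.
rewrite (_ : (fun n => _) = (fun n => (expR (- t) * series (exp_coeff (phi * t)) n)%:E)).
  apply/cvg_EFin; first exact: nearW.
  have -> : - (t * (1 - phi)) = - t + phi * t by ring.
  rewrite expRD; apply: cvgM; first exact: cvg_cst.
  exact: is_cvg_series_exp_coeff.
by apply/funext => n; rewrite sumEFin /series/= mulr_sumr.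
Qed.

Lemma random_sum_laplace (t omega phi : R) : 0 < t ->
  (\int[P]_w (expR (- (omega * D 0%N w)))%:E = phi%:E)%E ->
  (\int[P]_w (expR (- (omega * S (N t w) w)))%:E =
   (expR (- (t * (1 - phi))))%:E)%E.
Proof.
move=> t0 phiE; have t0' := ltW t0.
have p0 : 0 <= phi by rewrite -lee_fin -phiE; apply: integral_ge0 => w _; rewrite lee_fin expR_ge0.
rewrite -poisson_generating//.
have gE n : (\int[P]_w (expR (- (omega * S n w)))%:E = (phi ^+ n)%:E)%E.
  by rewrite partial_sum_laplace phiE prodEFin prodr_const card_ord.
pose k (x : R) : \bar R := (expR (- (omega * x)))%:E.
have mk : measurable_fun setT k.
  exact: measurable_laplace_kernel.
have k0 x : (0 <= k x)%E by rewrite lee_fin expR_ge0.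
apply: (discrete_integral (Y := N t) _ (g := fun n => (phi ^+ n)%:E)).
- by move=> c; exact: mN1.
- exact: (measurableT_comp mk (measurable_random_sum t0')).
- by move=> w; exact: k0.
- by move=> c; rewrite lee_fin exprn_ge0.
move=> c; rewrite -gE integral_set_indic.
pose tt := [tuple t | i < 1].
pose X w := [tuple N (tnth tt i) w | i < 1].
pose Z w := [tuple D i w | i < c].
have ind : indep2 P X Z by apply: iND => i; rewrite tnth_mktuple.
have XE w : tnth (X w) ord0 = N t w by rewrite !tnth_mktuple.
have ZE w : seq_sum (Z w) c = S c w by exact: (seq_sumE D 0).
pose f (u : 1.-tuple nat) : \bar R := (\1_[set c] (tnth u ord0))%:E.
pose h (v : c.-tuple R) : \bar R := k (seq_sum v c).
have mf : measurable_fun setT f.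
  have m1 : measurable_fun setT (\1_[set c] : nat -> R) by exact: measurable_indic.
  apply/measurable_EFinP; exact: (measurableT_comp m1 (measurable_tnth _)).
have mh : measurable_fun setT h by exact: (measurableT_comp mk (measurable_seq_sum _)).
have mX : measurable_fun setT X.
  apply/measurable_fun_tnthP => i.
  rewrite (_ : _ \o _ = N t); first exact: mN.
  by apply/funext => w /=; rewrite !tnth_mktuple.
have mZ : measurable_fun setT Z by exact: measurable_mktuple.
have f0 u : (0 <= f u)%E by rewrite lee_fin.
have h0 v : (0 <= h v)%E by exact: k0.
transitivity (\int[P]_w (f (X w) * h (Z w)))%E.
  apply: eq_integral => w _; rewrite /f /h XE ZE muleC !indicE.
  have -> : (w \in N t @^-1` [set c]) = (N t w == c).
    by apply/idP/eqP => [/set_mem//|Nc]; exact/mem_set.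
  have -> : (N t w \in [set c]) = (N t w == c).
    by apply/idP/eqP => [/set_mem//|Nc]; exact/mem_set.
  by have [->|_] := eqVneq (N t w) c; rewrite ?mul0e.
rewrite (indep2_integralM mX mZ mf mh f0 h0 ind) muleC; congr (_ * _)%E.
  by apply: eq_integral => w _; rewrite /h ZE.
under eq_integral do rewrite /f XE.
rewrite -[X in _ = P X]setIT -integral_indic//; last exact: mN1.
Qed.

End compound_process.

(** * Finite-dimensional laws *)

Section finite_dimensional_laws.
Context {R : realType}.

Lemma subordinator_ge0 d (T : measurableType d) (P : probability T R)
    (Z : R -> T -> R) (t : R) : subordinator P Z -> 0 <= t ->
  {ae P, forall w, 0 <= Z t w}.
Proof.
move=> [_ Z0 Zmon _ _] t0; apply: filterS2 Z0 Zmon => w z0 [mon _].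
by rewrite -z0; exact: mon.
Qed.

(** Sort the times with 0 in front.  The increments between consecutive times
    are independent with laws given by stationarity, so they have the same joint
    law for both processes; the values at the given times are partial sums of
    these increments. *)
Lemma subordinators_eq_fdd d1 (T1 : measurableType d1) (P1 : probability T1 R)
    (Z1 : R -> T1 -> R) d2 (T2 : measurableType d2) (P2 : probability T2 R)
    (Z2 : R -> T2 -> R) : subordinator P1 Z1 -> subordinator P2 Z2 ->
  (forall t, 0 <= t -> eq_law P1 (Z1 t) P2 (Z2 t)) -> eq_fdd P1 Z1 P2 Z2.
Proof.
move=> sub1 sub2 eq12 n t ht.
pose s := sort <=%R (0 :: t : seq R).
have ss : size s = n.+1 by rewrite size_sort /= size_tuple.
have mems x : (x \in s) = (x \in 0 :: t) by rewrite mem_sort.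
pose tau i := nth 0 s (minn i n).
have tauE i : (i <= n)%N -> tau i = nth 0 s i by move=> /minn_idPl im; rewrite /tau im.
have s0 i : (i <= n)%N -> 0 <= nth 0 s i.
  move=> im; have : nth 0 s i \in s by rewrite mem_nth// ss.
  by rewrite mems inE => /predU1P[->//|/tnthP[j ->]]; exact: ht.
have tau0 i : 0 <= tau i by apply: s0; exact: geq_minr.
have tauS i : tau i <= tau i.+1.
  apply: le_sorted_leq_nth; rewrite ?inE ?ss ?ltnS ?geq_minr//.
    by apply: sort_sorted; exact: le_total.
  by rewrite leq_min geq_minr andbT (leq_trans (geq_minl _ _)).
have tau_first : tau 0%N = 0.
  apply/eqP; rewrite eq_le tau0 andbT.
  have zs : 0 \in s by rewrite mems inE eqxx.
  have : nth 0 s (index 0 s) = 0 by rewrite nth_index.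
  have : (index (0 : R)%R s <= n)%N by rewrite -ltnS -ss index_mem.
  by move=> jn; rewrite -tauE// => e0; rewrite -[leRHS]e0; apply: (homo_leq lexx le_trans tauS).
pose J (i : 'I_n) := index (tnth t i) s.
have ts i : tnth t i \in s by rewrite mems inE mem_tnth orbT.
have Jn i : (J i <= n)%N by rewrite -ltnS -ss index_mem.
have tauJ i : tau (J i) = tnth t i by rewrite tauE// nth_index.
pose Psi (u : n.-tuple R) : n.-tuple R := [tuple seq_sum u (J i) | i < n].
have mPsi : measurable_fun setT Psi.
  apply/measurable_fun_tnthP => i.
  rewrite (_ : _ \o _ = fun u : n.-tuple R => seq_sum u (J i)).
    exact: measurable_seq_sum.
  by apply/funext => u /=; rewrite tnth_mktuple.
have values d (T : measurableType d) (P : probability T R) (Z : R -> T -> R) :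
    subordinator P Z ->
    eq_law P (fun w => [tuple Z (tnth t i) w | i < n])
      P (Psi \o (fun w => [tuple Z (tau i.+1) w - Z (tau i) w | i < n])).
  move=> [mZ Z0 _ _ _]; apply: eq_law_ae.
  - apply/measurable_fun_tnthP => i; rewrite (_ : _ \o _ = Z (tnth t i)); first exact: mZ.
    by apply/funext => w /=; rewrite tnth_mktuple.
  - apply: measurableT_comp => //.
    apply: (@measurable_mktuple _ _ _ _ n (fun i w => Z (tau i.+1) w - Z (tau i) w)).
    by move=> i _; apply: measurable_funB; exact: mZ.
  - apply: filterS Z0 => w z0; apply: eq_from_tnth => i; rewrite !tnth_mktuple.
    have := @seq_sumE _ _ _ (fun i w => Z (tau i.+1) w - Z (tau i) w) 0 n (J i) w (Jn i).
    move=> ->; rewrite -(big_mkord xpredT (fun k => Z (tau k.+1) w - Z (tau k) w)).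
    by rewrite telescope_sumr// tauJ tau_first z0 subr0.
apply: (eq_law_trans (values _ _ _ _ sub1)).
apply: (eq_law_trans _ (eq_law_sym (values _ _ _ _ sub2))).
apply: eq_law_comp => //.
have [mZ1 _ _ ind1 st1] := sub1; have [mZ2 _ _ ind2 st2] := sub2.
apply: (@eq_law_mktuple _ _ _ _ _ _ _ _ _ n (fun i w => Z1 (tau i.+1) w - Z1 (tau i) w)
  (fun i w => Z2 (tau i.+1) w - Z2 (tau i) w)).
- by move=> i _; apply: measurable_funB; exact: mZ1.
- by move=> i _; apply: measurable_funB; exact: mZ2.
- exact: (mutual_indep_upto 0 n (ind1 tau (tau0 0%N) tauS)).
- exact: (mutual_indep_upto 0 n (ind2 tau (tau0 0%N) tauS)).
- move=> i _.
  have d0 : 0 <= tau i.+1 - tau i by rewrite subr_ge0.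
  have := st1 (tau i) (tau i.+1 - tau i) (tau0 i) d0; rewrite subrKC => e1.
  have := st2 (tau i) (tau i.+1 - tau i) (tau0 i) d0; rewrite subrKC => e2.
  exact: (eq_law_trans e1 (eq_law_trans (eq12 _ d0) (eq_law_sym e2))).
Qed.

Lemma levy_density_eq_fdd d1 (T1 : measurableType d1) (P1 : probability T1 R)
    (Z1 : R -> T1 -> R) d2 (T2 : measurableType d2) (P2 : probability T2 R)
    (Z2 : R -> T2 -> R) (rho : R -> \bar R) :
  has_levy_density P1 Z1 rho -> has_levy_density P2 Z2 rho -> eq_fdd P1 Z1 P2 Z2.
Proof.
move=> [sub1 _ L1] [sub2 _ L2]; apply: subordinators_eq_fdd => // t t0.
have [mZ1 _ _ _ _] := sub1; have [mZ2 _ _ _ _] := sub2.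
apply: laplace_unique; [exact: mZ1|exact: mZ2|exact: subordinator_ge0|
  exact: subordinator_ge0|].
by move=> omega o0; rewrite L1// L2.
Qed.

End finite_dimensional_laws.

(** * The compound Poisson representation *)

Section compound_poisson.
Context {R : realType} {dV} {TV : measurableType dV} (PV : probability TV R)
  (V : {RV PV >-> R}) (varrho : R).
Hypothesis V01 : forall w, 0 <= V w <= 1.
Hypothesis r0 : 0 < varrho.
Hypothesis rE : (varrho%:E = \int[PV]_w (- lne (V w)%:E))%E.

Let mV : measurable_fun setT V. Proof. by []. Qed.

Definition jump_density (s : R) : R :=
  if 0 < s then fine (rho_Sigma PV V s) / varrho else 0.

Let f := jump_density.

Lemma jump_density_ge0 s : 0 <= f s.
Proof.
rewrite /f /jump_density; case: ifP => // s0.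
by rewrite divr_ge0 ?(ltW r0)// fine_ge0// rho_Sigma_ge0.
Qed.

Lemma rho_Sigma_jump_density s : 0 < s -> rho_Sigma PV V s = (varrho * f s)%:E.
Proof.
move=> s0; rewrite /f /jump_density s0 mulrC divfK ?gt_eqF//.
by rewrite fineK// rho_Sigma_fin.
Qed.

Lemma measurable_jump_density : measurable_fun setT f.
Proof.
rewrite (_ : f = (fun s => fine (rho_Sigma PV V s) / varrho) \_ `]0, +oo[%classic); last first.
  by apply/funext => s; rewrite patchE mem_setE in_itv/= andbT.
have h : measurable_fun (`]0, +oo[%classic : set R)
    (fun s => fine (rho_Sigma PV V s) / varrho).
  apply: measurable_funM => //; apply: (measurableT_comp (@fine_measurable R setT measurableT)) => //.
  exact: measurable_rho_Sigma.
exact: ((measurable_restrictT _ (measurable_itv _)).1 h).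
Qed.

Let density_integral (g : R -> \bar R) :
  (\int[lebesgue_measure]_x (g x * (f x)%:E) =
   \int[lebesgue_measure]_(x in `]0%R, +oo[) (g x * (f x)%:E))%E.
Proof.
rewrite [RHS]integral_mkcond; apply: eq_integral => x _.
rewrite patchE mem_setE in_itv/= andbT /f /jump_density.
by case: ifP => //; rewrite mule0.
Qed.

Lemma jump_density_integral : (\int[lebesgue_measure]_x (f x)%:E = 1)%E.
Proof.
have := integral_rho_Sigma mV V01 rE.
have -> : (\int[lebesgue_measure]_x (f x)%:E =
    \int[lebesgue_measure]_(x in `]0%R, +oo[) (f x)%:E)%E.
  by have := density_integral (fun=> 1%E); under eq_integral do rewrite mul1e;
    move=> ->; under eq_integral do rewrite mul1e.
have -> : (\int[lebesgue_measure]_(x in `]0%R, +oo[) rho_Sigma PV V x =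
    varrho%:E * \int[lebesgue_measure]_(x in `]0%R, +oo[) (f x)%:E)%E.
  rewrite -ge0_integralZl//.
  - by apply: eq_integral => x; rewrite inE/= in_itv/= andbT => x0; rewrite rho_Sigma_jump_density.
  - by apply/measurable_EFinP; apply: measurable_funTS; exact: measurable_jump_density.
  - by move=> x _; rewrite lee_fin jump_density_ge0.
  - by rewrite lee_fin ltW.
case: (\int[_]_(_ in _) _)%E => [x| |].
- by rewrite -EFinM => -[h]; congr EFin; apply: (mulfI (lt0r_neq0 r0)); rewrite h mulr1.
- by rewrite gt0_muley ?lte_fin.
- by rewrite gt0_muleNy ?lte_fin.
Qed.

Lemma jump_variable : exists (P : probability (measurableTypeR R) R)
  (X : {RV P >-> R}), has_density P X f.
Proof.
have [P PE] := density_probability measurable_jump_density jump_density_ge0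
  jump_density_integral.
have mid : measurable_fun setT (idfun : measurableTypeR R -> R) by exact: measurable_id.
exists P, (mfun_of mid); split; [exact: measurable_jump_density|exact: jump_density_ge0|].
by move=> A mA; rewrite -PE.
Qed.

(** Since e^{- omega s} and 1 - e^{- omega s} add up to 1, the exponent of rho is
    varrho times 1 - phi. *)
Lemma laplace_jump d (T : measurableType d) (P : probability T R) (X : {RV P >-> R})
    (omega : R) : 0 <= omega -> has_density P X f ->
  exists phi : R, (\int[P]_w (expR (- (omega * X w)))%:E = phi%:E)%E /\
    (\int[lebesgue_measure]_(s in `]0%R, +oo[)
       ((1 - expR (- (omega * s)))%:E * rho_Sigma PV V s) =
     (varrho * (1 - phi))%:E)%E.
Proof.
move=> o0 dX.
have mX : measurable_fun setT X by [].
have mf := measurable_jump_density; have f0 := jump_density_ge0.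
pose k (x : R) : \bar R := (expR (- (omega * x)))%:E.
have mk : measurable_fun setT k.
  exact: measurable_laplace_kernel.
have k0 x : (0 <= k x)%E by rewrite lee_fin expR_ge0.
have E1 : (\int[P]_w (expR (- (omega * X w)))%:E =
    \int[lebesgue_measure]_(x in `]0%R, +oo[) (k x * (f x)%:E))%E.
  by rewrite -density_integral -(has_density_integral mX dX mk k0).
pose g (x : R) : \bar R := (1 - expR (- (omega * x)))%:E.
have mg : measurable_fun setT g.
  apply/measurable_EFinP; apply: measurable_funB => //.
  exact/measurable_EFinP.
have g0 x : 0 < x -> (0 <= g x)%E.
  by move=> x0; rewrite lee_fin subr_ge0 expR_le1 oppr_le0 mulr_ge0// ltW.
have E2 : (\int[lebesgue_measure]_(x in `]0%R, +oo[) (k x * (f x)%:E) +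
    \int[lebesgue_measure]_(x in `]0%R, +oo[) (g x * (f x)%:E) = 1)%E.
  rewrite -ge0_integralD//.
  - rewrite -jump_density_integral -[RHS](_ : (\int[lebesgue_measure]_x (1 * (f x)%:E) = _)%E).
      rewrite density_integral; apply: eq_integral => x _.
      by rewrite mul1e -!EFinM -EFinD; congr EFin; ring.
    by apply: eq_integral => x _; rewrite mul1e.
  - by move=> x _; rewrite mule_ge0// lee_fin.
  - by apply: measurable_funTS; apply: emeasurable_funM => //; exact/measurable_EFinP.
  - move=> x; rewrite /= in_itv/= andbT => x0.
    by rewrite mule_ge0 ?g0// lee_fin.
  - by apply: measurable_funTS; apply: emeasurable_funM => //; exact/measurable_EFinP.
have E3 : (\int[lebesgue_measure]_(x in `]0%R, +oo[) (g x * rho_Sigma PV V x) =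
    varrho%:E * \int[lebesgue_measure]_(x in `]0%R, +oo[) (g x * (f x)%:E))%E.
  rewrite -ge0_integralZl//.
  - apply: eq_integral => x; rewrite inE/= in_itv/= andbT => x0.
    by rewrite rho_Sigma_jump_density// EFinM muleCA.
  - by apply: measurable_funTS; apply: emeasurable_funM => //; exact/measurable_EFinP.
  - move=> x; rewrite /= in_itv/= andbT => x0.
    by rewrite mule_ge0 ?g0// lee_fin.
  - by rewrite lee_fin ltW.
have I0 : (0 <= \int[lebesgue_measure]_(x in `]0%R, +oo[) (g x * (f x)%:E))%E.
  by apply: integral_ge0 => x; rewrite /= in_itv/= andbT => x0; rewrite mule_ge0 ?g0// lee_fin.
have J0 : (0 <= \int[lebesgue_measure]_(x in `]0%R, +oo[) (k x * (f x)%:E))%E.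
  by apply: integral_ge0 => x _; rewrite mule_ge0// lee_fin.
rewrite E1 E3; move: E2 I0 J0.
case: (\int[lebesgue_measure]_(x in _) (k x * _))%E => [phi| |]//;
  case: (\int[lebesgue_measure]_(x in _) (g x * _))%E => [y| |]// [E2] _ _.
exists phi; split=> //; rewrite -EFinM; congr EFin; rewrite -E2; ring.
Qed.

(** Paths inherit monotonicity and right-continuity from the count, the jumps
    being nonnegative: the count is integer-valued, so right-continuity means
    that it is constant just after each time. *)
Lemma compound_poisson_levy d (T : measurableType d) (P : probability T R)
    (N : R -> T -> nat) (Delta : nat -> {RV P >-> R})
    dD (TD : measurableType dD) (PD : probability TD R) (X : {RV PD >-> R}) :
  has_density PD X f -> poisson_process P N ->
  mutual_indep P (fun k => Delta k : T -> R) ->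
  (forall k, eq_law P (Delta k) PD X) ->
  indep_process_seq P N (fun k => Delta k : T -> R) ->
  has_levy_density P (fun t w => partial_sum (fun k => Delta k : T -> R) (N (varrho * t) w) w)
    (rho_Sigma PV V).
Proof.
move=> dX hN iD eD iND.
set CP := fun t w => _.
have mX : measurable_fun setT X by [].
have mD k : measurable_fun setT (Delta k) by [].
have iDn n : indep_upto P n (fun k => Delta k : T -> R).
  exact: (mutual_indep_upto 0 n iD).
have eD0 k : eq_law P (Delta k) P (Delta 0%N).
  exact: (eq_law_trans (eD k) (eq_law_sym (eD 0%N))).
have rt0 t : 0 <= t -> 0 <= varrho * t by move=> t0; rewrite mulr_ge0// ltW.
have [mN [_ N0 Nmon _ _] _] := hN.
have D0 : {ae P, forall w k, 0 <= Delta k w}.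
  apply: ae_foralln => k.
  have h : {ae PD, forall w, `[0, +oo[%classic (X w)}.
    apply: (has_density_ae_in mX (measurable_itv _) _ dX) => x /=.
    rewrite in_itv/= andbT => /negP; rewrite -ltNge => x0.
    by rewrite /f /jump_density ltNge (ltW x0).
  have : {ae P, forall w, `[0, +oo[%classic (Delta k w)}.
    exact: (eq_law_ae_in (mD k) mX (measurable_itv _) (eD k) h).
  by apply: filterS => w; rewrite /= in_itv/= andbT.
have sub : subordinator P CP.
  split.
  - by move=> t t0; apply: (measurable_random_sum hN mD); exact: rt0.
  - apply: filterS N0 => w /eqP; rewrite pnatr_eq0 => /eqP n0.
    by rewrite /CP mulr0 n0 /partial_sum big_ord0.
  - apply: filterS2 D0 Nmon => w d0 [mon rc]; split.
      move=> s t s0 st; have : (N (varrho * s)%R w <= N (varrho * t)%R w)%N.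
        by rewrite -(ler_nat R); apply: mon; rewrite ?rt0// ler_pM2l.
      move=> Nst; rewrite -subr_ge0 /CP partial_sumB//.
      by apply: sumr_ge0.
    move=> t t0; apply/cvg_at_rightP => u [tu ut].
    have /cvg_at_rightP/(_ (fun n => varrho * u n)) := rc _ (rt0 _ t0).
    have H : (forall n, varrho * t < varrho * u n) /\
        varrho * u n @[n --> \oo] --> varrho * t.
      split=> [n|]; first by rewrite ltr_pM2l.
      by apply: cvgM => //; exact: cvg_cst.
    move=> /(_ H) /cvgrPdist_lt/(_ 1 ltr01) Hn.
    apply: cvg_near_cst; apply: filterS Hn => n.
    rewrite /CP; have [lt|gt|<-//] := ltngtP (N (varrho * t) w) (N (varrho * u n) w).
      rewrite distrC -natrB 1?ltnW// normr_nat -[ltRHS]/(1%:R) ltr_nat ltnS leqn0 subn_eq0.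
      by rewrite leqNgt lt.
    rewrite -natrB 1?ltnW// normr_nat -[ltRHS]/(1%:R) ltr_nat ltnS leqn0 subn_eq0.
    by rewrite leqNgt gt.
  - move=> t t0 tS.
    have tt0 i : 0 <= t i by elim: i => // i IH; exact: (le_trans IH (tS i)).
    apply: (random_sum_indep hN mD iDn eD0 iND (t := fun i => varrho * t i)).
      by move=> i; exact: rt0.
    by move=> i; rewrite ler_pM2l.
  - move=> s t s0 t0; have := random_sum_stationary hN mD iDn eD0 iND (rt0 _ s0) (rt0 _ t0).
    by rewrite -mulrDr.
split=> //; first exact: levy_density_rho_Sigma.
move=> t omega; rewrite le_eqVlt => /predU1P[<-|t0] o0.
  by rewrite subordinator_laplace0// mul0e oppe0 /= expR0.
have [phi [pE ->]] := laplace_jump o0 dX.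
have E : (\int[P]_w (expR (- (omega * Delta 0%N w)))%:E = phi%:E)%E.
  rewrite -pE; apply: (@ge0_eq_law_integral _ _ _ _ _ _ _ _ _ _ _
    (fun x => (expR (- (omega * x)))%:E)) => //.
  exact: measurable_laplace_kernel.
rewrite (random_sum_laplace hN mD iDn eD0 iND _ E) ?mulr_gt0//.
by rewrite -EFinM /=; congr (expR _)%:E; ring.
Qed.

End compound_poisson.

(** * The theorem *)

Theorem theorem6p2 (R : realType) (delta : R) (hdelta : 0 < delta)
    (dV : measure_display) (TV : measurableType dV) (PV : probability TV R)
    (V : {RV PV >-> R}) (hV : forall w, 0 <= V w <= 1)
    (dX : measure_display) (TX : measurableType dX) (PX : probability TX R)
    (X : {RV PX >-> \bar R})
    (hX : eq_law PX X PV (fun w => ((1 - V w)%:E / (V w)%:E)%E)) :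
  (* (i) *)
  [/\ forall (d : measure_display) (T : measurableType d)
         (P : probability T R) (G : R -> T -> R),
         gamma_subordinator P 1 delta^-1 G ->
         has_levy_density P G (fun s => (s^-1 * expR (- (s * delta)))%:E),
       forall (d : measure_display) (T : measurableType d)
         (P : probability T R) (Omega : R -> T -> R),
         is_GGC P 1 PV (fun w => V w / delta) Omega ->
         has_levy_density P Omega
           (fun s => ((s^-1)%:E * expect_exp_inv PV V (s * delta))%E),
       levy_density (rho_Sigma PV V),
       forall s : R, 0 < s ->
         ((s^-1 * expR (- (s * delta)))%:E =
          delta%:E * rho_Sigma PV V (s * delta)
          + (s^-1)%:E * expect_exp_inv PV V (s * delta))%E
     & forall s : R, 0 < s ->
         (rho_Sigma PV V s =
          (s^-1 * expR (- s))%:E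
          * (1 - \int[PX]_w expeR (- (s%:E * X w))))%E]
  (* (ii) *)
   /\ (forall varrho : R, 0 < varrho ->
        (varrho%:E = \int[PV]_w (- lne (V w)%:E))%E ->
        exists (f : R -> R) (dD : measure_display) (TD : measurableType dD)
          (PD : probability TD R) (Delta_e : {RV PD >-> R}),
          [/\ has_density PD Delta_e f,
              forall s : R, 0 < s -> rho_Sigma PV V s = (varrho * f s)%:E &
              forall (d : measure_display) (T : measurableType d)
                (P : probability T R) (N : R -> T -> nat)
                (Delta : nat -> {RV P >-> R}),
                poisson_process P N ->
                mutual_indep P (fun k => Delta k : T -> R) ->
                (forall k, eq_law P (Delta k) PD Delta_e) ->
                indep_process_seq P N (fun k => Delta k : T -> R) ->
                let CP := fun (t : R) (w : T) =>
                  \sum_(k < N (varrho * t) w) Delta k w in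
                has_levy_density P CP (rho_Sigma PV V) /\
                forall (dS : measure_display) (TS : measurableType dS)
                  (PS : probability TS R) (Sigma : R -> TS -> R),
                  has_levy_density PS Sigma (rho_Sigma PV V) ->
                  eq_fdd PS Sigma P CP])
  (* (iii) *)
   /\ (forall theta : R, 0 < theta ->
        (exists (d : measure_display) (T : measurableType d)
           (P : probability T R) (M : {RV P >-> R}),
           M_equation theta PV V P M) /\
        forall (dS : measure_display) (TS : measurableType dS)
          (PS : probability TS R) (Sigma : R -> TS -> R)
          (d : measure_display) (T : measurableType d) (P : probability T R)
          (S : {RV P >-> R}) (G : {RV P >-> R}) (M : {RV P >-> R})
          (dG : measure_display) (TG : measurableType dG)
          (PG : probability TG R) (gamma : {RV PG >-> R}),
          has_levy_density PS Sigma (rho_Sigma PV V) ->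
          has_density PG gamma (gamma_pdf theta 1) ->
          indep3 P S G M ->
          eq_law P S PS (Sigma theta) ->
          eq_law P G PG gamma ->
          M_equation theta PV V P M ->
          eq_law PG gamma P (fun w => S w + G w * M w)).
Proof.
have mV : measurable_fun setT V by [].
split; last split.
- split.
  + by move=> d T P G; exact: gamma_subordinator_levy.
  + by move=> d T P Omega; exact: GGC_levy.
  + exact: levy_density_rho_Sigma.
  + by move=> s s0; exact: levy_decomposition.
  + by move=> s s0; exact: rho_Sigma_ratio.
- move=> varrho r0 rE.
  have [PD [Delta_e dD]] := jump_variable hV r0 rE.
  exists (jump_density V varrho), _, (measurableTypeR R), PD, Delta_e; split=> //.
    by move=> s s0; exact: rho_Sigma_jump_density.
  move=> d T P N Delta hN iD eD iND CP.
  have LCP : has_levy_density P CP (rho_Sigma PV V).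
    exact: (compound_poisson_levy hV r0 rE dD hN iD eD iND).
  split=> // dS TS PS Sigma LS; exact: (levy_density_eq_fdd LS LCP).
- move=> theta t0; split; first exact: M_equation_solution.
  move=> dS TS PS Sigma d T P S G M dG TG PG gamma.
  exact: gamma_decomposition.
Qed.
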